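(* For every $r\ge 2$, the graph Houghton group $B_r$ is $1$-ended.
   Context: $\Gamma_r$ is the graph consisting of $r$ rays glued at a common origin $x_0$, with one loop attached at each positive integer point of each ray (no loop at $x_0$), subdivided as needed. $\mathrm{Map}(\Gamma_r)$ is the group of proper homotopy equivalences of $\Gamma_r$ modulo proper homotopy. $Y^1$ is a segment with three vertices and a loop at the middle one; its endpoints are $\partial_-Y^1,\partial_+Y^1$. Decompose $\Gamma_r=C\cup\bigcup_jY_j$ into subgraphs with disjoint interiors, with core $C$ a connected rank-0 subgraph containing $x_0$ with $r$ valence-one vertices, and pieces $Y_j\cong Y^1$, each disjoint from $C$ or meeting $C$ in the single point $\partial_-Y_j\in\partial C$; fix markings $\phi_j:Y_j\to Y^1$ (proper homotopy equivalences preserving $\partial_\pm$, with chosen homotopy inverses $\phi_j^{-1}$). A suited subgraph is a connected union of $C$ and finitely many pieces. $B_r=B(0,1,r)$ is the group of classes in $\mathrm{Map}(\Gamma_r)$ of proper homotopy equivalences $f$ for which there is a suited $Z$ with $f|_Z$ a proper homotopy equivalence onto its image, $f(Z)$ suited, and for every piece $Y_j\subset\overline{\Gamma_r\setminus Z}$ a piece $Y_i\subset\overline{\Gamma_r\setminus f(Z)}$ with $f(Y_j)=Y_i$ and $f|_{Y_j}=\phi_i^{-1}\phi_j$. (This group is finitely generated for $r\ge2$; the number of ends is that of a Cayley graph with respect to a finite generating set.) *)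

(* Defs.v *)
From HB Require Import structures.
From mathcomp Require Import all_boot all_order all_algebra.
From mathcomp Require Import generic_quotient.
From mathcomp Require Import all_classical all_reals topology normedtype.

Set Implicit Arguments.
Unset Strict Implicit.
Unset Printing Implicit Defensive.

Import Order.TTheory GRing.Theory Num.Theory.
Import numFieldNormedType.Exports.

Local Open Scope classical_set_scope.
Local Open Scope ring_scope.

(** * Proper maps and proper homotopies between subspaces

    A map from the subspace [A] of [X] to the subspace [B] of [Y] is
    represented by a function [X -> Y], of which only the values on [A]
    matter.  A subset of [B] is compact for the topology of [B] iff it is
    compact for that of [Y], so [proper_on A B] is properness for the subspace
    topologies. *)

Definition proper_on (X Y : topologicalType) (A : set X) (B : set Y)
    (f : X -> Y) : Prop :=
  [/\ {within A, continuous f}, {homo f : x / A x >-> B x} &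
      forall K : set Y, K `<=` B -> compact K -> compact (A `&` f @^-1` K)].

Definition cylinder (R : realType) (X : topologicalType) (A : set X) :
  set (R * X) := `[0, 1]%classic `*` A.
Arguments cylinder R {X} A.

(** Proper homotopy relative to [D]; [D := set0] gives plain proper homotopy. *)
Definition proper_homotopic (R : realType) (X Y : topologicalType)
    (A : set X) (B : set Y) (D : set X) (f g : X -> Y) : Prop :=
  exists H : R * X -> Y,
    [/\ proper_on (cylinder R A) B H,
        forall x, A x -> H (0, x) = f x,
        forall x, A x -> H (1, x) = g x &
        forall (t : R) x, `[0, 1]%classic t -> A x -> D x -> H (t, x) = f x].

Definition proper_heq (R : realType) (X Y : topologicalType)
    (A : set X) (B : set Y) (f : X -> Y) : Prop :=
  proper_on A B f /\
  exists g : Y -> X, [/\ proper_on B A g,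
    proper_homotopic R A A set0 (g \o f) id &
    proper_homotopic R B B set0 (f \o g) id].

Section ProperTheory.
Variable R : realType.
Implicit Types X Y Z : topologicalType.

Lemma within_comp X Y Z (A : set X) (B : set Y) (f : X -> Y) (g : Y -> Z) :
  {homo f : x / A x >-> B x} -> {within A, continuous f} ->
  {within B, continuous g} -> {within A, continuous (g \o f)}.
Proof.
move=> fAB /subspace_continuousP cf /subspace_continuousP cg.
apply/subspace_continuousP => x Ax U /(cg _ (fAB _ Ax)).
rewrite /nbhs/= /within/= => gU; have := cf x Ax _ gU.
rewrite /nbhs/= /within/=; apply: filterS => y h Ay.
by apply: h => //; exact: fAB.
Qed.

Lemma within_eq X Y (A : set X) (f g : X -> Y) :
  (forall x, A x -> f x = g x) ->
  {within A, continuous f} -> {within A, continuous g}.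
Proof. by move=> fg; apply: subspace_eq_continuous => x /set_mem /fg. Qed.

Lemma proper_on_id X (A : set X) : proper_on A A id.
Proof.
split=> //; first by apply: continuous_subspaceT => x; exact: cvg_id.
by move=> K KA cK; rewrite setIidr.
Qed.

Lemma proper_on_comp X Y Z (A : set X) (B : set Y) (C : set Z) f g :
  proper_on A B f -> proper_on B C g -> proper_on A C (g \o f).
Proof.
move=> [cf fAB pf] [cg gBC pg]; split.
- exact: within_comp fAB cf cg.
- by move=> x /fAB /gBC.
- move=> K KC cK; have := pf _ (@subIsetl _ _ _) (pg _ KC cK).
  congr compact; apply/seteqP; split=> x /=; first by case=> ? [].
  by move=> [Ax Kx]; split=> //; split=> //; exact: fAB.
Qed.

Lemma proper_on_eq X Y (A : set X) (B : set Y) f g :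
  (forall x, A x -> f x = g x) -> proper_on A B f -> proper_on A B g.
Proof.
move=> fg [cf fAB pf]; split.
- exact: within_eq cf.
- by move=> x Ax; rewrite -fg//; exact: fAB.
- move=> K KB cK; have := pf K KB cK; congr compact.
  by apply/seteqP; split=> x /= [Ax]; rewrite fg.
Qed.

Lemma proper_on_snd X (A : set X) :
  proper_on (cylinder R A) A snd.
Proof.
split.
- by apply: continuous_subspaceT => x; exact: cvg_snd.
- by move=> [t x] [].
- move=> K KA cK.
  have -> : cylinder R A `&` snd @^-1` K = cylinder R K.
    by rewrite /cylinder; apply/seteqP; split=> -[t x] /=; [case=> -[]|case=> ? /[dup] /KA].
  by apply: compact_setX => //; exact: segment_compact.
Qed.

Lemma proper_homotopic_refl X Y (A : set X) (B : set Y) D f :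
  proper_on A B f -> proper_homotopic R A B D f f.
Proof.
move=> pf; exists (f \o snd); split=> //.
exact: proper_on_comp (@proper_on_snd _ _) pf.
Qed.

Lemma continuous_time X (a b : R) :
  continuous (fun p : R * X => (a * p.1 + b, p.2)).
Proof.
move=> p.
apply: (@cvg_pair _ _ _ _ (nbhs _) (nbhs _)) => /=; last exact: cvg_snd.
apply: cvgD; last exact: cvg_cst.
by apply: cvgM; [exact: cvg_cst|exact: cvg_fst].
Qed.

Lemma proper_homotopic_sym X Y (A : set X) (B : set Y) D f g :
  proper_homotopic R A B D f g -> proper_homotopic R A B D g f.
Proof.
move=> [H [pH H0 H1 HD]].
have I01 (t : R) : `[0, 1]%classic t -> `[0, 1]%classic (1 - t).
  by rewrite /= !in_itv /= subr_ge0 gerBl => /andP[-> ->].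
pose s (p : R * X) := (-1 * p.1 + 1, p.2).
have sE t x : s (t, x) = (1 - t, x) by rewrite /s /= mulN1r addrC.
have ss p : s (s p) = p by case: p => t x; rewrite !sE subKr.
have cs : continuous s by exact: continuous_time.
exists (H \o s); split.
- apply: proper_on_comp pH; split.
  + exact: continuous_subspaceT.
  + by move=> [t x] [/= /I01 t01 Ax]; rewrite sE.
  + move=> K KA cK.
    have -> : cylinder R A `&` s @^-1` K = s @` K.
      apply/seteqP; split=> [p [_ Kp]|_ [p Kp <-]]; first by exists (s p).
      split; last by rewrite /= ss.
      by case: p Kp => t x /KA [/= /I01 t01 Ax]; rewrite sE.
    by apply: continuous_compact => //; exact: continuous_subspaceT.
- by move=> x Ax /=; rewrite /= sE subr0 H1.
- by move=> x Ax /=; rewrite /= sE subrr H0.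
- move=> t x t01 Ax Dx; rewrite /= sE (HD _ _ (I01 t t01) Ax Dx).
  by rewrite -H1// (HD 1)//= in_itv /= ler01 lexx.
Qed.

Lemma proper_homotopic_trans X Y (A : set X) (B : set Y) D f g h :
  proper_homotopic R A B D f g -> proper_homotopic R A B D g h ->
  proper_homotopic R A B D f h.
Proof.
move=> [H [[cH HB pH] H0 H1 HD]] [G [[cG GB pG] G0 G1 GD]].
pose a (p : R * X) := (2 * p.1 + 0, p.2).
pose b (p : R * X) := (2 * p.1 + -1, p.2).
pose a' (p : R * X) := (2^-1 * p.1 + 0, p.2).
pose b' (p : R * X) := (2^-1 * p.1 + 2^-1, p.2).
have ca : continuous a by exact: continuous_time.
have cb : continuous b by exact: continuous_time.
have ca' : continuous a' by exact: continuous_time.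
have cb' : continuous b' by exact: continuous_time.
have n2 : (2 : R) != 0 by rewrite pnatr_eq0.
have a'K p : a (a' p) = p by rewrite /a /a' /= !addr0 mulrA divff// mul1r; case: p.
have aK p : a' (a p) = p by rewrite /a /a' /= !addr0 mulrA mulVf// mul1r; case: p.
have b'K p : b (b' p) = p.
  rewrite /b /b' /= mulrDr mulrA !divff// mul1r addrK; by case: p.
have bK p : b' (b p) = p.
  by rewrite /b /b' /= mulrDr mulrA mulVf// mul1r mulrN1 subrK; case: p.
pose L := `[0, 2^-1]%classic `*` A : set (R * X).
pose U := `[2^-1, 1]%classic `*` A : set (R * X).
have h0 : (0 : R) <= 2^-1 by rewrite invr_ge0.
have h1 : (2^-1 : R) <= 1 by rewrite invf_le1// ler1n.
have CP t x : cylinder R A (t, x) = (0 <= t <= 1 /\ A x).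
  by rewrite /cylinder /setX /= in_itv.
have LP t x : L (t, x) = (0 <= t <= 2^-1 /\ A x).
  by rewrite /L /setX /= in_itv.
have UP t x : U (t, x) = (2^-1 <= t <= 1 /\ A x).
  by rewrite /U /setX /= in_itv.
have LU : cylinder R A = L `|` U.
  apply/seteqP; split=> -[t x]; rewrite /setU /= CP LP UP.
    move=> [/andP[t0 t1] Ax].
    by have [le|/ltW le] := leP t 2^-1; [left|right]; rewrite ?t0 ?t1 ?le.
  case=> -[/andP[u v] Ax]; split=> //; rewrite ?u ?v ?andbT //=.
    exact: le_trans v _.
  exact: le_trans u.
have La p : L p -> (cylinder R A) (a p).
  case: p => t x; rewrite CP LP => -[/andP[t0 t1] Ax]; split=> //=.
  by rewrite addr0 mulr_ge0//= mulrC -ler_pdivlMr// mul1r.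
have Ub p : U p -> (cylinder R A) (b p).
  case: p => t x; rewrite CP UP => -[/andP[t0 t1] Ax]; split=> //=.
  rewrite subr_ge0 mulrC -ler_pdivrMr// mul1r t0 /= lerBlDr.
  by rewrite -[1 + 1]/(2%:R) ler_piMl.
have La' p : (cylinder R A) p -> L (a' p).
  case: p => t x; rewrite CP LP => -[/andP[t0 t1] Ax]; split=> //=.
  by rewrite addr0 mulr_ge0//= ler_piMr.
have Ub' p : (cylinder R A) p -> U (b' p).
  case: p => t x; rewrite CP UP => -[/andP[t0 t1] Ax]; split=> //=.
  rewrite lerDr mulr_ge0//=.
  rewrite (le_trans (lerD (ler_piMr h0 t1) (lexx _)))//.
  by rewrite -mulr2n -[_ *+ 2]mulr_natr mulVf.
pose F (p : R * X) := if p.1 <= 2^-1 then H (a p) else G (b p).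
have FL p : L p -> F p = H (a p).
  by case: p => t x; rewrite LP /F /= => -[/andP[_ ->]].
have FU p : U p -> F p = G (b p).
  case: p => t x; rewrite UP /F /= => -[/andP[t0 _] Ax].
  case: ifPn => // t1.
  have -> : t = 2^-1 by apply/le_anti; rewrite t0 t1.
  by rewrite /a /b /= addr0 divff// subrr H1// G0.
have cL : {within L, continuous F}.
  apply: (@within_eq _ _ _ (H \o a)); first by move=> p /FL.
  by apply: within_comp cH => //; exact: continuous_subspaceT.
have cU : {within U, continuous F}.
  apply: (@within_eq _ _ _ (G \o b)); first by move=> p /FU.
  by apply: within_comp cG => //; exact: continuous_subspaceT.
exists F; split.
- rewrite LU; split.
  + apply/subspace_continuousP => p LUp W nW.
    have nL : within L (nbhs p) (F @^-1` W).
      have [Lp|nLp] := pselect (L p).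
        by move/subspace_continuousP : cL => /(_ p Lp W nW).
      have {}LUp : U p by case: LUp.
      have lt : 2^-1 < p.1.
        case: p LUp nLp {nW} => t x; rewrite LP UP => -[/andP[t0 _] Ax] nL /=.
        rewrite lt_neqAle t0 andbT; apply/negP => /eqP e; apply: nL.
        by rewrite -e h0 lexx.
      have : nbhs p [set q : R * X | 2^-1 < q.1].
        apply: (@cvg_fst _ _ (nbhs p.1) (nbhs p.2) _ [set t | 2^-1 < t]).
        exact: lt_nbhsr.
      rewrite /within /=; apply: filterS => -[t x] /= lq.
      by rewrite LP [t <= _]leNgt lq andbF => -[].
    have nU : within U (nbhs p) (F @^-1` W).
      have [Up|nUp] := pselect (U p).
        by move/subspace_continuousP : cU => /(_ p Up W nW).
      have {}LUp : L p by case: LUp.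
      have lt : p.1 < 2^-1.
        case: p LUp nUp {nW nL} => t x; rewrite LP UP => -[/andP[_ t0] Ax] nL /=.
        rewrite lt_neqAle t0 andbT; apply/negP => /eqP e; apply: nL.
        by rewrite e h1 lexx.
      have : nbhs p [set q : R * X | q.1 < 2^-1].
        apply: (@cvg_fst _ _ (nbhs p.1) (nbhs p.2) _ [set t | t < 2^-1]).
        exact: lt_nbhsl.
      rewrite /within /=; apply: filterS => -[t x] /= lq.
      by rewrite UP [_ <= t]leNgt lq => -[].
    move: nL nU; rewrite /nbhs /= /within /= => nL nU.
    by apply: filterS2 nL nU => q /= qL qU [/qL|/qU].
  + by move=> p [Lp|Up]; [rewrite FL//; exact/HB/La|rewrite FU//; exact/GB/Ub].
  + move=> K KB cK.
    have -> : (L `|` U) `&` F @^-1` K =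
       a' @` (cylinder R A `&` H @^-1` K) `|` b' @` (cylinder R A `&` G @^-1` K).
      apply/seteqP; split=> [p [[Lp|Up]]|p [] [q [Aq /= Kq] <-]].
      * by rewrite /= FL// => Kp; left; exists (a p) => //; split => //; exact: La.
      * by rewrite /= FU// => Kp; right; exists (b p) => //; split => //; exact: Ub.
      * by split; [left; exact: La'|rewrite /= FL ?a'K//; exact: La'].
      * by split; [right; exact: Ub'|rewrite /= FU ?b'K//; exact: Ub'].
    apply: compactU; apply: continuous_compact.
    * exact: continuous_subspaceT.
    * exact: pH.
    * exact: continuous_subspaceT.
    * exact: pG.
- by move=> x Ax; rewrite /F /= h0 /a /= mulr0 addr0 H0.
- move=> x Ax; rewrite FU; last by rewrite UP h1 lexx.
  by rewrite /b /= mulr1 (_ : 2 - 1 = 1) ?G1// -[2]/(1 + 1) addrK.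
- move=> t x t01 Ax Dx; rewrite /F /=.
  have e : f x = g x by rewrite -H1// (HD 1)//= in_itv /= ler01 lexx.
  have : (L `|` U) (t, x) by rewrite -LU.
  case=> [p|p].
    by rewrite -[LHS]/(F (t, x)) (FL _ p); apply: HD => //; case: (La _ p).
  by rewrite -[LHS]/(F (t, x)) (FU _ p) e; apply: GD => //; case: (Ub _ p).
Qed.

Lemma hausdorff_prod X Y :
  hausdorff_space X -> hausdorff_space Y -> hausdorff_space (X * Y)%type.
Proof.
move=> hX hY [x y] [x' y'] cl; congr pair.
- apply: hX => U V nU nV.
  have [] := cl (fst @^-1` U) (fst @^-1` V) (cvg_fst nU) (cvg_fst nV).
  by move=> -[u v] [/= Uu Vu]; exists u.
- apply: hY => U V nU nV.
  have [] := cl (snd @^-1` U) (snd @^-1` V) (cvg_snd nU) (cvg_snd nV).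
  by move=> -[u v] [/= Uu Vu]; exists v.
Qed.

Lemma proper_homotopic_compl X Y Z (A : set X) (B : set Y) (C : set Z) D f g k :
  proper_homotopic R A B D f g -> proper_on B C k ->
  proper_homotopic R A C D (k \o f) (k \o g).
Proof.
move=> [H [pH H0 H1 HD]] pk; exists (k \o H); split => //.
- exact: proper_on_comp pH pk.
- by move=> x Ax; rewrite /= H0.
- by move=> x Ax; rewrite /= H1.
- by move=> t x t01 Ax Dx; rewrite /= HD.
Qed.

Lemma compact_within_preimage X Y (M : set X) (L : set Y) (f : X -> Y) :
  compact M -> {within M, continuous f} -> closed L ->
  compact (M `&` f @^-1` L).
Proof.
move=> cM /subspace_continuousP cf cL F FF FML.
have [p [Mp Fp]] := cM F FF (filterS (@subIsetl _ _ _) FML).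
exists p; split => //; split => //; apply: contrapT => nLp.
have /(cf p Mp) : nbhs (f p) (~` L).
  by apply: open_nbhs_nbhs; split => //; exact: closed_openC.
rewrite /nbhs /= /within /= => nL.
by have [q [[Mq Lq] /(_ Mq)]] := Fp _ _ FML nL.
Qed.

Lemma within_pair X Y Z (A : set X) (f : X -> Y) (g : X -> Z) :
  {within A, continuous f} -> {within A, continuous g} ->
  {within A, continuous (fun x => (f x, g x))}.
Proof.
by move=> cf cg x; apply: (@cvg_pair _ _ _ _ (nbhs _) (nbhs _)); [exact: cf|exact: cg].
Qed.

Lemma proper_on_cylinder X Y (A : set X) (B : set Y) k :
  hausdorff_space Y -> proper_on A B k ->
  proper_on (cylinder R A) (cylinder R B) (fun p : R * X => (p.1, k p.2)).
Proof.
move=> hY [ck kAB pk].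
have cm : {within cylinder R A, continuous (fun p : R * X => (p.1, k p.2))}.
  apply: within_pair; first by apply: continuous_subspaceT => p; exact: cvg_fst.
  apply: (@within_comp _ _ _ _ A snd) => //; first by move=> p [].
  by apply: continuous_subspaceT => p; exact: cvg_snd.
split=> //; first by move=> [t x] [/= t01 Ax]; split => //; exact: kAB.
move=> K KB cK.
have csK : compact (snd @` K).
  by apply: continuous_compact => //; apply: continuous_subspaceT => p; exact: cvg_snd.
have sKB : snd @` K `<=` B by move=> _ [p /KB [_ Bp] <-].
have -> : cylinder R A `&` (fun p : R * X => (p.1, k p.2)) @^-1` K =
    cylinder R (A `&` k @^-1` (snd @` K)) `&` (fun p : R * X => (p.1, k p.2)) @^-1` K.
  apply/seteqP; split=> -[t x] [[/= t01]]; last by move=> [].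
  by move=> Ax Kx; split=> //; split=> //; split=> //; exists (t, k x).
apply: compact_within_preimage.
- by apply: compact_setX; [exact: segment_compact|exact: pk].
- by apply: continuous_subspaceW cm => -[t x] [t01 []].
- by apply: compact_closed => //; apply: hausdorff_prod => //; exact: Rhausdorff.
Qed.

Lemma proper_homotopic_compr X Y Z (A : set X) (B : set Y) (C : set Z) k f g :
  hausdorff_space Y -> proper_on A B k -> proper_homotopic R B C set0 f g ->
  proper_homotopic R A C set0 (f \o k) (g \o k).
Proof.
move=> hY pk [H [pH H0 H1 HD]]; exists (H \o (fun p : R * X => (p.1, k p.2))).
have [_ kAB _] := pk.
split => //.
- exact: proper_on_comp (proper_on_cylinder hY pk) pH.
- by move=> x Ax; rewrite /= H0//; exact: kAB.
- by move=> x Ax; rewrite /= H1//; exact: kAB.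
Qed.

Lemma proper_heq_id X (A : set X) : proper_heq R A A id.
Proof.
have pI := @proper_on_id X A; split=> //; exists id; split=> //;
  exact: proper_homotopic_refl pI.
Qed.

Lemma proper_heq_comp X Y Z (A : set X) (B : set Y) (C : set Z) f g :
  hausdorff_space X -> hausdorff_space Y -> hausdorff_space Z ->
  proper_heq R A B f -> proper_heq R B C g -> proper_heq R A C (g \o f).
Proof.
move=> hX hY hZ [pf [f' [pf' f'f ff']]] [pg [g' [pg' g'g gg']]].
split; first exact: proper_on_comp pf pg.
exists (f' \o g'); split; first exact: proper_on_comp pg' pf'.
- apply: proper_homotopic_trans f'f.
  have := proper_homotopic_compl (proper_homotopic_compr hY pf g'g) pf'.
  by [].
- apply: proper_homotopic_trans gg'.
  have := proper_homotopic_compl (proper_homotopic_compr hY pg' ff') pg.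
  by [].
Qed.

End ProperTheory.

(** * The group of proper homotopy equivalences modulo proper homotopy *)

Record phe (R : realType) (X : normedModType R) (A : set X) := Phe {
  phe_fun :> X -> X;
  pheP : proper_heq R A A phe_fun }.

Section MappingClassGroup.
Variables (R : realType) (X : normedModType R) (A : set X).
Local Open Scope quotient_scope.

HB.instance Definition _ := gen_eqMixin (phe A).
HB.instance Definition _ := gen_choiceMixin (phe A).

Implicit Types f g : phe A.

Definition phe_rel f g : bool := `[< proper_homotopic R A A set0 f g >].

Lemma phe_rel_refl : reflexive phe_rel.
Proof.
by move=> f; apply/asboolP/proper_homotopic_refl; case: (pheP f).
Qed.

Lemma phe_rel_sym : symmetric phe_rel.
Proof.
by move=> f g; apply/asboolP/asboolP; exact: proper_homotopic_sym.
Qed.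

Lemma phe_rel_trans : transitive phe_rel.
Proof.
move=> g f h /asboolP fg /asboolP gh; apply/asboolP.
exact: proper_homotopic_trans fg gh.
Qed.

Canonical phe_equiv := EquivRel phe_rel phe_rel_refl phe_rel_sym phe_rel_trans.

Definition mcg := {eq_quot phe_equiv}.

HB.instance Definition _ := Choice.on mcg.
HB.instance Definition _ := EqQuotient.on mcg.

Definition mclass f : mcg := \pi_mcg f.

Lemma mclassP f g : mclass f = mclass g <-> proper_homotopic R A A set0 f g.
Proof. by split=> [/eqmodP/asboolP|fg]; last exact/eqmodP/asboolP. Qed.

Lemma mclass_repr (x : mcg) : mclass (repr x) = x.
Proof. exact: reprK. Qed.

Definition phe_one : phe A := Phe (@proper_heq_id R X A).

Lemma phe_comp_subproof f g : proper_heq R A A (f \o g).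
Proof.
by apply: (@proper_heq_comp _ _ _ _ A A A) (pheP g) (pheP f);
  exact: norm_hausdorff.
Qed.

Definition phe_comp f g : phe A := Phe (phe_comp_subproof f g).

Lemma phe_inv_subproof f : exists g : phe A,
  proper_homotopic R A A set0 (g \o f) id /\
  proper_homotopic R A A set0 (f \o g) id.
Proof.
case: (pheP f) => pf [g [pg gf fg]].
suff hg : proper_heq R A A g by exists (Phe hg).
by split=> //; exists f.
Qed.

Definition phe_inv f : phe A := projT1 (cid (phe_inv_subproof f)).

Definition mcg_one : mcg := mclass phe_one.
Definition mcg_mul (x y : mcg) : mcg := mclass (phe_comp (repr x) (repr y)).
Definition mcg_inv (x : mcg) : mcg := mclass (phe_inv (repr x)).

Lemma mclass_comp f g : mclass (phe_comp f g) = mcg_mul (mclass f) (mclass g).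
Proof.
have /mclassP ff := mclass_repr (mclass f).
have /mclassP gg := mclass_repr (mclass g).
have [pf _] := pheP f; have [pg _] := pheP (repr (mclass g)).
apply/esym/mclassP => /=; apply: (@proper_homotopic_trans _ _ _ _ _ _ _ (f \o repr (mclass g))).
  by apply: proper_homotopic_compr ff => //; exact: norm_hausdorff.
exact: proper_homotopic_compl gg pf.
Qed.

Lemma mcg_mulA : associative mcg_mul.
Proof.
move=> x y z; rewrite -(mclass_repr x) -(mclass_repr y) -(mclass_repr z).
rewrite -!mclass_comp; apply/mclassP/proper_homotopic_refl.
exact: (phe_comp_subproof _ (phe_comp _ _)).1.
Qed.

Lemma mcg_mul1 : left_id mcg_one mcg_mul.
Proof.
move=> x; rewrite -(mclass_repr x) -mclass_comp.
by apply/mclassP/proper_homotopic_refl; exact: (pheP (repr x)).1.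
Qed.

Lemma mcg_mulr1 : right_id mcg_one mcg_mul.
Proof.
move=> x; rewrite -(mclass_repr x) -mclass_comp.
by apply/mclassP/proper_homotopic_refl; exact: (pheP (repr x)).1.
Qed.

Lemma mcg_mulV : left_inverse mcg_one mcg_inv mcg_mul.
Proof.
move=> x; rewrite -{2}(mclass_repr x) -mclass_comp; apply/mclassP.
by rewrite /phe_inv; case: cid => g [].
Qed.

Lemma mcg_mulrV : right_inverse mcg_one mcg_inv mcg_mul.
Proof.
move=> x; rewrite -{1}(mclass_repr x) -mclass_comp; apply/mclassP.
by rewrite /phe_inv; case: cid => g [].
Qed.

HB.instance Definition _ :=
  isGroup.Build mcg mcg_mulA mcg_mul1 mcg_mulr1 mcg_mulV mcg_mulrV.

End MappingClassGroup.

(** * Ends of graphs and Cayley graphs *)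

Section Ends.
Variables (V : Type) (adj : V -> V -> Prop).

Definition ray (w : nat -> V) : Prop :=
  injective w /\ forall n, adj (w n) (w n.+1).

Definition joined_off (F : set V) (u v : V) : Prop :=
  exists (n : nat) (p : nat -> V), [/\ p 0%N = u, p n = v,
    forall k, (k < n)%N -> adj (p k) (p k.+1) &
    forall k, (k <= n)%N -> ~ F (p k)].

Definition equivalent_rays (w w' : nat -> V) : Prop :=
  forall F : set V, finite_set F -> exists N : nat,
    forall m n, (N <= m)%N -> (N <= n)%N -> joined_off F (w m) (w' n).

Definition ends : set (set (nat -> V)) :=
  [set [set w' | ray w' /\ equivalent_rays w w'] | w in ray].

Definition number_of_ends (n : nat) : Prop := (ends #= `I_n)%card.

End Ends.

Section Cayley.
Variable G : groupType.
Local Open Scope group_scope.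

Definition is_subgroup (H : set G) : Prop :=
  [/\ H 1, forall g h, H g -> H h -> H (g * h) & forall g, H g -> H g^-1].

Definition generated_by (S : set G) : set G := smallest is_subgroup S.

(** The vertices are the elements of [H]; [S] is meant to generate [H]. *)
Definition cayley (H S : set G) (g h : H) : Prop :=
  exists2 s, S s & (val h = val g * s \/ val g = val h * s).

End Cayley.

Arguments cayley {G} H S g h.

(** * The graphs Gamma_r *)

Section Graph.
Variables (R : realType) (r : nat).

(** Gamma_r is realised as a closed subset of [R^r * R]: the [i]-th ray is the
    half-axis spanned by the [i]-th basis vector, at height [0], and the loop at
    its point [k >= 1] is the circle of radius [1/4] tangent to it at that point
    in the plane spanned by the ray and the vertical direction. *)
Local Notation ambient := ('rV[R]_r * R)%type.

Definition ray_plane (i : 'I_r) (q : R * R) : ambient :=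
  (q.1 *: delta_mx 0 i, q.2).

Definition half_line : set (R * R) := [set q | 0 <= q.1 /\ q.2 = 0].
Definition base_segment (a b : R) : set (R * R) :=
  [set q | a <= q.1 <= b /\ q.2 = 0].
Definition loop_at (k : nat) : set (R * R) :=
  [set q | (q.1 - k%:R) ^+ 2 + (q.2 - 4^-1) ^+ 2 = 4^-1 ^+ 2].

Definition Gamma : set ambient :=
  \bigcup_i ray_plane i @`
    (half_line `|` \bigcup_(k in [set k | (0 < k)%N]) loop_at k).

Definition map_Gamma : groupType := mcg Gamma.

(** The model piece [Y^1], with vertices at [-1/2], [0] and [1/2]. *)
Definition Y1 : set (R * R) := base_segment (- 2^-1) 2^-1 `|` loop_at 0.
Definition Y1_minus : R * R := (- 2^-1, 0).
Definition Y1_plus : R * R := (2^-1, 0).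

(** A decomposition of Gamma_r into a core and pieces amounts to the choice of
    the points [cut i k], [k < cut i k < k + 1], at which the [i]-th ray is cut.
    The core is the star around the origin; the piece [(i, k)] consists of the
    part of the [i]-th ray between [cut i k] and [cut i k.+1] and of the loop at
    the point [k + 1] in between, and its [-] end is the one towards the core. *)
Section Decomposition.
Variable cut : 'I_r -> nat -> R.

Definition core : set ambient :=
  \bigcup_i ray_plane i @` base_segment 0 (cut i 0%N).

Definition piece (j : 'I_r * nat) : set ambient :=
  ray_plane j.1 @`
    (base_segment (cut j.1 j.2) (cut j.1 j.2.+1) `|` loop_at j.2.+1).

Definition piece_minus (j : 'I_r * nat) : ambient :=
  ray_plane j.1 (cut j.1 j.2, 0).
Definition piece_plus (j : 'I_r * nat) : ambient :=
  ray_plane j.1 (cut j.1 j.2.+1, 0).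

Definition suited (Z : set ambient) : Prop :=
  connected Z /\
  exists2 F : set ('I_r * nat), finite_set F &
    Z = core `|` \bigcup_(j in F) piece j.

End Decomposition.

(** A decomposition with markings [mark j] of its pieces, and chosen homotopy
    inverses [unmark j].  The homotopies are relative to the two boundary points,
    so that the maps [unmark i \o mark j] compose up to homotopies which agree on
    adjacent pieces. *)
Record rigid_structure := RigidStructure {
  cut : 'I_r -> nat -> R;
  cut_bounds : forall i k, k%:R < cut i k < k.+1%:R;
  mark : 'I_r * nat -> ambient -> R * R;
  unmark : 'I_r * nat -> R * R -> ambient;
  mark_proper : forall j, proper_on (piece cut j) Y1 (mark j);
  unmark_proper : forall j, proper_on Y1 (piece cut j) (unmark j);
  mark_boundary : forall j,
    mark j (piece_minus cut j) = Y1_minus /\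
    mark j (piece_plus cut j) = Y1_plus;
  unmark_boundary : forall j,
    unmark j Y1_minus = piece_minus cut j /\
    unmark j Y1_plus = piece_plus cut j;
  unmark_mark : forall j, proper_homotopic R (piece cut j) (piece cut j)
    [set piece_minus cut j; piece_plus cut j] (unmark j \o mark j) id;
  mark_unmark : forall j, proper_homotopic R Y1 Y1
    [set Y1_minus; Y1_plus] (mark j \o unmark j) id }.

(** Rigid structures exist: cut the rays at the half-integers and mark the
    pieces by translations. *)
Section Standard.
Let cut0 (_ : 'I_r) (k : nat) : R := k%:R + 2^-1.
Let mark0 (j : 'I_r * nat) (p : ambient) : R * R :=
  (p.1 0 j.1 - j.2.+1%:R, p.2).
Let unmark0 (j : 'I_r * nat) (q : R * R) : ambient :=
  ray_plane j.1 (q.1 + j.2.+1%:R, q.2).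

Let mark0E j q : mark0 j (ray_plane j.1 q) = (q.1 - j.2.+1%:R, q.2).
Proof. by rewrite /mark0 /= !mxE !eqxx mulr1. Qed.

Let unmark0K j q : mark0 j (unmark0 j q) = q.
Proof. by rewrite mark0E /= addrK; case: q. Qed.

Let mark0K j q : unmark0 j (mark0 j (ray_plane j.1 q)) = ray_plane j.1 q.
Proof. by rewrite mark0E /unmark0 /= subrK; case: q. Qed.

Let halfD : (2^-1 + 2^-1 : R) = 1.
Proof. by rewrite -mulr2n -[_ *+ 2]mulr_natr mulVf// pnatr_eq0. Qed.

Let cut0E i k : cut0 i k = - 2^-1 + k.+1%:R.
Proof.
have e : - 2^-1 + 1 = 2^-1 :> R by rewrite -[X in _ + X]halfD addKr.
by rewrite /cut0 -[k.+1%:R]natr1 addrCA e.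
Qed.

Let pieceE j q :
  (base_segment (cut0 j.1 j.2) (cut0 j.1 j.2.+1) `|` loop_at j.2.+1) q =
  Y1 (q.1 - j.2.+1%:R, q.2).
Proof.
rewrite /Y1 /setU /base_segment /loop_at /= subr0.
by rewrite lerBrDr lerBlDr cut0E /cut0 [2^-1 + _]addrC.
Qed.

Let unmark0_piece j q : Y1 q -> piece cut0 j (unmark0 j q).
Proof.
move=> Yq; exists (q.1 + j.2.+1%:R, q.2) => //.
by rewrite pieceE /= addrK; case: q Yq.
Qed.

Let piece0P j p : piece cut0 j p -> Y1 (mark0 j p) /\ unmark0 j (mark0 j p) = p.
Proof. by move=> [q + <-]; rewrite pieceE mark0K mark0E. Qed.

Let continuous_mark0 j : continuous (mark0 j).
Proof.
move=> p; apply: (@cvg_pair _ _ _ _ (nbhs _) (nbhs _)); last exact: cvg_snd.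
apply: cvgB; last exact: cvg_cst.
apply: (@cvg_comp _ _ _ fst (fun x : 'rV[R]_r => x 0 j.1) _ (nbhs p.1)).
  exact: cvg_fst.
exact: coord_continuous.
Qed.

Let continuous_unmark0 j : continuous (unmark0 j).
Proof.
move=> q; apply: (@cvg_pair _ _ _ _ (nbhs _) (nbhs _)); last exact: cvg_snd.
apply: cvgZr_tmp; apply: cvgD; last exact: cvg_cst.
exact: cvg_fst.
Qed.

Let mark0_proper j : proper_on (piece cut0 j) Y1 (mark0 j).
Proof.
split; first exact/continuous_subspaceT/continuous_mark0.
  by move=> p /piece0P[].
move=> K KY cK.
have -> : piece cut0 j `&` mark0 j @^-1` K = unmark0 j @` K.
  apply/seteqP; split=> [p [/piece0P[_ e] Kp]|_ [q Kq <-]].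
    by exists (mark0 j p).
  by split; [exact/unmark0_piece/KY|rewrite /= unmark0K].
apply: continuous_compact => //.
exact/continuous_subspaceT/continuous_unmark0.
Qed.

Let unmark0_proper j : proper_on Y1 (piece cut0 j) (unmark0 j).
Proof.
split; first exact/continuous_subspaceT/continuous_unmark0.
  by move=> p; exact: unmark0_piece.
move=> K KY cK.
have -> : Y1 `&` unmark0 j @^-1` K = mark0 j @` K.
  apply/seteqP; split=> [q [_ Kq]|_ [p Kp <-]].
    by exists (unmark0 j q); rewrite ?unmark0K.
  by have [Yp e] := piece0P (KY _ Kp); split; rewrite //= e.
apply: continuous_compact => //.
exact/continuous_subspaceT/continuous_mark0.
Qed.

Lemma rigid_structure_inhabited : inhabited rigid_structure.
Proof.
have eq_homotopic (T : topologicalType) (A E : set T) f :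
    (forall x, A x -> f x = x) -> proper_homotopic R A A E f id.
  move=> fE; exists snd; split=> //; first exact: proper_on_snd.
  - by move=> x /fE.
  - by move=> t x _ /fE.
have half_gt0 : 0 < 2^-1 :> R by rewrite invr_gt0 ltr0n.
apply: inhabits; apply: (@RigidStructure cut0 _ mark0 unmark0) => //.
- move=> i k; rewrite ltrDl half_gt0 /= /cut0 -[k.+1%:R]natr1 ltrD2l.
  by rewrite invf_lt1// ltr1n.
- move=> j; rewrite !mark0E cut0E /= addrK.
  by rewrite /cut0 [X in X - _]addrC addrK.
- move=> j; rewrite /unmark0 /= /piece_minus /piece_plus cut0E.
  by rewrite /cut0 [2^-1 + _]addrC.
- by move=> j; apply: eq_homotopic => p /piece0P[].
- by move=> j; apply: eq_homotopic => q _; exact: unmark0K.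
Qed.

End Standard.

Section Houghton.
Variable D : rigid_structure.

Definition asymptotically_rigid (f : ambient -> ambient) : Prop :=
  exists Z : set ambient, [/\ suited (cut D) Z, suited (cut D) (f @` Z),
    proper_heq R Z (f @` Z) f &
    forall j, piece (cut D) j `<=` closure (Gamma `\` Z) ->
      exists i, [/\ piece (cut D) i `<=` closure (Gamma `\` f @` Z),
        f @` piece (cut D) j = piece (cut D) i &
        forall x, piece (cut D) j x -> f x = unmark D i (mark D j x)]].

(** The graph Houghton group B_r, as a subset of [map_Gamma]. *)
Definition graph_houghton : set map_Gamma :=
  [set c | exists2 f : phe Gamma, c = mclass f & asymptotically_rigid f].

End Houghton.

End Graph.

Arguments Gamma R r : clear implicits.

(* Main.v *)
Require Import Defs.
From mathcomp Require Import all_boot all_order all_algebra.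
From mathcomp Require Import all_classical all_reals all_analysis.
From mathcomp Require Import ring lra zify.

Set Implicit Arguments.
Unset Strict Implicit.
Unset Printing Implicit Defensive.

Import Order.TTheory GRing.Theory Num.Theory.
Import numFieldNormedType.Exports.

Local Open Scope classical_set_scope.
Local Open Scope ring_scope.

(** The group B_r contains, for every piece, the flip of its loop: the map that
    reverses the loop, read through the marking of the piece, and is the
    identity on all other cells. Flips are commuting involutions. A rigid map
    carries the piece [j] to a piece [k] by [unmark k \o mark j], so it
    conjugates the flip of [j] to the flip of [k]. Far out on the i-th ray an
    element of B_r sends the m-th piece to the (m + c)-th piece of some ray
    (rigid maps respect the ends of the pieces, so adjacent pieces go to
    adjacent pieces). All that is used of B_r is that it contains these flips
    ([flip_class_houghton]), and how it acts, far out on the rays, on the flips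
    and on the free homotopy classes of the marked pieces ([houghton_tail]).

    Finite generation yields translations. If every element of B_r that maps the
    i-th ray to itself had c = 0 there, then the rays in the orbit of the i-th
    one would carry a height which finitely many generators, hence all of B_r,
    preserve beyond some threshold; elements of B_r would then send the class of
    each marked piece beyond it to the class of a marked piece. A flip does not,
    since a flipped loop is not homotopic to the loop. So for every i some t in
    B_r translates the tail of the i-th ray ([exists_translation]). Together
    with a flip, t generates a lamplighter group, which is one-ended.

    One-endedness is proved through almost invariant sets: sets A such that A
    and Ah differ by a finite set for every h. They must be shown to be finite
    or cofinite ([almost_invariant_trivial]), because the components of the
    complement of a finite set of vertices of the Cayley graph are almost
    invariant ([cayley_one_end]). Write [F j] for the flips. To go from [y] to
    [y * F j] one may translate to the position of [j], flip there and translate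
    back; this meets the finite frontier of A only if the coset of [y] or of [y
    * F j] under the translations does. As flips of different pieces lead to
    different cosets, all but finitely many of these paths are free, and
    comparing [x * F j], [x * F j * F k] and [x * F k] shows that A contains
    almost all or almost none of the elements [x * F j]. Which of the two holds
    does not depend on [x], because h only shifts the indices of the flips far
    out; so it decides on which side all but finitely many elements lie.

    The topological input is a degree argument: the flip of a circle is not
    homotopic to the identity, and a self-map of a circle which is homotopic to
    the identity is onto ([degree_homotopy], [loop_surjective]). The latter is
    needed for the flips to be represented by asymptotically rigid maps
    ([rigid_flip_rigid]), whose restrictions to the pieces have to be onto.
    Proper maps and homotopies of the graph are glued from maps of its cells
    ([within_cells], [glue_homotopy], [homotopic_on_piece]). *)

(** * Finite sets and generated subgroups *)

Lemma finite_set_bounded (T : eqType) (A : set T) (h : T -> nat) :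
  finite_set A -> exists B, forall x, A x -> (h x < B)%N.
Proof.
move=> /finite_seqP[s ->]; exists (\max_(x <- s) h x).+1 => x /= xs.
by rewrite ltnS; exact: leq_bigmax_seq.
Qed.

Lemma finite_subset1 (T : Type) (X : set T) :
  (forall x y, X x -> X y -> x = y) -> finite_set X.
Proof.
move=> h; have [[x Xx]|nX] := pselect (exists x, X x).
  by apply: (sub_finite_set (B := [set x])) => [y Xy|]; [exact: h|exact: finite_set1].
by rewrite (_ : X = set0)//; apply/seteqP; split=> // x Xx; case: nX; exists x.
Qed.

Lemma infinite_pick (T : Type) (X Y Z W : set T) : infinite_set X ->
  finite_set Y -> finite_set Z -> finite_set W ->
  exists2 x, X x & [/\ ~ Y x, ~ Z x & ~ W x].
Proof.
move=> iX fY fZ fW; apply: contrapT => no; apply: iX.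
apply: (@sub_finite_set _ _ (Y `|` Z `|` W)); last by rewrite !finite_setU.
move=> x Xx; apply: contrapT => nx; apply: no; exists x => //.
by split=> h; apply: nx; [left; left|left; right|right].
Qed.

Section GeneratedSubgroup.
Variables (G : groupType) (S : set G).
Local Open Scope group_scope.

Lemma generated_subgroup : is_subgroup (generated_by S).
Proof.
split=> [K [[]//]|g h Sg Sh K [KK SK]|g Sg K [KK SK]].
- by have [_ + _] := KK; apply; [exact: Sg|exact: Sh].
- by have [_ _] := KK; apply; exact: Sg.
Qed.

Lemma sub_generated : S `<=` generated_by S.
Proof. by move=> s Ss K [_]; exact. Qed.

Lemma generated_min (K : set G) : is_subgroup K -> S `<=` K -> generated_by S `<=` K.
Proof. by move=> KK SK x; apply. Qed.

End GeneratedSubgroup.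

(** * Ends of graphs and Cayley graphs *)

Section GraphEnds.
Variables (V : choiceType) (adj : V -> V -> Prop).
Hypothesis adj_sym : forall u v, adj u v -> adj v u.
Implicit Types (u v : V) (X : set V) (w : nat -> V).

Lemma joined_off_refl X u : ~ X u -> joined_off adj X u u.
Proof. by move=> nX; exists 0%N, (fun=> u). Qed.

Lemma joined_off_sym X u v : joined_off adj X u v -> joined_off adj X v u.
Proof.
move=> [n [p [p0 pn padj pX]]]; exists n, (fun k => p (n - k)%N).
rewrite subn0 subnn; split=> // k kn; last by apply: pX; exact: leq_subr.
by apply: adj_sym; have := padj (n - k.+1)%N; rewrite -subSn// subSS; apply; lia.
Qed.

Lemma joined_off_step X u v v' : joined_off adj X u v -> adj v v' -> ~ X v' ->
  joined_off adj X u v'.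
Proof.
move=> [n [p [p0 pn padj pX]]] vw nX.
exists n.+1, (fun k => if (k <= n)%N then p k else v'); rewrite ltnn; split=> //.
- move=> k; rewrite ltnS => kn; rewrite kn; move: kn.
  rewrite leq_eqVlt => /predU1P[->|kn]; first by rewrite ltnn pn.
  by rewrite kn; exact: padj.
- by move=> k _; case: ifP => // kn; exact: pX.
Qed.

Lemma joined_off_trans X u v v' : joined_off adj X u v -> joined_off adj X v v' ->
  joined_off adj X u v'.
Proof.
move=> uv [n [p [p0 pn padj pX]]]; rewrite -pn.
have : (n <= n)%N by [].
move: {1 3}n => m; elim: m => [|m IHm] mn; first by rewrite p0.
by apply: joined_off_step (IHm (ltnW mn)) _ _; [exact: padj|exact: pX].
Qed.

Definition walk n u v : Prop := exists p : nat -> V,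
  [/\ p 0%N = u, p n = v & forall k, (k < n)%N -> adj (p k) (p k.+1)].

Lemma walk_cat n m u v v' : walk n u v -> walk m v v' -> walk (n + m)%N u v'.
Proof.
move=> [p [p0 pn padj]] [q [q0 qm qadj]].
exists (fun k => if (k <= n)%N then p k else q (k - n)%N); split=> //.
- case: ifP => [|_]; last by rewrite addKn.
  rewrite -{2}[n]addn0 leq_add2l leqn0 => /eqP m0.
  by rewrite m0 addn0 pn -q0 -qm m0.
- move=> k kn; have [lt|gt|e] := ltngtP k n.
  + exact: padj.
  + by rewrite subSn ?(ltnW gt)//; apply: qadj; lia.
  + by rewrite e subSnn pn -q0; apply: qadj; lia.
Qed.

Lemma walk1 u v : adj u v -> walk 1 u v.
Proof. by move=> uv; exists (fun k => if k is 0 then u else v); split=> // -[]. Qed.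

Lemma walk_sym n u v : walk n u v -> walk n v u.
Proof.
move=> [p [p0 pn padj]]; exists (fun k => p (n - k)%N).
rewrite subn0 subnn; split=> // k kn.
by apply: adj_sym; have := padj (n - k.+1)%N; rewrite -subSn// subSS; apply; lia.
Qed.

(** Koenig's lemma: from [v0], keep stepping to a neighbour on geodesics to
    infinitely many vertices. *)
Lemma exists_ray v0 : infinite_set [set: V] ->
  (forall u, finite_set [set v | adj u v]) ->
  (forall v, exists n, walk n v0 v) -> exists w, ray adj w.
Proof.
move=> infV fin conn.
pose dist v n := walk n v0 v /\ forall m, walk m v0 v -> (n <= m)%N.
have ex_dist v : exists n, dist v n.
  have ex : exists n, `[< walk n v0 v >] by have [n h] := conn v; exists n; apply/asboolP.
  case: (ex_minnP ex) => n /asboolP h min; exists n; split=> // m /asboolP; exact: min.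
have dist_inj v n m : dist v n -> dist v m -> n = m.
  by move=> [h1 h2] [h3 h4]; apply/eqP; rewrite eqn_leq h2// h4.
(* vertices that lie behind u on a geodesic from v0 *)
pose beyond u := [set v | exists a b, [/\ dist u a, walk b u v & dist v (a + b)%N]].
have step u a : infinite_set (beyond u) -> dist u a ->
    exists v, [/\ adj u v, dist v a.+1 & infinite_set (beyond v)].
  move=> inf da; apply: contrapT => no; apply: inf.
  apply: (@sub_finite_set _ _ ([set u] `|` \bigcup_(v in [set v | adj u v /\ dist v a.+1]) beyond v)).
    move=> v [a' [b [da' [p [p0 pb padj]] dv]]]; rewrite -(dist_inj _ _ _ da da') in dv.
    case: b pb padj dv => [|b] pb padj dv; first by left; rewrite -pb -p0.
    have up : adj u (p 1%N) by rewrite -{1}p0; exact: padj.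
    have wb : walk b (p 1%N) v.
      by exists (fun k => p k.+1); split=> // k kb; exact: padj.
    have dp : dist (p 1%N) a.+1.
      split; first by rewrite -addn1; exact: walk_cat da.1 (walk1 up).
      move=> m wm; have := dv.2 _ (walk_cat wm wb); lia.
    by right; exists (p 1%N) => //; exists a.+1, b; split=> //; rewrite addSnnS.
  rewrite finite_setU; split; first exact: finite_set1.
  apply: bigcup_finite; first by apply: sub_finite_set (fin u) => v [].
  by move=> v [uv dv]; apply: contrapT => inf; apply: no; exists v.
have d0 : dist v0 0%N by split=> //; exists (fun=> v0).
have b0 : infinite_set (beyond v0).
  apply: sub_infinite_set infV => v _; have [n dn] := ex_dist v.
  by exists 0%N, n; split=> //; case: dn.
pose T := {u : V * nat | infinite_set (beyond u.1) /\ dist u.1 u.2}.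
have /choice[nxt nxtP] : forall u : T, exists v : T,
    adj (sval u).1 (sval v).1 /\ (sval v).2 = (sval u).2.+1.
  move=> [[u a] [/= iu da]]; have [v [uv dv iv]] := step u a iu da.
  by exists (exist _ (v, a.+1) (conj iv dv)).
pose st n : T := iter n nxt (exist _ (v0, 0%N) (conj b0 d0)).
have stn n : (sval (st n)).2 = n.
  by elim: n => //= n IHn; have [_ ->] := nxtP (st n); rewrite IHn.
exists (fun n => (sval (st n)).1); split.
  move=> n m e; have [_ dn] := proj2_sig (st n); have [_ dm] := proj2_sig (st m).
  by rewrite e in dn; rewrite -(stn n) -(stn m); exact: dist_inj dn dm.
by move=> n; have [] := nxtP (st n).
Qed.

Lemma ray_joined_off w X N m : ray adj w -> (forall n, (N <= n)%N -> ~ X (w n)) ->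
  (N <= m)%N -> joined_off adj X (w N) (w m).
Proof.
move=> [_ wadj] wX; elim: m => [|m IHm].
  by rewrite leqn0 => /eqP N0; rewrite N0; apply: joined_off_refl; apply: wX; rewrite N0.
rewrite leq_eqVlt => /predU1P[<-|]; first by apply: joined_off_refl; exact: wX.
rewrite ltnS => Nm; apply: joined_off_step (IHm Nm) (wadj m) _.
by apply: wX; exact: leqW.
Qed.

Lemma ray_leaves w X : ray adj w -> finite_set X ->
  exists N, forall n, (N <= n)%N -> ~ X (w n).
Proof.
move=> [wI _] fX.
have fin : finite_set (w @^-1` X) by apply: finite_preimage fX => ? ? _ _; exact: wI.
have [N hN] := finite_set_bounded id fin.
by exists N => n Nn Xn; have := hN n Xn; rewrite ltnNge Nn.
Qed.

(** All rays are equivalent, so the class of any ray is the set of all rays. *)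
Lemma one_end : (exists w, ray adj w) ->
  (forall w w', ray adj w -> ray adj w' -> equivalent_rays adj w w') ->
  number_of_ends adj 1.
Proof.
move=> [w0 rw0] h; rewrite /number_of_ends.
have -> : ends adj = [set [set w' | ray adj w']].
  apply/seteqP; split=> [_ [w rw <-]|_ ->].
    by apply/seteqP; split=> w'; [case|split=> //; exact: h].
  by exists w0 => //; apply/seteqP; split=> w'; [case|split=> //; exact: h].
exact: card_set1.
Qed.

End GraphEnds.

Section CayleyOneEnd.
Local Open Scope group_scope.
Variables (G : groupType) (S H : set G).
Hypotheses (finS : finite_set S) (genS : generated_by S = H) (infH : infinite_set H).
Hypothesis trivial_sets : forall A : set G,
  (forall s, S s -> finite_set [set x | H x /\ ~ (A x <-> A (x * s))]) ->
  finite_set [set x | H x /\ A x] \/ finite_set [set x | H x /\ ~ A x].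
Local Notation adj := (cayley H S).

Lemma cayley_sym u v : adj u v -> adj v u.
Proof. by move=> [s Ss [e|e]]; exists s => //; [right|left]. Qed.

Lemma generator_vertex s : S s -> H s.
Proof. by rewrite -genS; exact: sub_generated. Qed.

Lemma vertices_subgroup : is_subgroup H.
Proof. by rewrite -genS; exact: generated_subgroup. Qed.

Lemma infinite_vertices : infinite_set [set: H].
Proof.
move=> fV; apply: infH.
rewrite (_ : H = val @` [set: H]); first exact: finite_image.
by apply/seteqP; split=> [x Hx|_ [v _ <-]]; [exists (SigSub (mem_set Hx))|exact: set_valP].
Qed.

Lemma cayley_locally_finite u : finite_set [set v | adj u v].
Proof.
apply: (@sub_finite_set _ _ (val @^-1` ((fun s => val u * s) @` S `|` (fun s => val u * s^-1) @` S))).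
  move=> v [s Ss [e|e]]; [left|right]; exists s => //.
  by rewrite e mulgK.
apply: finite_preimage; first by move=> ? ? _ _; exact: val_inj.
by rewrite finite_setU; split; exact: finite_image.
Qed.

(** The elements by which right translation moves every vertex along a walk
    form a subgroup. *)
Lemma cayley_connected (v0 v : H) : exists n, walk adj n v0 v.
Proof.
have [H1 HM HV] := vertices_subgroup.
pose K : set G := [set h | H h /\ forall u v : H, val v = val u * h -> exists n, walk adj n u v].
have KK : is_subgroup K.
  split=> [|g h [Hg Kg] [Hh Kh]|g [Hg Kg]].
  - split=> // u v'; rewrite mulg1 => /val_inj ->; by exists 0%N, (fun=> u).
  - split; first exact: HM.
    move=> u v' e.
    have Hug : H (val u * g) by apply: HM => //; exact: set_valP.
    have [n wn] := Kg u (SigSub (mem_set Hug)) erefl.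
    have [|m wm] := Kh (SigSub (mem_set Hug)) v'; first by rewrite e mulgA.
    by exists (n + m)%N; exact: walk_cat wn wm.
  - split; first exact: HV.
    move=> u v' e; have [|n wn] := Kg v' u; first by rewrite e mulgVK.
    by exists n; exact: (walk_sym cayley_sym wn).
have SK : S `<=` K.
  move=> s Ss; split; first exact: generator_vertex.
  by move=> u v' e; exists 1%N; apply: walk1; exists s => //; left.
have : K ((val v0)^-1 * val v).
  have : H ((val v0)^-1 * val v) by apply: HM; [apply: HV|]; exact: set_valP.
  by rewrite -{1}genS; exact: generated_min.
by move=> [_ h]; apply: h; rewrite mulgA mulgV mul1g.
Qed.

(** A component of the complement of a finite set is almost invariant, hence
    cofinite as soon as it contains the end of a ray. *)
Lemma cayley_rays_equivalent w w' : ray adj w -> ray adj w' -> equivalent_rays adj w w'.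
Proof.
move=> rw rw' X fX; have [N hN] := ray_leaves rw fX.
pose A : set G := [set x | exists2 v : H, val v = x & joined_off adj X (w N) v].
have wA n : (N <= n)%N -> A (val (w n)).
  by move=> Nn; exists (w n) => //; exact: ray_joined_off.
have step u v : adj u v -> joined_off adj X (w N) u -> ~ joined_off adj X (w N) v -> X v.
  by move=> uv ju nj; apply: contrapT => nX; apply: nj; exact: joined_off_step ju uv nX.
have AE (v : H) : A (val v) <-> joined_off adj X (w N) v.
  by split=> [[v' /val_inj ->]//|j]; exists v.
have hA s : S s -> finite_set [set x | H x /\ ~ (A x <-> A (x * s))].
  move=> Ss; have [H1 HM HV] := vertices_subgroup.
  apply: (@sub_finite_set _ _ (val @` X `|` (fun x => x * s) @^-1` (val @` X))).
    move=> x [Hx d]; have Hxs : H (x * s) by apply: HM => //; exact: generator_vertex.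
    pose u : H := SigSub (mem_set Hx); pose v : H := SigSub (mem_set Hxs).
    have uv : adj u v by exists s => //; left.
    rewrite -[x]/(val u) -[val u * s]/(val v) !AE in d.
    have [ju|nju] := pselect (joined_off adj X (w N) u).
      by right; exists v => //; apply: (step _ _ uv ju) => jv; apply: d; split.
    left; exists u => //; apply: (step _ _ (cayley_sym uv) _ nju).
    by apply: contrapT => njv; apply: d; split=> // /njv.
  rewrite finite_setU; split; first exact: finite_image.
  by apply: finite_preimage; [move=> ? ? _ _ /mulIg|exact: finite_image].
have inj_val (z : nat -> H) : ray adj z -> injective (fun n => val (z n)).
  by move=> [zI _] n m /val_inj /zI.
have [fin|cof] := trivial_sets hA.
  case: infinite_nat; apply: (@sub_finite_set _ _
    (`I_N `|` (fun n => val (w n)) @^-1` [set x | H x /\ A x])).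
    move=> n _; have [Nn|nN] := leqP N n; [right|by left].
    by split; [exact: set_valP|exact: wA].
  rewrite finite_setU; split; first exact: finite_II.
  by apply: finite_preimage fin => ? ? _ _; exact: inj_val rw _ _.
have fin' : finite_set ((fun n => val (w' n)) @^-1` [set x | H x /\ ~ A x]).
  by apply: finite_preimage cof => ? ? _ _; exact: inj_val rw' _ _.
have [N' hN'] := finite_set_bounded id fin'.
exists (maxn N N') => m n; rewrite !geq_max => /andP[Nm _] /andP[_ N'n].
have jm : joined_off adj X (w N) (w m) by apply/AE/wA.
have jn : joined_off adj X (w N) (w' n).
  apply/AE; apply: contrapT => nA; have := hN' n; rewrite ltnNge N'n => h.
  by have := h (conj (set_valP _) nA).
exact: (joined_off_trans (joined_off_sym cayley_sym jm) jn).
Qed.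

Lemma cayley_one_end : number_of_ends adj 1.
Proof.
have [H1 _ _] := vertices_subgroup.
apply: one_end; last exact: cayley_rays_equivalent.
apply: (@exists_ray _ adj (SigSub (mem_set H1))).
- exact: infinite_vertices.
- exact: cayley_locally_finite.
- exact: cayley_connected.
Qed.

End CayleyOneEnd.

(** * Groups acting on rays of commuting flips *)

Section FlipSystem.
Local Open Scope group_scope.
Variables (G : groupType) (I : finType) (S H : set G).
Local Notation J := (I * nat)%type.
Variables (F : J -> G) (sends : G -> J -> J -> Prop).
Hypotheses (finS : finite_set S) (genS : generated_by S = H).
Hypotheses (HF : forall j, H (F j)) (FF : forall j, F j * F j = 1)
  (FC : forall j k, F j * F k = F k * F j).
Hypotheses (sends_one : forall j, sends 1 j j)
  (sends_mul : forall x y j k l, sends y j k -> sends x k l -> sends (x * y) j l)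
  (sends_inv : forall x j k, sends x j k -> sends x^-1 k j)
  (F_other : forall j k, k <> j -> sends (F j) k k)
  (F_not : forall j, ~ sends (F j) j j).
Implicit Types (x y h t u : G) (i l : I) (j k : J) (m n M a b d e p : nat).

(** Far out on its rays [x] acts as a shift, both on the labels and, by
    conjugation, on the flips.  The label [M + n] goes to [a + n]; two natural
    numbers encode the integral shift [a - M]. *)
Definition moves_tail x i l M a : Prop := forall n,
  sends x (i, (M + n)%N) (l, (a + n)%N) /\ x * F (i, (M + n)%N) = F (l, (a + n)%N) * x.

Hypothesis H_moves_tails : forall x i, H x -> exists M l a, moves_tail x i l M a.

Lemma H_subgroup : is_subgroup H.
Proof. by rewrite -genS; exact: generated_subgroup. Qed.

Lemma mem_one : H 1. Proof. by have [] := H_subgroup. Qed.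
Lemma mem_mul x y : H x -> H y -> H (x * y). Proof. by have [_ + _] := H_subgroup; exact. Qed.
Lemma mem_inv x : H x -> H x^-1. Proof. by have [_ _] := H_subgroup; exact. Qed.
Lemma mem_exp x n : H x -> H (x ^+ n).
Proof. by move=> Hx; elim: n => [|n IHn]; [exact: mem_one|rewrite expgS; exact: mem_mul]. Qed.

Lemma S_sub : S `<=` H.
Proof. by rewrite -genS; exact: sub_generated. Qed.

Lemma H_min (K : set G) : is_subgroup K -> S `<=` K -> H `<=` K.
Proof. by rewrite -genS; exact: generated_min. Qed.

Lemma sends_one_inj j k : sends 1 j k -> j = k.
Proof.
move=> s; apply: contrapT => jk; apply: (F_not (j := j)).
have := sends_mul s (F_other (j := j) (k := k) (nesym jk)).
by move=> /sends_mul /(_ (sends_inv s)); rewrite invg1 mul1g mulg1.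
Qed.

Lemma sends_inj x j k j' : sends x j j' -> sends x k j' -> j = k.
Proof.
by move=> sj /sends_inv sk; apply: sends_one_inj; rewrite -(mulVg x); exact: sends_mul sj sk.
Qed.

Lemma sends_fun x j k j' : sends x j k -> sends x j j' -> k = j'.
Proof.
move=> /sends_inv sk sl; apply: sends_one_inj; rewrite -(mulgV x).
exact: sends_mul sk sl.
Qed.

Lemma flips_inj : injective F.
Proof.
move=> j k e; apply: contrapT => jk; apply: (F_not (j := k)).
by rewrite -{1}e; apply: F_other; exact: nesym.
Qed.

Lemma moves_tail_one i : moves_tail 1 i i 0 0.
Proof. by move=> n; rewrite mul1g mulg1; split=> //; exact: sends_one. Qed.

Lemma moves_tail_inv x i l M a : moves_tail x i l M a -> moves_tail x^-1 l i a M.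
Proof.
move=> tx n; have [s e] := tx n; split; first exact: sends_inv.
by apply: (mulgI x); rewrite mulgA mulgV mul1g mulgA e mulgK.
Qed.

Lemma moves_tail_mul x y i l l' M a M' a' : moves_tail x i l M a -> moves_tail y l l' M' a' ->
  moves_tail (y * x) i l' (M + M')%N (a' + a)%N.
Proof.
move=> tx ty n; have [s e] := tx (M' + n)%N; have [s' e'] := ty (a + n)%N.
rewrite -!addnA; move: s e; rewrite [(a + (M' + n))%N]addnCA => s e.
by split; [exact: sends_mul s s'|rewrite -mulgA e !mulgA e'].
Qed.

(** * Translations along the rays *)

(** Some element of [H] shifts the tail of the ray [i] to that of [l] in such a
    way that [p] on [i] would go to [m] on [l].  When no element translates the
    tail of [i], the number [p] is a height function of [(l, m)]. *)
Definition lies_over i l m p : Prop :=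
  exists h M a, [/\ H h, moves_tail h i l M a & (M + m = a + p)%N].

Lemma lies_over_tail i l l' m p s M a n : H s -> moves_tail s l l' M a -> m = (M + n)%N ->
  lies_over i l m p -> lies_over i l' (a + n)%N p.
Proof.
move=> Hs ts -> [h [M1 [a1 [Hh th e]]]].
exists (s * h), (M1 + M)%N, (a + a1)%N; split; [exact: mem_mul|exact: moves_tail_mul ts|lia].
Qed.

(** There are finitely many generators and rays, so one threshold does for all. *)
Lemma uniform_tails : exists B, forall s, S s -> forall l,
  (exists M l' a, moves_tail s l l' M a /\ (M <= B)%N) /\
  (exists M l' a, moves_tail s^-1 l l' M a /\ (M <= B)%N).
Proof.
have /choice[b bP] : forall s, exists b, S s -> forall l,
    (exists M l' a, moves_tail s l l' M a /\ (M <= b)%N) /\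
    (exists M l' a, moves_tail s^-1 l l' M a /\ (M <= b)%N).
  move=> s; have [Ss|nS] := pselect (S s); last by exists 0%N.
  have /choice[f fP] : forall l, exists z : nat * I * nat, moves_tail s l z.1.2 z.1.1 z.2.
    by move=> l; have [M [l' [a tl]]] := H_moves_tails l (S_sub Ss); exists (M, l', a).
  have /choice[g gP] : forall l, exists z : nat * I * nat, moves_tail s^-1 l z.1.2 z.1.1 z.2.
    by move=> l; have [M [l' [a tl]]] := H_moves_tails l (mem_inv (S_sub Ss)); exists (M, l', a).
  exists (\max_l ((f l).1.1 + (g l).1.1))%N => _ l.
  have le : ((f l).1.1 + (g l).1.1 <= \max_l ((f l).1.1 + (g l).1.1))%N.
    exact: (leq_bigmax l).
  split; [exists (f l).1.1, (f l).1.2, (f l).2|exists (g l).1.1, (g l).1.2, (g l).2].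
    by split; [exact: fP|exact: leq_trans (leq_addr _ _) le].
  by split; [exact: gP|exact: leq_trans (leq_addl _ _) le].
have [B hB] := finite_set_bounded b finS.
exists B => s Ss l; have [[M [l' [a [tl lb]]]] [M' [l'' [a' [tl' lb']]]]] := bP s Ss l.
split; [exists M, l', a|exists M', l'', a'].
  by split=> //; exact: leq_trans lb (ltnW (hB s Ss)).
by split=> //; exact: leq_trans lb' (ltnW (hB s Ss)).
Qed.

(** Otherwise [lies_over] defines a height on the rays in the orbit of [i].
    Beyond a threshold the generators, and hence all elements, preserve it and
    send labels to labels; but the flip at a label beyond the threshold does not
    send that label to any label. *)
Lemma exists_translation i : exists t M d, [/\ H t, (0 < d)%N & moves_tail t i i M (M + d)%N].
Proof.
apply: contrapT => no.
have fixed x M a : H x -> moves_tail x i i M a -> M = a.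
  move=> Hx tx; case: (ltngtP M a) => // lt; case: no.
    by exists x, M, (a - M)%N; rewrite subn_gt0 subnKC ?(ltnW lt).
  exists x^-1, a, (M - a)%N; rewrite subn_gt0 subnKC ?(ltnW lt)//.
  by split=> //; [exact: mem_inv|exact: moves_tail_inv].
have [B hB] := uniform_tails.
have /choice[P PP] : forall l, exists P, forall m p, lies_over i l m p -> (P <= p)%N -> (B <= m)%N.
  move=> l; have [[m0 [p0 h0]]|nh] := pselect (exists m p, lies_over i l m p); last first.
    by exists 0%N => m p h; case: nh; exists m, p.
  exists (B + p0)%N => m p [h [M [a [Hh th e]]]] le.
  have [h' [M' [a' [Hh' th' e']]]] := h0.
  have := fixed _ _ _ (mem_mul (mem_inv Hh') Hh) (moves_tail_mul th (moves_tail_inv th')).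
  lia.
pose P0 := \max_l P l.
have PP0 l m p : lies_over i l m p -> (P0 <= p)%N -> (B <= m)%N.
  by move=> hl le; apply: PP hl _; apply: leq_trans le; exact: leq_bigmax.
(* C x: beyond the threshold P0, x sends labels to labels of the same height *)
pose C x := forall l m p, (P0 <= p)%N -> lies_over i l m p ->
  exists l' m', lies_over i l' m' p /\ sends x (l, m) (l', m').
have C_tail x : H x -> (forall l, exists M l' a, moves_tail x l l' M a /\ (M <= B)%N) -> C x.
  move=> Hx tx l m p le hl; have [M [l' [a [tl MB]]]] := tx l.
  have mB := PP0 _ _ _ hl le; pose n := (m - M)%N.
  have em : m = (M + n)%N by rewrite subnKC// (leq_trans MB).
  exists l', (a + n)%N; split; first exact: lies_over_tail Hx tl em hl.
  by rewrite em; have [] := tl n.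
have CM x y : C x -> C y -> C (x * y).
  move=> Cx Cy l m p le /(Cy _ _ _ le)[l' [m' [hl' s]]].
  have [l2 [m2 [hl2 s2]]] := Cx _ _ _ le hl'.
  by exists l2, m2; split=> //; exact: sends_mul s s2.
have C1 : C 1 by move=> l m p _ hl; exists l, m; split=> //; exact: sends_one.
have /H_min : is_subgroup [set x | [/\ H x, C x & C x^-1]].
  split=> /= [|x y [Hx Cx CVx] [Hy Cy CVy]|x [Hx Cx CVx]].
  - by rewrite invg1; split=> //; exact: mem_one.
  - by rewrite invgM; split; [exact: mem_mul|exact: CM|exact: CM].
  - by rewrite invgK; split=> //; exact: mem_inv.
have SC : S `<=` [set x | [/\ H x, C x & C x^-1]].
  move=> s Ss /=; have Hs := S_sub Ss.
  split=> //; apply: C_tail => //; try exact: mem_inv.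
    by move=> l; have [] := hB s Ss l.
  by move=> l; have [] := hB s Ss l.
move=> /(_ SC) HC; have [_ CF _] := HC _ (HF (i, P0)).
have [|l' [m' [_ s]]] := CF i P0 P0 (leqnn _).
  by exists 1, 0%N, 0%N; split; [exact: mem_one|exact: moves_tail_one|].
have [e|ne] := pselect ((l', m') = (i, P0)); first by apply: (F_not (j := (i, P0))); rewrite -{3}e.
by have := sends_inj s (F_other ne) => /esym.
Qed.

Lemma translation_pow t i M d n m : moves_tail t i i M (M + d)%N ->
  sends (t ^+ n) (i, (M + m)%N) (i, (M + m + n * d)%N) /\
  t ^+ n * F (i, (M + m)%N) = F (i, (M + m + n * d)%N) * t ^+ n.
Proof.
move=> tt; elim: n => [|n [s e]].
  by rewrite expg0 mul1g mulg1 mul0n addn0; split=> //; exact: sends_one.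
have [s' e'] := tt (m + n * d)%N.
have e1 : (M + d + (m + n * d) = M + m + n.+1 * d)%N by lia.
rewrite e1 addnA in s'; rewrite e1 addnA in e'.
split; first by rewrite expgS; exact: sends_mul s s'.
by rewrite expgS -mulgA e mulgA e' mulgA.
Qed.

Lemma translation_pow_inj t i M d n m : (0 < d)%N -> moves_tail t i i M (M + d)%N ->
  t ^+ n = t ^+ m -> n = m.
Proof.
move=> d0 tt e; have [s _] := translation_pow n 0 tt; have [s' _] := translation_pow m 0 tt.
rewrite e in s; have [] := sends_fun s s' => /eqP.
by rewrite eqn_add2l eqn_pmul2r// => /eqP.
Qed.

(** * Almost invariant sets *)

Definition differ (A : set G) h : set G := [set x | H x /\ ~ (A x <-> A (x * h))].

Definition almost_invariant (A : set G) : Prop :=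
  forall h, H h -> finite_set (differ A h).

Lemma almost_invariantC A : almost_invariant A -> almost_invariant (~` A).
Proof.
move=> hA h Hh; apply: sub_finite_set (hA h Hh) => x [Hx d]; split=> // e.
by apply: d; rewrite /setC /=; tauto.
Qed.

Lemma infinite_J i : infinite_set [set: J].
Proof.
move=> fJ; apply: infinite_nat; rewrite -(preimage_setT (fun n => (i, n))).
by apply: finite_preimage fJ => n m _ _ [].
Qed.

Section Translations.
Variables (t : I -> G) (M d : I -> nat).
Hypotheses (Ht : forall i, H (t i)) (d_gt0 : forall i, (0 < d i)%N)
  (tP : forall i, moves_tail (t i) i i (M i) (M i + d i)%N).

(** Two commuting involutions that agree up to powers of an element of infinite
    order are equal, since their product squares to 1. *)
Lemma involution_coset i x y a b : x * x = 1 -> y * y = 1 -> x * y = y * x ->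
  x * t i ^+ a = y * t i ^+ b -> x = y.
Proof.
move=> xx yy xy e.
have e1 : y * x * t i ^+ a = t i ^+ b by rewrite -mulgA e mulgA yy mul1g.
(* the product of the two involutions exchanges the two powers *)
have e2 : y * x * t i ^+ b = t i ^+ a.
  by rewrite -xy -mulgA -e mulgA xx mul1g.
have e3 : t i ^+ (b + b) = t i ^+ (a + a).
  by rewrite expgnDr -{1}e1 -mulgA -expgnDr (addnC a b) expgnDr mulgA e2 -expgnDr.
have ab : a = b.
  have := translation_pow_inj (d_gt0 i) (tP i) e3; lia.
by move: e; rewrite ab => /mulIg.
Qed.

Variable A : set G.
Hypothesis hA : almost_invariant A.

(** Outside of the frontier neither a translation nor a flip at one of the
    first [d i] places of a tail leaves [A] or its complement; translations carry
    these places to all later ones. *)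
Definition frontier : set G :=
  \bigcup_i (differ A (t i) `|` \bigcup_(e in `I_(d i)) differ A (F (i, (M i + e)%N))).

Lemma finite_frontier : finite_set frontier.
Proof.
apply: bigcup_finite; first exact: finite_finset.
move=> i _; rewrite finite_setU; split; first exact: hA.
by apply: bigcup_finite; [exact: finite_II|move=> e _; exact: hA].
Qed.

(** Two natural exponents stand for an integral one, so that the condition concerns
    the whole coset of [y] under each translation. *)
Definition off_frontier : set G := [set y | H y /\
  forall i z a b, frontier z -> y * t i ^+ a <> z * t i ^+ b].

Lemma frontier_t i y : H y -> ~ frontier y -> (A y <-> A (y * t i)).
Proof. by move=> Hy nf; apply: contrapT => h; apply: nf; exists i => //; left. Qed.

Lemma frontier_F i e y : (e < d i)%N -> H y -> ~ frontier y ->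
  (A y <-> A (y * F (i, (M i + e)%N))).
Proof.
move=> ed Hy nf; apply: contrapT => h; apply: nf; exists i => //; right.
by exists e.
Qed.

Lemma off_frontier_pow i y n : off_frontier y -> (A y <-> A (y * t i ^+ n)).
Proof.
move=> [Hy gy]; elim: n => [|n IHn]; first by rewrite expg0 mulg1.
rewrite IHn expgSr mulgA; apply: frontier_t; first by apply: mem_mul => //; exact: mem_exp.
by move=> f; apply: (gy i _ n 0%N f); rewrite expg0 mulg1.
Qed.

Lemma off_frontier_powV i y n : off_frontier y -> (A y <-> A (y * (t i)^-1 ^+ n)).
Proof.
move=> [Hy gy]; elim: n => [|n IHn]; first by rewrite expg0 mulg1.
rewrite IHn; have -> : y * (t i)^-1 ^+ n = y * (t i)^-1 ^+ n.+1 * t i.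
  by rewrite expgSr -!mulgA mulVg mulg1.
apply: iff_sym; apply: frontier_t.
  by apply: mem_mul => //; apply: mem_exp; exact: mem_inv.
move=> f; apply: (gy i _ 0%N n.+1 f).
by rewrite expg0 mulg1 expVgn -mulgA mulVg mulg1.
Qed.

(** Go from [y] to the place of [k], flip, and come back: with [n] the number of
    translations needed, [y * t ^+ n] is off the frontier, and its flip is
    [y * F k * t ^+ n]. *)
Lemma off_frontier_flip y k : off_frontier y -> off_frontier (y * F k) -> (M k.1 <= k.2)%N -> (A y <-> A (y * F k)).
Proof.
case: k => i m /= gy gyF Mm.
(* n translations carry the e-th place of the tail to the m-th place of the ray *)
pose q := (m - M i)%N; pose e := (q %% d i)%N; pose n := (q %/ d i)%N.
have em : m = (M i + e + n * d i)%N by rewrite -addnA [(e + _)%N]addnC -divn_eq subnKC.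
have [_ eF] := translation_pow n e (tP i).
rewrite -em in eF; rewrite (off_frontier_pow i n gy) (off_frontier_pow i n gyF) -mulgA -eF mulgA.
apply: frontier_F; first by rewrite ltn_mod.
  by apply: mem_mul; [case: gy|exact: mem_exp].
by case: gy => _ gy f; apply: (gy i _ n 0%N f); rewrite expg0 mulg1.
Qed.

(** A finite frontier meets only finitely many cosets of each translation, and
    the commuting involutions [f k] reach different cosets. *)
Lemma finite_meets_frontier (K : Type) (f : K -> G) x : H x -> (forall c, H (f c)) ->
  injective f -> (forall c, f c * f c = 1) -> (forall c c', f c * f c' = f c' * f c) ->
  finite_set [set c | ~ off_frontier (x * f c)].
Proof.
move=> Hx Hf fI ff fC.
apply: (@sub_finite_set _ _ (\bigcup_i \bigcup_(z in frontier)
    [set c | exists a b, x * f c * t i ^+ a = z * t i ^+ b])).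
  move=> c /= ng; apply: contrapT => nb; apply: ng; split; first exact: mem_mul.
  by move=> i z a b fz e; apply: nb; exists i => //; exists z => //; exists a, b.
apply: bigcup_finite => [|i _]; first exact: finite_finset.
apply: bigcup_finite => [|z _]; first exact: finite_frontier.
apply: finite_subset1 => c c' /= [a [b e]] [a' [b' e']].
apply: fI; apply: (@involution_coset i _ _ (a + b') (a' + b)) => //.
apply: (mulgI x); rewrite !mulgA !expgnDr !mulgA e e' -!mulgA -!expgnDr.
by rewrite addnC.
Qed.

Lemma finite_flips_meet_frontier x : H x -> finite_set [set j | ~ off_frontier (x * F j)].
Proof. by move=> Hx; apply: finite_meets_frontier => //; exact: flips_inj. Qed.

Lemma finite_low : finite_set [set j : J | ~ (M j.1 <= j.2)%N].
Proof.
apply: (@sub_finite_set _ _ (setT `*` `I_(\max_i M i))).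
  move=> [i m] /= /negP; rewrite -ltnNge => mM; split=> //=.
  exact: leq_trans mM (leq_bigmax i).
by apply: finite_setX; [exact: finite_finset|exact: finite_II].
Qed.

(** If both alternatives failed, there would be [j] and [k] far apart such that
    [x * F j * F k = x * F k * F j] lies both in [A] and in its complement. *)
Lemma eventually_constant x : H x ->
  finite_set [set j | A (x * F j)] \/ finite_set [set j | ~ A (x * F j)].
Proof.
move=> Hx; apply: contrapT => no.
have i1 : infinite_set [set j | A (x * F j)] by move=> f; apply: no; left.
have i2 : infinite_set [set j | ~ A (x * F j)] by move=> f; apply: no; right.
have fx := finite_flips_meet_frontier Hx.
have [j /= Aj [/contrapT gj /contrapT Mj _]] := infinite_pick i1 fx finite_low finite_low.
have fxj := finite_flips_meet_frontier (mem_mul Hx (HF j)).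
have [k /= Ak [/contrapT gk /contrapT Mk /contrapT gjk]] := infinite_pick i2 fx finite_low fxj.
have e1 := off_frontier_flip gj gjk Mk.
have gkj : off_frontier (x * F k * F j) by rewrite -mulgA -FC mulgA.
have e2 := off_frontier_flip gk gkj Mj.
by move: e2; rewrite -mulgA -FC mulgA; tauto.
Qed.

Definition almost_all_flips x : Prop := finite_set [set j | ~ A (x * F j)].

Lemma finite_bad_seq (f : nat -> G) h : injective f -> (forall n, H (f n)) -> H h ->
  finite_set [set n | ~ (A (f n) <-> A (f n * h))].
Proof.
move=> fI Hf Hh; apply: (@sub_finite_set _ _ (f @^-1` differ A h)).
  by move=> n /= dn; split.
by apply: finite_preimage; [move=> ? ? _ _; exact: fI|exact: hA].
Qed.

Variable i0 : I.

(** Since [h * F j = F k * h] for [j] far out on a ray, with [k] far out as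
    well, [x * h * F j] is [x * F k * h], which lies in [A] iff [x * F k] does,
    up to finitely many exceptions. *)
Lemma almost_all_flips_mul x h : H x -> H h -> almost_all_flips x -> almost_all_flips (x * h).
Proof.
move=> Hx Hh lx; have Hxh := mem_mul Hx Hh.
have [fin|//] := eventually_constant Hxh.
have [M1 [l [a th]]] := H_moves_tails i0 Hh.
pose f n := x * F (l, (a + n)%N); pose g n : J := (i0, (M1 + n)%N).
have fI : injective f by move=> n m /mulgI /flips_inj [/addnI].
have gI : injective g by move=> n m [/addnI].
have lI : injective (fun n => (l, (a + n)%N)) by move=> n m [/addnI].
have f1 : finite_set [set n | ~ (A (f n) <-> A (f n * h))].
  by apply: finite_bad_seq => // n; exact: mem_mul.
have f2 : finite_set [set n | ~ A (f n)].
  by apply: (finite_preimage (f := fun n => (l, (a + n)%N)) _ lx) => ? ? _ _; exact: lI.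
have f3 : finite_set [set n | A (x * h * F (g n))].
  by apply: (finite_preimage (f := g) _ fin) => ? ? _ _; exact: gI.
have [n _ [/= /contrapT n1 /contrapT n2 n3]] := infinite_pick infinite_nat f1 f2 f3.
case: n3; have [_ e] := th n.
by rewrite /g -mulgA e mulgA -/(f n) -n1.
Qed.

Lemma conj_seq i n m : (n <= m)%N ->
  (t i) ^+ m * ((t i)^-1 ^+ n * F (i, M i) * (t i) ^+ n) =
  F (i, (M i + (m - n) * d i)%N) * (t i) ^+ m.
Proof.
move=> nm; have [_ e] := translation_pow (m - n) 0 (tP i).
rewrite !addn0 in e; rewrite -{1}(subnK nm) expgnDr !mulgA.
rewrite expVgn mulgK e -mulgA -expgnDr subnK//.
Qed.

(** The elements [f n = u ^+ n * F0 * u ^- n] are commuting involutions, even where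
    they are not flips: conjugation by a large power of the translation makes any
    two of them flips.  So almost all cosets of [z * f n] are off the frontier,
    and [z * u ^+ n] is compared with
    [z * u ^+ n * F0 = z * f n * u ^+ n]. *)
Lemma finite_exceptions i z u : H z -> (u = t i \/ u = (t i)^-1) -> almost_all_flips 1 ->
  finite_set [set n | ~ A (z * u ^+ n)].
Proof.
move=> Hz ut l1; have lz x : H x -> almost_all_flips x by move=> Hx; rewrite -(mul1g x); exact: almost_all_flips_mul mem_one _ _.
have Hu : H u by case: ut => ->; [|exact: mem_inv].
have uI : injective (fun n => u ^+ n).
  case: ut => -> n m /=; first exact: translation_pow_inj (d_gt0 i) (tP i).
  rewrite !expVgn => /invg_inj; exact: translation_pow_inj (d_gt0 i) (tP i).
pose F0 := F (i, M i); pose f n := u ^+ n * F0 * u ^- n.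
have Hf n : H (f n) by apply: mem_mul; [apply: mem_mul; [exact: mem_exp|exact: HF]|apply: mem_inv; exact: mem_exp].
have fu n : f n * u ^+ n = u ^+ n * F0 by rewrite mulgVK.
have ff n : f n * f n = 1.
  by rewrite {2}/f !mulgA fu -[_ * F0 * F0]mulgA FF mulg1 mulgV.
(* conjugating by a power of t turns finitely many terms into flips *)
have fF n m : exists v j k, [/\ f n * v = v * F j, f m * v = v * F k & (j = k -> n = m)].
  case: ut => eu.
    exists 1, (i, (M i + n * d i)%N), (i, (M i + m * d i)%N).
    have E q : f q = F (i, (M i + q * d i)%N).
      have [_ e] := translation_pow q 0 (tP i); rewrite !addn0 in e.
      by rewrite /f eu e mulgK.
    rewrite !mulg1 !mul1g !E; split=> // -[] /eqP.
    by rewrite eqn_add2l eqn_pmul2r// => /eqP.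
  pose N := (n + m)%N.
  exists ((t i)^-1 ^+ N), (i, (M i + (N - n) * d i)%N), (i, (M i + (N - m) * d i)%N).
  have E q : (q <= N)%N -> f q * (t i)^-1 ^+ N = (t i)^-1 ^+ N * F (i, (M i + (N - q) * d i)%N).
    move=> qN; have e := conj_seq i qN.
    have fq : f q = (t i)^-1 ^+ q * F0 * t i ^+ q by rewrite /f eu expVgn invgK.
    apply: (mulgI (t i ^+ N)); rewrite mulgA fq e -mulgA expVgn mulgV mulg1.
    by rewrite mulgA mulgV mul1g.
  split; [exact/E/leq_addr|exact/E/leq_addl|move=> [] /eqP].
  by rewrite eqn_add2l eqn_pmul2r// /N => /eqP; lia.
have fI : injective f.
  move=> n m e; have [v [j [k [en em]]]] := fF n m; apply; apply: flips_inj.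
  by apply: (mulgI v); rewrite -en -em e.
have fC n m : f n * f m = f m * f n.
  have [v [j [k [en em _]]]] := fF n m; apply: (mulIg v).
  by rewrite -(mulgA (f n)) em mulgA en -(mulgA (f m)) en (mulgA (f m)) em -!mulgA FC.
have f1 := finite_meets_frontier Hz Hf fI ff fC.
have zI : injective (fun n => z * u ^+ n) by move=> n m /mulgI /uI.
have f2 : finite_set [set n | ~ (A (z * u ^+ n) <-> A (z * u ^+ n * F0))].
  by apply: finite_bad_seq => // [n|]; [apply: mem_mul => //; exact: mem_exp|exact: HF].
apply: (@sub_finite_set _ _ ([set n | ~ off_frontier (z * f n)] `|`
    [set n | ~ (A (z * u ^+ n) <-> A (z * u ^+ n * F0))])); last first.
  by rewrite finite_setU.
move=> n /= nA; apply: contrapT => nx.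
have gn : off_frontier (z * f n) by apply: contrapT => ng; apply: nx; left.
have e : A (z * u ^+ n) <-> A (z * u ^+ n * F0).
  by apply: contrapT => ne; apply: nx; right.
apply: nA; rewrite e -mulgA -fu mulgA.
have Ag : A (z * f n).
  have [j _ [/contrapT Aj /contrapT gj /contrapT Mj]] :=
    infinite_pick (infinite_J i) (lz _ (mem_mul Hz (Hf n))) (finite_flips_meet_frontier (mem_mul Hz (Hf n))) finite_low.
  by rewrite (off_frontier_flip gn gj Mj).
case: ut => eu; rewrite eu; [by rewrite -(off_frontier_pow i n gn)|by rewrite -(off_frontier_powV i n gn)].
Qed.

(** An [x] off the frontier has the side of its [x * F j].  The remaining [x] lie
    on finitely many cosets, each of which has finitely many exceptions. *)
Lemma almost_all_flips_cofinite : almost_all_flips 1 -> finite_set [set x | H x /\ ~ A x].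
Proof.
move=> l1.
pose E i u z := [set z * u ^+ n | n in [set n | ~ A (z * u ^+ n)]].
apply: (@sub_finite_set _ _ (\bigcup_i \bigcup_(z in frontier)
    (E i (t i) z `|` E i (t i)^-1 z))); last first.
  apply: bigcup_finite => [|i _]; first exact: finite_finset.
  apply: bigcup_finite => [|z [i' _ fz]]; first exact: finite_frontier.
  have Hz : H z by case: fz => [[]|[e _ []]].
  rewrite finite_setU; split; apply: finite_image; apply: (finite_exceptions (i := i)) => //.
    by left.
  by right.
move=> x [Hx nA]; have [gx|ngx] := pselect (off_frontier x).
  case: nA; have lx : almost_all_flips x by rewrite -(mul1g x); exact: almost_all_flips_mul mem_one _ _.
  have [j _ [/contrapT Aj /contrapT gj /contrapT Mj]] :=
    infinite_pick (infinite_J i0) lx (finite_flips_meet_frontier Hx) finite_low.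
  by rewrite (off_frontier_flip gx gj Mj).
have [i [z [a [b [fz e]]]]] : exists i z a b, frontier z /\ x * t i ^+ a = z * t i ^+ b.
  apply: contrapT => no; apply: ngx; split=> // i z a b fz e; apply: no.
  by exists i, z, a, b.
exists i => //; exists z => //; have [ab|ba] := leqP a b.
  have xE : x = z * t i ^+ (b - a).
    by apply: (mulIg (t i ^+ a)); rewrite e -mulgA -expgnDr subnK.
  by left; exists (b - a)%N => //=; rewrite -xE.
have xE : x = z * (t i)^-1 ^+ (a - b).
  apply: (mulIg (t i ^+ a)); rewrite e -{2}(subnK (ltnW ba)) expgnDr.
  by rewrite -mulgA (mulgA (_ ^+ (a - b))) expVgn mulVg mul1g.
by right; exists (a - b)%N => //=; rewrite -xE.
Qed.

End Translations.

Lemma almost_invariant_trivial (A : set G) (i0 : I) : almost_invariant A ->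
  finite_set [set x | H x /\ A x] \/ finite_set [set x | H x /\ ~ A x].
Proof.
move=> hA.
have /choice[z zP] : forall i, exists z : G * nat * nat,
    [/\ H z.1.1, (0 < z.2)%N & moves_tail z.1.1 i i z.1.2 (z.1.2 + z.2)%N].
  by move=> i; have [t [M [d h]]] := exists_translation i; exists (t, M, d).
have Ht i : H (z i).1.1 by have [] := zP i.
have d0 i : (0 < (z i).2)%N by have [] := zP i.
have tP i : moves_tail (z i).1.1 i i (z i).1.2 ((z i).1.2 + (z i).2)%N by have [] := zP i.
have [fin|cof] := eventually_constant Ht d0 tP hA mem_one; last first.
  by right; exact: (almost_all_flips_cofinite Ht d0 tP hA i0 cof).
left; apply: sub_finite_set (almost_all_flips_cofinite Ht d0 tP (almost_invariantC hA) i0 _).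
  by move=> x [Hx Ax]; split.
by apply: sub_finite_set fin => j /= /contrapT.
Qed.

Lemma almost_invariant_generators (A : set G) :
  (forall s, S s -> finite_set (differ A s)) -> almost_invariant A.
Proof.
move=> hS.
have rI g : injective (fun x => x * g) by move=> x y /mulIg.
have : is_subgroup [set h | H h /\ finite_set (differ A h)].
  split=> /= [|g h [Hg fg] [Hh fh]|g [Hg fg]].
  - split; first exact: mem_one.
    rewrite (_ : differ A 1 = set0)//; apply/seteqP; split=> // x [_ []].
    by rewrite mulg1.
  - split; first exact: mem_mul.
    apply: (@sub_finite_set _ _ (differ A g `|` (fun x => x * g) @^-1` differ A h)).
      move=> x [Hx d]; apply: contrapT => no; apply: d.
      have e1 : A x <-> A (x * g) by apply: contrapT => d; apply: no; left.
      have e2 : A (x * g) <-> A (x * g * h).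
        by apply: contrapT => d; apply: no; right; split=> //; exact: mem_mul.
      by rewrite e1 e2 mulgA.
    rewrite finite_setU; split=> //; apply: finite_preimage fh => x y _ _; exact: rI.
  - split; first exact: mem_inv.
    apply: (@sub_finite_set _ _ ((fun x => x * g^-1) @^-1` differ A g)).
      move=> x [Hx d]; split; first by apply: mem_mul => //; exact: mem_inv.
      by rewrite mulgVK => e; apply: d; tauto.
    by apply: finite_preimage fg => x y _ _; exact: rI.
move=> /H_min h x /h[]// s Ss; split; last exact: hS.
exact: S_sub.
Qed.

Lemma infinite_group (i : I) : infinite_set H.
Proof.
move=> fH; apply: (infinite_J i); rewrite (_ : setT = F @^-1` H).
  by apply: finite_preimage fH => j k _ _; exact: flips_inj.
by apply/seteqP; split=> // j _; exact: HF.
Qed.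

End FlipSystem.

(** * The degree of maps of the circle *)

Section Circle.
Variable R : realType.
Implicit Types a b c s t u x y : R.

(** An angle of the unit vector [(c, s)], by the half-angle formula; it is
    continuous away from [(-1, 0)]. *)
Definition angle (c s : R) : R := atan (s / (1 + c)) *+ 2.

Lemma angleP c s : c ^+ 2 + s ^+ 2 = 1 -> c != -1 ->
  cos (angle c s) = c /\ sin (angle c s) = s.
Proof.
move=> cs1 cN1; have c1 : 1 + c != 0 by rewrite addrC addr_eq0.
rewrite /angle; set T := s / (1 + c).
have T1 : 1 + T ^+ 2 != 0.
  by rewrite gt_eqF// (lt_le_trans ltr01)// lerDl sqr_ge0.
have k2 : cos (atan T) ^+ 2 = (1 + c) / 2.
  rewrite cos_atan exprVn sqr_sqrtr; last by rewrite addr_ge0// sqr_ge0.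
  apply: (mulIf T1); rewrite mulVf// /T expr_div_n.
  have -> : s ^+ 2 = 1 - c ^+ 2 by rewrite -cs1 addrC addKr.
  by field.
have k0 : cos (atan T) != 0.
  rewrite -sqrf_eq0 k2 mulf_neq0// invr_neq0// pnatr_eq0.
have sk : sin (atan T) = T * cos (atan T).
  by rewrite -{2}[T]atanK /tan divfK.
split; first by rewrite cos_mulr2n k2; field.
by rewrite sin_mulr2n sk mulrCA -expr2 k2 /T; field.
Qed.

Lemma angle_continuous (T : topologicalType) (f g : T -> R) :
  continuous f -> continuous g -> (forall x : T, f x != -1) ->
  continuous (fun x : T => angle (f x) (g x)).
Proof.
move=> cf cg fN1 x; rewrite /angle.
have -> : (fun x : T => atan (g x / (1 + f x)) *+ 2) =
          (fun x : T => 2 * atan (g x / (1 + f x))).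
  by apply: funext => y; rewrite mulr_natl.
apply: cvgM; first exact: cvg_cst.
apply: (@continuous_comp _ _ _ (fun x : T => g x / (1 + f x)) atan); last exact: continuous_atan.
apply: cvgM; first exact: cg.
apply: cvgV; first by rewrite addrC addr_eq0.
by apply: cvgD; [exact: cvg_cst|exact: cf].
Qed.

(** Were the values different, the intermediate value theorem would give one that
    differs from [u a] by some [d] with [0 < d <= pi]. *)
Lemma cos_eq1_const (u : R -> R) (a b : R) : a <= b -> continuous u ->
  (forall x, a <= x <= b -> cos (u x) = 1) -> u a = u b.
Proof.
move=> ab cu u1.
have nlt (v : R -> R) : continuous v ->
    (forall x, a <= x <= b -> cos (v x) = 1) -> ~ v a < v b.
  move=> cv v1 lt.
  pose d : R := Num.min (pi / 2) (v b - v a).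
  have d0 : 0 < d by rewrite lt_min subr_gt0 lt divr_gt0// pi_gt0.
  have dpi : d <= pi.
    by rewrite ge_min; apply/orP; left; rewrite ler_piMr ?pi_ge0// invf_le1// ler1n.
  have vI : Num.min (v a) (v b) <= v a + d <= Num.max (v a) (v b).
    rewrite min_l ?max_r ?(ltW lt)// lerDl (ltW d0)/=.
    by rewrite -lerBrDl ge_min lexx orbT.
  have [c] := IVT ab (continuous_subspaceT cv) vI.
  rewrite in_itv/= => cab vc; have := v1 c cab; rewrite vc cosD.
  have va : cos (v a) = 1 by rewrite v1// lexx ab.
  have sa : sin (v a) = 0 by apply: cos1sin0; rewrite va normr1.
  rewrite va sa mul0r subr0 mul1r.
  rewrite -cos0 => /cos_inj; rewrite !in_itv /= lexx pi_ge0 (ltW d0) dpi.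
  by move=> /(_ isT isT) d0'; rewrite d0' ltxx in d0.
apply/eqP; rewrite eq_le !leNgt; apply/andP; split; apply/negP; last exact: nlt.
move=> lt; apply: (nlt (fun x => - u x)); first by move=> x; exact: cvgN (cu x).
  by move=> x /u1; rewrite cosN.
by rewrite ltrN2.
Qed.

(** [P] is locally constant, so its indicator is continuous and the
    intermediate value theorem applies to it. *)
Lemma segment_locally_constant (P : R -> Prop) (a b : R) : a <= b ->
  (forall t, \forall u \near t, P u <-> P t) -> P a -> P b.
Proof.
move=> ab lP Pa; apply: contrapT => nPb.
pose f (t : R) : R := (`[< P t >] : bool)%:R.
have cf : continuous f.
  move=> t; apply: (@near_cst_continuous _ _ (f t) f t).
  near=> u; have e : P u <-> P t by near: u; exact: lP.
  by rewrite /f; do 2![case: asboolP => //]; tauto.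
have fa : f a = 1 by rewrite /f asboolT.
have fb : f b = 0 by rewrite /f asboolF.
have fI : Num.min (f a) (f b) <= 2^-1 <= Num.max (f a) (f b).
  by rewrite fa fb min_r ?max_l ?ler01// invr_ge0 ler0n/= invf_le1// ler1n.
have [c _] := IVT ab (continuous_subspaceT cf) fI.
rewrite /f; case: asboolP => _ /eqP; last by rewrite eq_sym invr_eq0 pnatr_eq0.
by rewrite eq_sym invr_eq1 -[1 in eqbRHS](mulr1n 1) eqr_nat.
Unshelve. all: by end_near. Qed.

(** The tube lemma. *)
Lemma near_segment_gt0 (f : R * R -> R) (a b t : R) : continuous f ->
  (forall s, a <= s <= b -> 0 < f (t, s)) ->
  \forall u \near t, forall s, a <= s <= b -> 0 < f (u, s).
Proof.
move=> cf f0.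
have /compact_near_coveringP cK := @segment_compact R a b.
suff h : forall x, `[a, b]%classic x ->
   \forall x' \near x & i \near t, 0 < f (i, x').
  have : \forall u \near nbhs t, `[a, b]%classic `<=` (fun s => 0 < f (u, s)).
    exact: cK.
  apply: filterS => u /= hu s sab; apply: hu => /=.
  by rewrite in_itv.
move=> s; rewrite /= in_itv/= => /f0 fts.
have : nbhs (t, s) [set q | 0 < f q] by exact: (cf (t, s) _ (lt_nbhsr fts)).
case=> -[U V]/= [tU sV] UV; exists (V, U) => //= -[x y] [Vx Uy].
exact: (UV (y, x)).
Qed.

(** A lift of the map at a time [t] gives a lift at the times when the scalar
    product with the map at time [t] stays positive, by adding the angle between
    the two; these lifts have the same increment over the period.  The circle is
    the quotient of the segment from 0 to [pi *+ 2], and [X] and [Y] are the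
    coordinates of a homotopy that starts at the identity. *)
Lemma degree_homotopy (X Y : R * R -> R) (xi : R -> R) :
  continuous X -> continuous Y -> continuous xi ->
  (forall p, X p ^+ 2 + Y p ^+ 2 = 1) ->
  (forall t, X (t, 0) = X (t, pi *+ 2) /\ Y (t, 0) = Y (t, pi *+ 2)) ->
  (forall s, 0 <= s <= pi *+ 2 -> X (0, s) = cos s /\ Y (0, s) = sin s) ->
  (forall s, 0 <= s <= pi *+ 2 -> X (1, s) = cos (xi s) /\ Y (1, s) = sin (xi s)) ->
  xi (pi *+ 2) = xi 0 + pi *+ 2.
Proof.
move=> cX cY cxi XY1 per H0 H1.
have pi2 : 0 <= (pi : R) *+ 2 by rewrite mulrn_wge0// pi_ge0.
pose P (t : R) := exists th : R -> R, [/\ continuous th,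
  th (pi *+ 2) = th 0 + pi *+ 2 &
  forall s, 0 <= s <= pi *+ 2 -> X (t, s) = cos (th s) /\ Y (t, s) = sin (th s)].
have step (t u : R) : (forall s, 0 <= s <= pi *+ 2 ->
    0 < X (t, s) * X (u, s) + Y (t, s) * Y (u, s)) -> P t -> P u.
  move=> dot [th [cth thp thE]].
  pose clamp (s : R) := Num.min (Num.max s 0) (pi *+ 2).
  have cclamp : continuous clamp.
    move=> s; apply: (@continuous_min _ _ (fun s => Num.max s 0) (cst (pi *+ 2))); last exact: cvg_cst.
    apply: (@continuous_max _ _ id (cst 0)); [exact: cvg_id|exact: cvg_cst].
  have clampE s : 0 <= s <= pi *+ 2 -> clamp s = s.
    by case/andP=> s0 s1; rewrite /clamp max_l// min_l.
  have clampI s : 0 <= clamp s <= pi *+ 2.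
    by rewrite /clamp le_min ge_min lexx orbT le_max lexx orbT pi2.
  pose c s := X (t, clamp s) * X (u, clamp s) + Y (t, clamp s) * Y (u, clamp s).
  pose d s := X (t, clamp s) * Y (u, clamp s) - Y (t, clamp s) * X (u, clamp s).
  have ch (Z : R * R -> R) (v : R) : continuous Z -> continuous (fun s => Z (v, clamp s)).
    move=> cZ s; apply: continuous_comp; last exact: cZ.
    apply: (@cvg_pair _ _ _ _ (nbhs _) (nbhs _)); first exact: cvg_cst.
    exact: cclamp.
  have cc : continuous c.
    by move=> s; apply: cvgD; apply: cvgM; exact: ch.
  have cd : continuous d.
    by move=> s; apply: cvgB; apply: cvgM; exact: ch.
  have c0 s : 0 < c s by exact: dot.
  have cd1 s : c s ^+ 2 + d s ^+ 2 = 1.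
    have := XY1 (t, clamp s); have := XY1 (u, clamp s); rewrite /c /d.
    move: (X _) (Y _) (X _) (Y _) => x y x' y' e e'.
    by rewrite -[1]mulr1 -{1}e -e'; ring.
  have cN1 s : c s != -1.
    by rewrite gt_eqF// (lt_trans _ (c0 s))// oppr_lt0.
  exists (fun s => th s + angle (c s) (d s)); split.
  - by move=> s; apply: cvgD; [exact: cth|exact: angle_continuous].
  - rewrite thp addrAC; congr (_ + _ + _); congr angle.
      rewrite /c !clampE ?lexx ?pi2//.
      by have [-> ->] := per t; have [-> ->] := per u.
    rewrite /d !clampE ?lexx ?pi2//.
    by have [-> ->] := per t; have [-> ->] := per u.
  - move=> s sI; have [ac as_] := angleP (cd1 s) (cN1 s).
    rewrite cosD sinD ac as_ /c /d clampE//.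
    have [<- <-] := thE _ sI.
    have := XY1 (t, s).
    move: (X _) (Y _) (X _) (Y _) => x y x' y' e.
    by split; [rewrite -[LHS]mul1r -e|rewrite -[LHS]mul1r -e]; ring.
have [th [cth thp thE]] : P 1.
  apply: (@segment_locally_constant P 0 1) => //; last first.
    by exists id; split; [move=> s; exact: cvg_id|rewrite /= add0r|exact: H0].
  move=> t.
  have : \forall u \near t, forall s, 0 <= s <= pi *+ 2 ->
      0 < X (t, s) * X (u, s) + Y (t, s) * Y (u, s).
    apply: (@near_segment_gt0 (fun q => X (t, q.2) * X q + Y (t, q.2) * Y q)).
      have cp (Z : R * R -> R) : continuous Z -> continuous (fun q : R * R => Z (t, q.2)).
        move=> cZ q; apply: continuous_comp; last exact: cZ.
        by apply: (@cvg_pair _ _ _ _ (nbhs _) (nbhs _)); [exact: cvg_cst|exact: cvg_snd].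
      by move=> q; apply: cvgD; apply: cvgM; [exact: cp|exact: cX|exact: cp|exact: cY].
    by move=> s _ /=; rewrite -!expr2 XY1.
  apply: filterS => u dot; split; last exact: step.
  by apply: step => s /dot; rewrite [X _ * _]mulrC [Y _ * _]mulrC.
have := @cos_eq1_const (fun s => th s - xi s) 0 (pi *+ 2) pi2.
have ctx : continuous (fun s => th s - xi s).
  by move=> s; apply: cvgB; [exact: cth|exact: cxi].
move=> /(_ ctx) h.
suff : th 0 - xi 0 = th (pi *+ 2) - xi (pi *+ 2) by rewrite thp; lra.
apply: h => s sI; rewrite cosB.
have [e1 e2] := thE _ sI; have [e3 e4] := H1 _ sI.
by rewrite -e1 -e2 -e3 -e4 -!expr2 XY1.
Qed.

End Circle.

(** * Segments and loops in the plane *)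

Section PlaneShapes.
Variable R : realType.
Implicit Types (a b x y : R) (k m : nat) (q : R * R).

Lemma loop_atP k q : loop_at k q ->
  [/\ `|q.1 - k%:R| <= 4^-1, 0 <= q.2 <= 2^-1 & q.2 = 0 -> q.1 = k%:R].
Proof.
case: q => x y; rewrite /loop_at /= => e.
have x0 : 0 <= (x - k%:R) ^+ 2 by exact: sqr_ge0.
have y0 : 0 <= (y - 4^-1) ^+ 2 by exact: sqr_ge0.
split.
- rewrite -[leRHS]ger0_norm ?invr_ge0 ?ler0n// -ler_sqr ?nnegrE ?normr_ge0//.
  by rewrite !real_normK ?num_real//; lra.
- have : `|y - 4^-1| <= 4^-1.
    rewrite -[leRHS]ger0_norm ?invr_ge0 ?ler0n// -ler_sqr ?nnegrE ?normr_ge0//.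
    by rewrite !real_normK ?num_real//; lra.
  by rewrite ler_norml => /andP[? ?]; apply/andP; split; lra.
- move=> y00; move: e; rewrite y00 sub0r sqrrN => /eqP.
  by rewrite -subr_eq0 addrK sqrf_eq0 subr_eq0 => /eqP.
Qed.

Lemma loop_bounds k q : loop_at k q ->
  k%:R - 4^-1 <= q.1 <= k%:R + 4^-1.
Proof.
by move=> /loop_atP[+ _ _]; rewrite ler_norml => /andP[? ?]; apply/andP; split; lra.
Qed.

Lemma loop_base k : loop_at k (k%:R, 0 : R).
Proof. by rewrite /loop_at /= subrr expr0n/= add0r sub0r sqrrN. Qed.

Lemma loop_top k : loop_at k (k%:R, 2^-1 : R).
Proof. by rewrite /loop_at /= subrr expr0n/= add0r; field. Qed.

Lemma continuous_fst_prod (T U : topologicalType) : continuous (@fst T U).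
Proof. by move=> p; exact: cvg_fst. Qed.

Lemma continuous_snd_prod (T U : topologicalType) : continuous (@snd T U).
Proof. by move=> p; exact: cvg_snd. Qed.

Lemma continuous_pair (S T U : topologicalType) (f : S -> T) (g : S -> U) :
  continuous f -> continuous g -> continuous (fun x : S => (f x, g x)).
Proof.
by move=> cf cg x; apply: (@cvg_pair _ _ _ _ (nbhs _) (nbhs _)); [exact: cf|exact: cg].
Qed.

Lemma closed_continuous_preimage (T U : topologicalType) (f : T -> U) (D : set U) :
  continuous f -> closed D -> closed (f @^-1` D).
Proof. by move=> /continuous_closedP; exact. Qed.

Lemma closed_base_segment a b : closed (base_segment a b).
Proof.
have -> : base_segment a b =
    (fst @^-1` `[a, b]%classic) `&` (snd @^-1` [set x | x = 0]).
  by apply/seteqP; split=> -[x y]; rewrite /base_segment /= in_itv.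
apply: closedI; apply: closed_continuous_preimage.
- exact: continuous_fst_prod.
- exact: itv_closed.
- exact: continuous_snd_prod.
- exact: closed_eq.
Qed.

Lemma closed_loop_at k : closed (@loop_at R k).
Proof.
have -> : @loop_at R k =
   (fun q : R * R => (q.1 - k%:R) ^+ 2 + (q.2 - 4^-1) ^+ 2) @^-1` [set x | x = 4^-1 ^+ 2].
  by [].
apply: closed_continuous_preimage; last exact: closed_eq.
have sq (f : R * R -> R) : continuous f -> continuous (fun q => f q ^+ 2).
  by move=> cf q; rewrite (_ : (fun q => _) = (fun q => f q * f q))//; apply: cvgM; exact: cf.
move=> q; apply: cvgD.
  by apply: sq => p; apply: cvgB; [exact: cvg_fst|exact: cvg_cst].
by apply: sq => p; apply: cvgB; [exact: cvg_snd|exact: cvg_cst].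
Qed.

Lemma compact_base_segment a b : compact (base_segment a b).
Proof.
apply: (@subclosed_compact (R * R)%type _ (`[a, b]%classic `*` `[0, 1]%classic)).
- exact: closed_base_segment.
- by apply: compact_setX; exact: segment_compact.
- by move=> -[x y] [/= xab ->]; split; rewrite /= in_itv //= lexx ler01.
Qed.

Lemma compact_loop_at k : compact (@loop_at R k).
Proof.
apply: (@subclosed_compact (R * R)%type _
  (`[k%:R - 4^-1, k%:R + 4^-1]%classic `*` `[0, 2^-1]%classic)).
- exact: closed_loop_at.
- by apply: compact_setX; exact: segment_compact.
- move=> q lq; have := loop_bounds lq; have [_ h _] := loop_atP lq.
  by case: q h {lq} => x y /= h h'; split; rewrite /= in_itv.
Qed.

Definition loop_param k (s : R) : R * R :=
  (k%:R + cos s / 4, 4^-1 + sin s / 4).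

Lemma loop_paramP k s : loop_at k (loop_param k s).
Proof.
rewrite /loop_at /loop_param /= ![_ + _ / 4]addrC !addrK !expr_div_n -mulrDl.
by rewrite cos2Dsin2 mul1r exprVn.
Qed.

Lemma loop_param_surj k q : loop_at k q -> exists s, q = loop_param k s.
Proof.
case: q => x y; rewrite /loop_at /= => e.
have cs1 : (4 * (x - k%:R)) ^+ 2 + (4 * (y - 4^-1)) ^+ 2 = 1.
  by rewrite !exprMn -mulrDr e; field.
have [cN1|cN1] := eqVneq (4 * (x - k%:R)) (-1).
  exists pi; rewrite /loop_param cospi sinpi; congr pair; first by lra.
  move: cs1; rewrite cN1 sqrrN expr1n => /eqP.
  by rewrite addrC -subr_eq0 addrK sqrf_eq0 mulf_eq0 pnatr_eq0/= => /eqP; lra.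
have [c s] := angleP cs1 cN1.
by exists (angle (4 * (x - k%:R)) (4 * (y - 4^-1))); rewrite /loop_param c s; congr pair; field.
Qed.

Lemma continuous_loop_param k : continuous (loop_param k).
Proof.
apply: continuous_pair => s; apply: cvgD; try exact: cvg_cst.
  by apply: cvgM; [exact: continuous_cos|exact: cvg_cst].
by apply: cvgM; [exact: continuous_sin|exact: cvg_cst].
Qed.

Lemma connected_loop_at k : connected (@loop_at R k).
Proof.
have -> : @loop_at R k = loop_param k @` setT.
  apply/seteqP; split=> [q /loop_param_surj[s ->]|_ [s _ <-]].
    by exists s.
  exact: loop_paramP.
apply: connected_continuous_connected; first by apply/connected_intervalP.
exact/continuous_subspaceT/continuous_loop_param.
Qed.

Lemma connected_base_segment a b : connected (base_segment a b).
Proof.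
have -> : base_segment a b = (fun x => (x, 0)) @` `[a, b]%classic.
  apply/seteqP; split=> [[x y] [/= xab ->]|_ [x + <-]].
    by exists x; rewrite //= in_itv.
  by rewrite /= in_itv.
apply: connected_continuous_connected; first exact: segment_connected.
apply: continuous_subspaceT; apply: continuous_pair; first by move=> x; exact: cvg_id.
by move=> x; exact: cvg_cst.
Qed.

End PlaneShapes.

(** * Cells of the graph *)

Section Cells.
Variables (R : realType) (r : nat) (cut : 'I_r -> nat -> R).
Hypothesis cutP : forall i k, k%:R < cut i k < k.+1%:R.
Local Notation ambient := ('rV[R]_r * R)%type.
Implicit Types (i l : 'I_r) (j : 'I_r * nat) (p : ambient) (q : R * R).

Lemma cut_gt i k : k%:R < cut i k. Proof. by have /andP[] := cutP i k. Qed.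
Lemma cut_lt i k : cut i k < k.+1%:R. Proof. by have /andP[] := cutP i k. Qed.
Lemma cut_gt0 i k : 0 < cut i k.
Proof. by rewrite (le_lt_trans _ (cut_gt i k)). Qed.

Lemma cut_ltn i m n : (m < n)%N -> cut i m < cut i n.
Proof.
move=> mn; apply: (lt_trans (cut_lt i m)); apply: le_lt_trans (cut_gt i n).
by rewrite ler_nat.
Qed.

Lemma cut_le i m n : (m <= n)%N -> cut i m <= cut i n.
Proof. by rewrite leq_eqVlt => /predU1P[->//|/cut_ltn/ltW]. Qed.

Definition flat i p : R * R := (p.1 0 i, p.2).

Lemma flatK i q : flat i (ray_plane i q) = q.
Proof. by rewrite /flat /ray_plane /= !mxE !eqxx mulr1; case: q. Qed.

Lemma coord_ray_plane i l q :
  (ray_plane i q).1 0 l = if i == l then q.1 else 0.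
Proof.
rewrite /ray_plane /= !mxE eqxx/= eq_sym; case: eqP => _; first by rewrite mulr1.
by rewrite mulr0.
Qed.

Lemma continuous_coord i : continuous (fun p : ambient => p.1 0 i).
Proof.
move=> p; apply: (@continuous_comp _ _ _ fst (fun x : 'rV[R]_r => x 0 i)).
  exact: cvg_fst.
exact: coord_continuous.
Qed.

Lemma continuous_flat i : continuous (flat i).
Proof.
by apply: continuous_pair; [exact: continuous_coord|exact: continuous_snd_prod].
Qed.

Lemma continuous_ray_plane i : continuous (ray_plane (R:=R) i).
Proof.
apply: continuous_pair; last exact: continuous_snd_prod.
by move=> q; apply: cvgZr_tmp; exact: cvg_fst.
Qed.

Lemma hausdorff_ambient : hausdorff_space ambient.
Proof. exact: norm_hausdorff. Qed.

Local Notation piece := (piece cut).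
Local Notation core := (core cut).
Local Notation minus := (piece_minus cut).
Local Notation plus := (piece_plus cut).

Definition cell (c : option ('I_r * nat)) : set ambient :=
  if c is Some j then piece j else core.

Definition ball_graph (N : nat) : set ambient :=
  core `|` \bigcup_(j in [set j | (j.2 < N)%N]) piece j.

Lemma piece_has_minus j : piece j (minus j).
Proof.
by exists (cut j.1 j.2, 0) => //; left; rewrite /base_segment /= lexx cut_le.
Qed.

Lemma piece_has_plus j : piece j (plus j).
Proof.
by exists (cut j.1 j.2.+1, 0) => //; left; rewrite /base_segment /= lexx cut_le.
Qed.

Lemma compact_cell c : compact (cell c).
Proof.
have cR i (A : set (R * R)) : compact A -> compact (ray_plane i @` A).
  move=> cA; apply: continuous_compact => //.
  exact/continuous_subspaceT/continuous_ray_plane.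
case: c => [j|] /=.
  by apply: cR; apply: compactU; [exact: compact_base_segment|exact: compact_loop_at].
have -> : core = \big[setU/set0]_(i <- enum 'I_r) (ray_plane i @` base_segment 0 (cut i 0%N)).
  rewrite -bigcup_seq /core; apply/seteqP; split=> p [i _ h]; exists i => //=.
  by rewrite mem_enum.
by apply: bigsetU_compact => i _; apply: cR; exact: compact_base_segment.
Qed.

Lemma closed_cell c : closed (cell c).
Proof. exact: compact_closed hausdorff_ambient (@compact_cell c). Qed.

Lemma compact_ball_graph N : compact (ball_graph N).
Proof.
apply: compactU; first exact: (@compact_cell None).
have -> : \bigcup_(j in [set j : 'I_r * nat | (j.2 < N)%N]) piece j =
    \big[setU/set0]_(x <- enum {: 'I_r * 'I_N}) piece (x.1, val x.2).
  rewrite -bigcup_seq; apply/seteqP; split=> p [].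
    by move=> [i m] /= mN h; exists (i, Ordinal mN); rewrite //= mem_enum.
  by move=> [i m] _ h; exists (i, val m) => //=.
by apply: bigsetU_compact => x _; exact: (@compact_cell (Some _)).
Qed.

Lemma piece_flat j p : piece j p ->
  [/\ p = ray_plane j.1 (flat j.1 p), j.2%:R < p.1 0 j.1 &
     p.1 0 j.1 < j.2.+2%:R].
Proof.
case=> q qj <-; rewrite flatK coord_ray_plane eqxx; split=> //.
  case: qj => [[/andP[h _] _]|/loop_bounds/andP[h _]].
    exact: lt_le_trans (cut_gt _ _) h.
  by apply: lt_le_trans h; rewrite -natr1; lra.
case: qj => [[/andP[_ h] _]|/loop_bounds/andP[_ h]].
  exact: le_lt_trans h (cut_lt _ _).
by apply: le_lt_trans h _; rewrite -[j.2.+2%:R]natr1; lra.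
Qed.

Lemma piece_coord_other j l p : piece j p -> j.1 != l -> p.1 0 l = 0.
Proof. by case=> q _ <- /negbTE jl; rewrite coord_ray_plane jl. Qed.

Lemma piece_overlap_ray j j' p : piece j p -> piece j' p -> j.1 = j'.1.
Proof.
move=> jp lp; apply/eqP; apply: contraT => ne.
have := piece_coord_other jp ne; have [_ + _] := piece_flat lp => /[swap] ->.
by rewrite ltrn0.
Qed.

Lemma piece_overlap_lt i k m p : (k < m)%N -> piece (i, k) p -> piece (i, m) p ->
  m = k.+1 /\ p = plus (i, k).
Proof.
move=> km [q qk <-] [q' qm /(congr1 (flat i))]; rewrite !flatK => e.
move: qm; rewrite e => {q' e} qm.
have k1m : k.+1%:R <= m%:R :> R by rewrite ler_nat.
have cm : cut i k.+1 <= cut i m by exact: cut_le.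
have c1 := cut_lt i k.+1; have c2 := cut_gt i k.+1; have c3 := cut_gt i m.
have c4 := cut_lt i m.
have m1 : m.+1%:R = m%:R + 1 :> R by rewrite natr1.
have k2 : k.+2%:R = k.+1%:R + 1 :> R by rewrite natr1.
case: qk => /= [[/andP[a1 a2] a3]|lk]; case: qm => /= [[/andP[b1 b2] b3]|lm].
- have [e|ne] := eqVneq m k.+1; last first.
    have : (k.+1 < m)%N by lia.
    by move=> /(cut_ltn i) lt; have := le_lt_trans a2 (lt_le_trans lt b1); rewrite ltxx.
  split=> //; congr ray_plane; case: q a1 a2 a3 b1 b2 b3 => x y /= _ a2 -> b1 _ _.
  by congr pair; apply/le_anti; rewrite a2 -e b1.
- have [_ _ /(_ a3) e] := loop_atP lm; exfalso; lra.
- have [_ _ /(_ b3) e] := loop_atP lk; exfalso; lra.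
- have /andP[_ u] := loop_bounds lk; have /andP[v _] := loop_bounds lm; exfalso; lra.
Qed.

Lemma piece_overlap j j' p : piece j p -> piece j' p ->
  [\/ j = j',
      j.1 = j'.1 /\ j'.2 = j.2.+1 /\ p = plus j /\ p = minus j' |
      j.1 = j'.1 /\ j.2 = j'.2.+1 /\ p = plus j' /\ p = minus j].
Proof.
case: j j' => [i k] [l m] jp lp; have /= e := piece_overlap_ray jp lp; subst l.
case: (ltngtP k m) => [km|mk|->]; last by constructor 1.
  by have [e ep] := piece_overlap_lt km jp lp; subst m; constructor 2.
by have [e ep] := piece_overlap_lt mk lp jp; subst k; constructor 3.
Qed.

Lemma core_overlap j p : core p -> piece j p -> j.2 = 0%N /\ p = minus j.
Proof.
case: j => i k [l _ [q [/andP[q0 q1] q2] <-]] [q' qk e]; move: qk.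
have /= e2 : q.2 = q'.2 by have := congr1 snd e.
have [il|il] := eqVneq l i; last first.
  have := congr1 (fun p : ambient => p.1 0 i) e.
  rewrite !coord_ray_plane /= eqxx (negbTE il) => e1.
  case=> [[/andP[+ _] _]|/loop_bounds/andP[+ _]]; rewrite /= e1.
    by rewrite leNgt cut_gt0.
  by rewrite -natr1; have := ler0n R k; move=> ? ?; exfalso; lra.
subst l; have := congr1 (flat i) e; rewrite !flatK => {}e; subst q'; clear e2.
case=> /= [[/andP[a1 a2] a3]|lk].
  have [k0|k0] := posnP k; last by have := cut_ltn i k0; move=> ?; exfalso; lra.
  subst k; split=> //; congr ray_plane; case: q q0 q1 q2 a1 a2 a3 => x y /= _ u -> v _ _.
  by congr pair; apply/le_anti; rewrite u v.
have [_ _ /(_ q2) e] := loop_atP lk.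
have := cut_lt i 0; have : 1 <= k.+1%:R :> R by rewrite ler1n.
by rewrite -e => ? ?; exfalso; lra.
Qed.

Lemma Gamma_cell p : Gamma R r p <-> exists c, cell c p.
Proof.
split.
  move=> [i _ [[x y] [[/= x0 y0]|[[//|k] _ lk] <-]]]; last first.
    by exists (Some (i, k)), (x, y) => //; right.
  subst y.
  have [x1|x1] := leP x (cut i 0%N).
    by exists None, i => //; exists (x, 0) => //; rewrite /base_segment /= x0 x1.
  have exn : exists n, x < cut i n.
    exists (Num.bound x); apply: lt_trans (cut_gt _ _).
    exact: archi_boundP x0.
  case: (ex_minnP exn) => -[|n] xn min; first by move: x1; rewrite ltNge (ltW xn).
  exists (Some (i, n)), (x, 0) => //; left; split=> //=; rewrite (ltW xn) andbT.
  by rewrite leNgt; apply/negP => /min; rewrite ltnn.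
move=> [[[i k]|] /=].
  move=> [q qk <-]; exists i => //; exists q => //.
  case: qk => /= [[/andP[h _] q0]|lk]; last by right; exists k.+1.
  by left; split => //; apply: le_trans h; exact/ltW/cut_gt0.
move=> [i _ [q [/andP[h _] q0] <-]]; exists i => //; exists q => //; by left.
Qed.

Lemma cell_Gamma c : cell c `<=` Gamma R r.
Proof. by move=> p cp; apply/Gamma_cell; exists c. Qed.

Lemma ball_graph_cell N p : ball_graph N p <->
  exists2 c, (if c is Some j then (j.2 < N)%N else true) & cell c p.
Proof.
split=> [[cp|[j jN jp]]|[[j|] jN jp]].
- by exists None.
- by exists (Some j).
- by right; exists j.
- by left.
Qed.

Lemma ball_graph_Gamma N : ball_graph N `<=` Gamma R r.
Proof. by move=> p /ball_graph_cell[c _ cp]; exact: cell_Gamma cp. Qed.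

Lemma cell_ball_graph N c p : cell c p -> (forall i, p.1 0 i < N%:R) ->
  ball_graph N p.
Proof.
case: c => [j|] jp h; last by left.
right; exists j => //=; have [_ jlt _] := piece_flat jp.
by rewrite -(ltr_nat R) (lt_trans jlt).
Qed.

Lemma compact_coord_bounded (K : set ambient) : compact K ->
  \forall N \near \oo, forall p, K p -> forall i, p.1 0 i < N%:R.
Proof.
move=> /compact_near_coveringP cK.
apply: (cK nat \oo (fun N p => forall i, p.1 0 i < N%:R)) => p _.
suff H i : filter_prod (nbhs p) \oo
    (fun z : ambient * nat => z.1.1 0 i < z.2%:R) by exact: filter_forall H.
exists ([set p' : ambient | p'.1 0 i < p.1 0 i + 1], [set N : nat | p.1 0 i + 1 < N%:R]).
  split; last exact: nbhs_infty_gtr.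
  have lt1 : p.1 0 i < p.1 0 i + 1 by rewrite ltrDl.
  exact: (@continuous_coord i p _ (lt_nbhsl lt1)).
by move=> [p' N] [/= /lt_trans]; apply.
Qed.

Lemma ball_graph_connected N : connected (ball_graph N).
Proof.
have cR i (A : set (R * R)) : connected A -> connected (ray_plane i @` A).
  move=> cA; apply: connected_continuous_connected => //.
  exact/continuous_subspaceT/continuous_ray_plane.
have cpiece j : connected (piece j).
  apply: cR; apply: connectedU.
  - exists (j.2.+1%:R, 0); split; last exact: loop_base.
    by split=> //=; rewrite (ltW (cut_lt _ _)) (ltW (cut_gt _ _)).
  - exact: connected_base_segment.
  - exact: connected_loop_at.
pose ray i := ray_plane i @` base_segment 0 (cut i 0%N) `|`
  \bigcup_(k in [set k | (k < N)%N]) piece (i, k).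
have rayN i n : connected (ray_plane i @` base_segment 0 (cut i 0%N) `|`
    \bigcup_(k in [set k | (k < n)%N]) piece (i, k)).
  elim: n => [|n IHn].
    rewrite (_ : \bigcup_(k in _) _ = set0) ?setU0.
      by apply: cR; exact: connected_base_segment.
    by apply/seteqP; split=> // p [].
  have -> : \bigcup_(k in [set k | (k < n.+1)%N]) piece (i, k) =
      \bigcup_(k in [set k | (k < n)%N]) piece (i, k) `|` piece (i, n).
    apply/seteqP; split=> [p [k /= +] kp|p [[k /= kn kp]|np]].
    - rewrite ltnS leq_eqVlt => /predU1P[e|kn]; first by right; rewrite -e.
      by left; exists k.
    - by exists k => //=; exact: ltnW.
    - by exists n => /=.
  rewrite setUA; apply: connectedU => //.
  exists (minus (i, n)); split; last exact: piece_has_minus.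
  case: n {IHn} => [|n].
    left; exists (cut i 0%N, 0) => //.
    by rewrite /base_segment /= lexx (ltW (cut_gt0 _ _)).
  by right; exists n => //=; exact: (piece_has_plus (i, n)).
have [r0|r0] := posnP r.
  rewrite (_ : ball_graph N = set0); first exact: connected0.
  apply/seteqP; split=> // p [[i]|[[i]]]; have := ltn_ord i; by rewrite {2}r0.
have -> : ball_graph N = \bigcup_(i in setT) ray i.
  apply/seteqP; split=> [p [[i _ ip]|[[i k] /= kN kp]]|p [i _ [ip|[k /= kN kp]]]].
  - by exists i => //; left.
  - by exists i => //; right; exists k.
  - by left; exists i.
  - by right; exists (i, k).
apply: bigcup_connected => [|i _]; last exact: rayN.
exists 0 => i _; left; exists 0; last by rewrite /ray_plane /= scale0r.
by rewrite /base_segment /= lexx (ltW (cut_gt0 _ _)).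
Qed.

End Cells.

(** * Proper maps and proper homotopies *)

Section ProperExtras.
Variable R : realType.
Implicit Types X Y Z : topologicalType.

Lemma proper_onI X Y (A : set X) (B : set Y) (f : X -> Y) :
  hausdorff_space Y -> {within A, continuous f} -> {homo f : x / A x >-> B x} ->
  (forall K, K `<=` B -> compact K -> exists C, [/\ compact C, C `<=` A &
     forall x, A x -> K (f x) -> C x]) ->
  proper_on A B f.
Proof.
move=> hY cf fAB hK; split=> // K KB cK.
have [C [cC CA KC]] := hK K KB cK.
have -> : A `&` f @^-1` K = C `&` f @^-1` K.
  by apply/seteqP; split=> x [u v]; split=> //; [exact: KC|exact: CA].
apply: compact_within_preimage => //; last exact: compact_closed.
exact: continuous_subspaceW cf.
Qed.

Lemma compact_proper_on X Y (A : set X) (B : set Y) (f : X -> Y) :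
  hausdorff_space Y -> compact A -> {within A, continuous f} ->
  {homo f : x / A x >-> B x} -> proper_on A B f.
Proof. by move=> hY cA cf fAB; apply: proper_onI => // K _ _; exists A; split. Qed.

Lemma proper_homotopic_eq X Y (A : set X) (B : set Y) D f g :
  proper_on A B f -> (forall x, A x -> f x = g x) ->
  proper_homotopic R A B D f g.
Proof.
move=> pf fg; exists (f \o snd); split=> //.
exact: proper_on_comp (@proper_on_snd _ _ _) pf.
Qed.

Lemma proper_homotopic_endsl X Y (A : set X) (B : set Y) D f f' g :
  (forall x, A x -> f x = f' x) ->
  proper_homotopic R A B D f g -> proper_homotopic R A B D f' g.
Proof.
move=> ff' [H [pH H0 H1 HD]]; exists H; split=> //.
- by move=> x Ax; rewrite H0// ff'.
- by move=> t x t01 Ax Dx; rewrite HD// ff'.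
Qed.

Lemma proper_homotopic_endsr X Y (A : set X) (B : set Y) D f g g' :
  (forall x, A x -> g x = g' x) ->
  proper_homotopic R A B D f g -> proper_homotopic R A B D f g'.
Proof.
move=> gg' [H [pH H0 H1 HD]]; exists H; split=> //.
by move=> x Ax; rewrite H1// gg'.
Qed.

Lemma proper_homotopic_compr_rel X Y Z (A : set X) (B : set Y) (C : set Z)
    (D : set X) (D' : set Y) k f g :
  hausdorff_space Y -> proper_on A B k -> (forall x, A x -> D x -> D' (k x)) ->
  proper_homotopic R B C D' f g ->
  proper_homotopic R A C D (f \o k) (g \o k).
Proof.
move=> hY pk kD [H [pH H0 H1 HD]].
exists (H \o (fun p : R * X => (p.1, k p.2))); have [_ kAB _] := pk; split => //.
- exact: proper_on_comp (proper_on_cylinder R hY pk) pH.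
- by move=> x Ax; rewrite /= H0//; exact: kAB.
- by move=> x Ax; rewrite /= H1//; exact: kAB.
- by move=> t x t01 Ax Dx; rewrite /= HD//; [exact: kAB|exact: kD].
Qed.

Lemma proper_homotopic_sub X Y (A : set X) (B : set Y) (D D' : set X) f g :
  D' `<=` D -> proper_homotopic R A B D f g -> proper_homotopic R A B D' f g.
Proof.
by move=> DD' [H [pH H0 H1 HD]]; exists H; split=> // t x t01 Ax /DD'; exact: HD.
Qed.

End ProperExtras.

(** * Gluing maps along the cells *)

Section Gluing.
Variables (R : realType) (r : nat) (cut : 'I_r -> nat -> R).
Hypothesis cutP : forall i k, k%:R < cut i k < k.+1%:R.
Local Notation ambient := ('rV[R]_r * R)%type.
Local Notation J := ('I_r * nat)%type.
Local Notation piece := (piece cut).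
Local Notation core := (core cut).
Local Notation minus := (piece_minus cut).
Local Notation plus := (piece_plus cut).
Local Notation cell := (cell cut).
Local Notation Gamma := (Gamma R r).
Implicit Types (i l : 'I_r) (j : J) (c : option J) (p : ambient).

Definition piece_ends j : set ambient := [set minus j; plus j].

(** Each point of the graph has a neighbourhood that meets finitely many cells,
    and cells are closed.  The projection [pi] makes the lemma serve both for maps
    of the graph and for homotopies, on its cylinder. *)
Lemma within_cells (E Y : topologicalType) (pi : E -> ambient) (A : set E)
    (f : E -> Y) :
  continuous pi -> closed A ->
  (forall c, {within A `&` pi @^-1` cell c, continuous f}) ->
  {within A `&` pi @^-1` Gamma, continuous f}.
Proof.
move=> cpi clA cf; apply/subspace_continuousP => e [Ae Ge] W nW.
rewrite /nbhs /= /within /=.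
have H c : nbhs e (fun e' => A e' -> cell c (pi e') -> W (f e')).
  have [ce|nce] := pselect (cell c (pi e)).
    have /subspace_continuousP /(_ e (conj Ae ce) W nW) := cf c.
    rewrite /nbhs /= /within /=; apply: filterS => e' h Ae' ce'.
    exact: h (conj Ae' ce').
  have : nbhs (pi e) (~` cell c).
    by apply: open_nbhs_nbhs; split=> //; apply: closed_openC; exact: closed_cell.
  move=> /(cpi e) h; have {}h : nbhs e (pi @^-1` ~` cell c) by exact: h.
  by apply: filterS h => e' nce' _ /nce'.
have [N hN] : exists N, forall i, (pi e).1 0 i < N%:R.
  have /filter_ex[N hN] := compact_coord_bounded (@compact_set1 _ (pi e)).
  by exists N; exact: hN.
have nb : nbhs e (fun e' => forall i, (pi e').1 0 i < N%:R).
  apply: filter_forall => i.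
  by have := @continuous_coord R r i (pi e) _ (lt_nbhsl (hN i)); exact: cpi.
pose fc (c : option ('I_r * 'I_N)) : option J := omap (fun x => (x.1, val x.2)) c.
have HN : nbhs e (fun e' => forall c : option ('I_r * 'I_N), A e' -> cell (fc c) (pi e') -> W (f e')).
  by apply: filter_forall => c; exact: H.
apply: filterS2 nb HN => e' he' Hc [Ae' Ge'].
have [c ce'] := (Gamma_cell cutP _).1 Ge'.
have [c' c'N c'e] := (ball_graph_cell cut _ _).1 (cell_ball_graph cutP ce' he').
case: c' c'N c'e => [[i m]|] /= mN c'e; last exact: (Hc None).
exact: (Hc (Some (i, Ordinal mN))).
Qed.

(** A compact set lies in a finite ball; since [f] preserves the cells, what it maps
    into a ball lies over that ball. *)
Lemma cellwise_proper (E : topologicalType) (pi : E -> ambient) (A : set E)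
    (f : E -> ambient) :
  continuous pi -> closed A ->
  (forall N, compact (A `&` pi @^-1` ball_graph cut N)) ->
  (forall c, {within A `&` pi @^-1` cell c, continuous f}) ->
  (forall c e, A e -> cell c (pi e) -> cell c (f e)) ->
  proper_on (A `&` pi @^-1` Gamma) Gamma f.
Proof.
move=> cpi clA cA cf fc; apply: proper_onI.
- exact: hausdorff_ambient.
- exact: within_cells.
- by move=> e [Ae /(Gamma_cell cutP)[c ce]]; apply: (cell_Gamma cutP (c := c)); exact: fc.
- move=> K KG cK; have /filter_ex[N hN] := compact_coord_bounded cK.
  exists (A `&` pi @^-1` ball_graph cut N); split=> //.
    by move=> e [Ae /(ball_graph_Gamma cutP)].
  move=> e [Ae /(Gamma_cell cutP)[c ce]] Ke; split=> //=.
  have /(ball_graph_cell cut) [c' c'N c'e] := cell_ball_graph cutP (fc c e Ae ce) (hN _ Ke).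
  apply/ball_graph_cell; exists c => //; case: c ce => // j ce.
  have [_ jlt _] := piece_flat cutP (fc (Some j) e Ae ce).
  by rewrite -(ltr_nat R) (lt_trans jlt)// hN.
Qed.

Definition glue (E Y : Type) (pi : E -> ambient) (f : option J -> E -> Y) (e : E) : Y :=
  if pselect (exists c, cell c (pi e)) is left h then f (projT1 (cid h)) e
  else f None e.

Lemma glueE (E Y : Type) (pi : E -> ambient) (f : option J -> E -> Y) c e :
  (forall c c', cell c (pi e) -> cell c' (pi e) -> f c e = f c' e) ->
  cell c (pi e) -> glue pi f e = f c e.
Proof.
move=> compat ce; rewrite /glue; case: pselect => [h|[]]; last by exists c.
by case: cid => c' c'e /=; exact: compat.
Qed.

(** Maps of the cells that fix the core and the ends of the pieces agree where
    the cells meet. *)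
Lemma compat_rel (E : Type) (pi : E -> ambient) (f : option J -> E -> ambient) e :
  (core (pi e) -> f None e = pi e) ->
  (forall j, piece_ends j (pi e) -> f (Some j) e = pi e) ->
  forall c c', cell c (pi e) -> cell c' (pi e) -> f c e = f c' e.
Proof.
move=> f0 fj [j|] [j'|] //= ce ce'.
- have [->//|[_ [_ [ej ej']]]|[_ [_ [ej ej']]]] := piece_overlap cutP ce ce'.
    by rewrite !fj//; [left|right].
  by rewrite !fj//; [right|left].
- have [_ e'] := core_overlap cutP ce' ce.
  by rewrite f0// fj//; left.
- have [_ e'] := core_overlap cutP ce ce'.
  by rewrite f0// fj//; left.
Qed.

Definition piece_self (j : J) (a : ambient -> ambient) : Prop :=
  [/\ {within piece j, continuous a}, {homo a : p / piece j p} &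
     forall p, piece_ends j p -> a p = p].

Definition cell_self (a : option J -> ambient -> ambient) : Prop :=
  (forall p, core p -> a None p = p) /\ forall j, piece_self j (a (Some j)).

Lemma glue_selfE a c p : cell_self a -> cell c p -> glue id a p = a c p.
Proof.
move=> [a0 aj] cp; apply: glueE => //; apply: compat_rel; first exact: a0.
by move=> j pj; have [_ _] := aj j; exact.
Qed.

Lemma cell_self_homo a c p : cell_self a -> cell c p -> cell c (a c p).
Proof.
by case: c => [j|] [a0 aj] cp /=; [have [_ h _] := aj j; exact: h|rewrite a0].
Qed.

Lemma glue_homo a c p : cell_self a -> cell c p -> cell c (glue id a p).
Proof. by move=> ha cp; rewrite (glue_selfE ha cp); exact: cell_self_homo. Qed.

Lemma glue_self_within a c : cell_self a -> {within cell c, continuous (glue id a)}.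
Proof.
move=> ha; apply: (@within_eq _ _ _ (a c)) => [p cp|].
  by rewrite (glue_selfE ha cp).
case: c => [j|]; first by have [_ /(_ j)[]] := ha.
apply: (@within_eq _ _ _ id) => [p cp|].
  by have [-> ] := ha.
by apply: continuous_subspaceT => p; exact: cvg_id.
Qed.

Lemma glue_self_proper a : cell_self a -> proper_on Gamma Gamma (glue id a).
Proof.
move=> ha; rewrite -[X in proper_on X](setTI Gamma).
apply: (@cellwise_proper ambient id setT) => //.
- by move=> p; exact: cvg_id.
- by move=> N; rewrite setTI; exact: compact_ball_graph.
- by move=> c; rewrite setTI; exact: glue_self_within.
- by move=> c p _; exact: glue_homo.
Qed.

Lemma glue_self_comp a b : cell_self a -> cell_self b ->
  cell_self (fun c => a c \o b c) /\
  forall p, Gamma p -> glue id (fun c => a c \o b c) p = glue id a (glue id b p).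
Proof.
move=> ha hb; have hab : cell_self (fun c => a c \o b c).
  have [a0 aj] := ha; have [b0 bj] := hb; split=> [p cp|j].
    by rewrite /= b0// a0.
  have [ca ah ae] := aj j; have [cb bh be] := bj j; split.
  - exact: within_comp ca.
  - by move=> p /bh /ah.
  - by move=> p pj; rewrite /= be// ae.
split=> // p /(Gamma_cell cutP)[c cp].
by rewrite (glue_selfE hab cp) (glue_selfE hb cp) (glue_selfE ha (c := c))//; exact: cell_self_homo.
Qed.

(** Homotopies of the pieces relative to their ends fit together; they form a
    proper homotopy since each of them stays in its piece. *)
Lemma glue_homotopy a b : cell_self a -> cell_self b ->
  (forall j, proper_homotopic R (piece j) (piece j) (piece_ends j) (a (Some j)) (b (Some j))) ->
  exists H : R * ambient -> ambient,
    [/\ proper_on (cylinder R Gamma) Gamma H,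
        forall p, Gamma p -> H (0, p) = glue id a p,
        forall p, Gamma p -> H (1, p) = glue id b p &
        forall c t p, `[0, 1]%classic t -> cell c p -> cell c (H (t, p))].
Proof.
move=> ha hb /choice[H HP].
pose K (c : option J) (e : R * ambient) : ambient := if c is Some j then H j e else e.2.
have KE c e : `[0, 1]%classic e.1 -> cell c e.2 -> glue snd K e = K c e.
  move=> e01 ce; apply: glueE => //; apply: compat_rel => // j ej.
  case: e e01 ej {ce} => t p /= e01 ej; have [_ _ _ ->//] := HP j; last first.
    by case: ej => ->; [exact: piece_has_minus|exact: piece_has_plus].
  by have [_ /(_ j)[_ _]] := ha; exact.
have Kcell c t p : `[0, 1]%classic t -> cell c p -> cell c (glue snd K (t, p)).
  move=> t01 cp; rewrite (KE c)//; case: c cp => //= j jp.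
  by have [[_ h _] _ _ _] := HP j; exact: h.
exists (glue snd K); split=> //.
- have -> : cylinder R Gamma = (fst @^-1` `[0, 1]%classic) `&` snd @^-1` Gamma by [].
  apply: cellwise_proper.
  + exact: continuous_snd_prod.
  + by apply: closed_continuous_preimage; [exact: continuous_fst_prod|exact: itv_closed].
  + move=> N; rewrite -[X in compact X]/(cylinder R (ball_graph cut N)).
    by apply: compact_setX; [exact: segment_compact|exact: compact_ball_graph].
  + move=> c; apply: (@within_eq _ _ _ (K c)) => [e [e01 ce]|]; first by rewrite (KE c).
    case: c => [j|]; last by apply: continuous_subspaceT; exact: continuous_snd_prod.
    by have [[]] := HP j.
  + by move=> c [t p]; exact: Kcell.
- move=> p /(Gamma_cell cutP)[c cp]; rewrite (KE c)//=; last by rewrite in_itv /= lexx ler01.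
  rewrite (glue_selfE ha cp); case: c cp => [j|] /= cp.
    by have [_ h _ _] := HP j; exact: h.
  by have [->] := ha.
- move=> p /(Gamma_cell cutP)[c cp]; rewrite (KE c)//=; last by rewrite in_itv /= lexx ler01.
  rewrite (glue_selfE hb cp); case: c cp => [j|] /= cp.
    by have [_ _ h _] := HP j; exact: h.
  by have [->] := hb.
Qed.

Lemma glue_homotopic a b : cell_self a -> cell_self b ->
  (forall j, proper_homotopic R (piece j) (piece j) (piece_ends j) (a (Some j)) (b (Some j))) ->
  proper_homotopic R Gamma Gamma set0 (glue id a) (glue id b).
Proof.
by move=> ha hb hab; have [H [pH H0 H1 _]] := glue_homotopy ha hb hab; exists H; split.
Qed.

Lemma glue_homotopic_ball a b N : cell_self a -> cell_self b ->
  (forall j, proper_homotopic R (piece j) (piece j) (piece_ends j) (a (Some j)) (b (Some j))) ->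
  proper_homotopic R (ball_graph cut N) (ball_graph cut N) set0 (glue id a) (glue id b).
Proof.
move=> ha hb hab; have [H [[cH HG _] H0 H1 Hc]] := glue_homotopy ha hb hab.
exists H; split=> //.
- apply: compact_proper_on.
  + exact: hausdorff_ambient.
  + by apply: compact_setX; [exact: segment_compact|exact: compact_ball_graph].
  + by apply: continuous_subspaceW cH => -[t p] [t01 /(ball_graph_Gamma cutP)].
  + move=> [t p] [t01 /(ball_graph_cell cut)[c cN cp]].
    by apply/ball_graph_cell; exists c => //; exact: Hc.
- by move=> p /(ball_graph_Gamma cutP) /H0.
- by move=> p /(ball_graph_Gamma cutP) /H1.
Qed.

(** The homotopy is constant off the piece [j].  It is proper because the preimage
    of a compact set is covered by the cylinders over [j] and over the preimage
    under [f]. *)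
Lemma homotopic_on_piece j (f g : ambient -> ambient) :
  proper_on Gamma Gamma f ->
  (forall c p, cell c p -> c <> Some j -> f p = g p) ->
  proper_homotopic R (piece j) Gamma (piece_ends j) f g ->
  proper_homotopic R Gamma Gamma set0 f g.
Proof.
move=> [cf fG pf] fg [H [[cH HG pH] H0 H1 HD]].
pose K (c : option J) (e : R * ambient) := if c == Some j then H e else f e.2.
have Kends e c : `[0, 1]%classic e.1 -> cell c e.2 -> piece j e.2 ->
    c <> Some j -> H e = f e.2.
  case: e => t p /= t01 cp jp cj; apply: HD => //.
  case: c cp cj => [k|] /= cp cj; last by left; have [_ ->] := core_overlap cutP cp jp.
  have [e|[_ [_ [_ ->]]]|[_ [_ [-> _]]]] := piece_overlap cutP cp jp.
  - by rewrite e in cj.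
  - by left.
  - by right.
have KE c e : `[0, 1]%classic e.1 -> cell c e.2 -> glue snd K e = K c e.
  move=> e01 ce; apply: glueE => // c1 c2 ce1 ce2; rewrite /K.
  case: eqP => [e1|ne1]; case: eqP => [e2|ne2] //; subst.
    exact: Kends ce2 ce1 ne2.
  exact/esym/(Kends _ _ _ ce1 ce2 ne1).
have KG e : cylinder R Gamma e -> Gamma (glue snd K e).
  move=> [e01 /[dup] Ge /(Gamma_cell cutP)[c ce]]; rewrite (KE c)// /K.
  by case: eqP => [cj|_]; [apply: HG; split=> //; rewrite cj in ce|exact: fG].
exists (glue snd K); split=> //.
- apply: proper_onI; [exact: hausdorff_ambient| |exact: KG|].
  + have -> : cylinder R Gamma = (fst @^-1` `[0, 1]%classic) `&` snd @^-1` Gamma by [].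
    apply: within_cells.
    * exact: continuous_snd_prod.
    * by apply: closed_continuous_preimage; [exact: continuous_fst_prod|exact: itv_closed].
    * move=> c; apply: (@within_eq _ _ _ (K c)) => [e [e01 ce]|]; first by rewrite (KE c).
      rewrite /K; case: eqP => [->//|_].
      apply: (@within_comp _ _ _ _ Gamma snd) => //.
        by move=> e [_ /= ce]; exact: cell_Gamma ce.
      by apply: continuous_subspaceT; exact: continuous_snd_prod.
  + move=> L LG cL; exists (cylinder R (piece j) `|` cylinder R (Gamma `&` f @^-1` L)).
    split.
    * by apply: compactU; (apply: compact_setX; [exact: segment_compact|]);
        [exact: (@compact_cell _ _ cut (Some j))|exact: pf].
    * move=> [t p] [[t01 jp]|[t01 [Gp _]]]; split=> //.
      exact: (cell_Gamma cutP (c := Some j)).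
    * move=> [t p] [/= t01 /[dup] Gp /(Gamma_cell cutP)[c cp]]; rewrite (KE c)// /K.
      by case: eqP => [cj _|_ Lp]; [left; rewrite cj in cp|right].
- move=> p /(Gamma_cell cutP)[c cp]; rewrite (KE c)//=; last by rewrite in_itv /= lexx ler01.
  by rewrite /K; case: eqP => // cj; rewrite H0//; rewrite cj in cp.
- move=> p /(Gamma_cell cutP)[c cp]; rewrite (KE c)//=; last by rewrite in_itv /= lexx ler01.
  rewrite /K; case: eqP => [cj|/(fg c p cp)//]; rewrite H1//; by rewrite cj in cp.
Qed.

End Gluing.

(** * Homotopies of compact spaces *)

Section Compacts.
Variable R : realType.

Lemma compact_cylinder (X : topologicalType) (A : set X) :
  compact A -> compact (cylinder R A).
Proof. by move=> cA; apply: compact_setX => //; exact: segment_compact. Qed.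

Lemma proper_homotopic_compl_compact (X Y Z : topologicalType) (A : set X)
    (B : set Y) (C : set Z) D f g k :
  hausdorff_space Z -> compact A -> {within B, continuous k} ->
  {homo k : y / B y >-> C y} ->
  proper_homotopic R A B D f g -> proper_homotopic R A C D (k \o f) (k \o g).
Proof.
move=> hZ cA ck kBC [H [[cH HB pH] H0 H1 HD]]; exists (k \o H); split.
- apply: compact_proper_on => //; first exact: compact_cylinder.
    exact: within_comp ck.
  by move=> e /HB /kBC.
- by move=> x Ax; rewrite /= H0.
- by move=> x Ax; rewrite /= H1.
- by move=> t x t01 Ax Dx; rewrite /= HD.
Qed.

Lemma proper_homotopic_restrict (X Y : topologicalType) (A A' : set X)
    (B : set Y) D f g :
  hausdorff_space X -> compact A' -> A' `<=` A ->
  proper_homotopic R A B D f g -> proper_homotopic R A' B D f g.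
Proof.
move=> hX cA' AA'.
have pid : proper_on A' A (@id X).
  by apply: compact_proper_on => //; apply: continuous_subspaceT => x; exact: cvg_id.
exact: (@proper_homotopic_compr_rel _ _ _ _ _ _ _ _ _ id).
Qed.

End Compacts.

(** * Maps of a loop and of a segment with a loop *)

Section LoopDegree.
Variable R : realType.
Implicit Types (a b s t x y : R) (k : nat) (q : R * R).

Let clamp (t : R) := Num.min (Num.max t 0) 1.

Let continuous_clamp : continuous clamp.
Proof.
move=> s; apply: (@continuous_min _ _ (fun s => Num.max s 0) (cst 1)); last exact: cvg_cst.
by apply: (@continuous_max _ _ id (cst 0)); [exact: cvg_id|exact: cvg_cst].
Qed.

Let clamp01 t : `[0, 1]%classic (clamp t).
Proof. by rewrite /= in_itv /= /clamp le_min ge_min lexx orbT le_max lexx orbT ler01. Qed.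

Let clamp0 : clamp 0 = 0.
Proof. by rewrite /clamp maxxx min_l. Qed.

Let clamp1 : clamp 1 = 1.
Proof. by rewrite /clamp max_l// minxx. Qed.

(** The time is clamped to the unit interval to obtain a homotopy defined on the
    whole plane. *)
Lemma loop_degree k (H : R * (R * R) -> R * R) (f : R * R -> R * R) (xi : R -> R) :
  proper_homotopic R (loop_at k) (loop_at k) set0 id f ->
  continuous xi ->
  (forall s, 0 <= s <= pi *+ 2 -> f (loop_param k s) = loop_param k (xi s)) ->
  xi (pi *+ 2) = xi 0 + pi *+ 2.
Proof.
move=> [{}H [[cH HL _] H0 H1 _]] cxi fE.
pose G (e : R * R) := H (clamp e.1, loop_param k e.2).
have GL e : loop_at k (G e).
  by apply: HL; split; [exact: clamp01|exact: loop_paramP].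
have cG : continuous G.
  have cp : continuous (fun e : R * R => (clamp e.1, loop_param k e.2)).
    apply: continuous_pair => e; apply: continuous_comp.
    - exact: cvg_fst.
    - exact: continuous_clamp.
    - exact: cvg_snd.
    - exact: continuous_loop_param.
  have /continuous_subspaceT := cp => /(_ setT) cp'.
  have : {within setT, continuous G}.
    apply: (within_comp _ cp' cH) => e _.
    by split; [exact: clamp01|exact: loop_paramP].
  by rewrite -continuous_subspace_setT.
pose X e := 4 * ((G e).1 - k%:R); pose Y e := 4 * ((G e).2 - 4^-1).
have XE e c : (G e).1 = k%:R + c / 4 -> X e = c.
  by rewrite /X => ->; field.
have YE e c : (G e).2 = 4^-1 + c / 4 -> Y e = c.
  by rewrite /Y => ->; field.
have G0 s : G (0, s) = loop_param k s.
  by rewrite /G /= clamp0 H0//; exact: loop_paramP.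
have G1 s : 0 <= s <= pi *+ 2 -> G (1, s) = loop_param k (xi s).
  by move=> sI; rewrite /G /= clamp1 H1 ?fE//; exact: loop_paramP.
apply: (@degree_homotopy R X Y xi) => //.
- move=> e; apply: cvgM; first exact: cvg_cst.
  apply: cvgB; last exact: cvg_cst.
  by apply: continuous_comp; [exact: cG|exact: cvg_fst].
- move=> e; apply: cvgM; first exact: cvg_cst.
  apply: cvgB; last exact: cvg_cst.
  by apply: continuous_comp; [exact: cG|exact: cvg_snd].
- move=> e; have := GL e; rewrite /loop_at /X /Y /= !exprMn -mulrDr => ->.
  by field.
- move=> t; suff e : G (t, pi *+ 2) = G (t, 0) by rewrite /X /Y e.
  by rewrite /G /loop_param cos2pi sin2pi cos0 sin0.
- by move=> s _; split; [apply: XE|apply: YE]; rewrite G0.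
- by move=> s sI; split; [apply: XE|apply: YE]; rewrite G1.
Qed.

(** A map of the circle that misses a point has a continuous angle, hence degree
    0, whereas a map homotopic to the identity has degree 1. *)
Lemma loop_surjective k (f : R * R -> R * R) :
  proper_homotopic R (loop_at k) (loop_at k) set0 id f ->
  forall q, loop_at k q -> exists2 z, loop_at k z & f z = q.
Proof.
move=> hf q /[dup] lq /loop_param_surj[s0 qE]; apply: contrapT => miss.
have [[cf fL _]] : proper_on (loop_at k) (loop_at k) f /\ True.
  split=> //; case: hf => H [[cH HL _] _ H1 _]; apply: compact_proper_on.
  - exact: norm_hausdorff.
  - exact: compact_loop_at.
  - apply: (@within_eq _ _ _ (H \o (fun q => (1, q)))).
      by move=> z /H1.
    apply: (@within_comp _ _ _ _ (cylinder R (loop_at k))) => //.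
      by move=> z lz; split=> //=; rewrite in_itv/= ler01 lexx.
    apply: continuous_subspaceT; apply: continuous_pair => z; first exact: cvg_cst.
    exact: cvg_id.
  - move=> z lz; rewrite -H1//; apply: HL; split=> //=.
    by rewrite in_itv/= ler01 lexx.
move=> _; pose v s := f (loop_param k s).
have vL s : loop_at k (v s) by apply: fL; exact: loop_paramP.
have cv : continuous v.
  have /continuous_subspaceT := @continuous_loop_param R k => /(_ setT) cp.
  have : {within setT, continuous v}.
    by apply: (within_comp _ cp cf) => s _; exact: loop_paramP.
  by rewrite -continuous_subspace_setT.
pose c s := 4 * ((v s).1 - k%:R); pose d s := 4 * ((v s).2 - 4^-1).
have cc : continuous c.
  move=> s; apply: cvgM; first exact: cvg_cst.
  apply: cvgB; last exact: cvg_cst.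
  by apply: continuous_comp; [exact: cv|exact: cvg_fst].
have cd : continuous d.
  move=> s; apply: cvgM; first exact: cvg_cst.
  apply: cvgB; last exact: cvg_cst.
  by apply: continuous_comp; [exact: cv|exact: cvg_snd].
have cd1 s : c s ^+ 2 + d s ^+ 2 = 1.
  by have := vL s; rewrite /loop_at /c /d /= !exprMn -mulrDr => ->; field.
(* rotate the missed point to -1 *)
pose al := s0 + pi.
pose c' s := c s * cos al + d s * sin al; pose d' s := d s * cos al - c s * sin al.
have ab1 : cos al ^+ 2 + sin al ^+ 2 = 1 by exact: cos2Dsin2.
have cd1' s : c' s ^+ 2 + d' s ^+ 2 = 1.
  rewrite -[RHS](mulr1 1) -{1}(cd1 s) -ab1 /c' /d'.
  by move: (c s) (d s) (cos al) (sin al) => x y z w; ring.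
have cN1 s : c' s != -1.
  apply/eqP => e; apply: miss; exists (loop_param k s); first exact: loop_paramP.
  have d0 : d' s = 0.
    by apply/eqP; rewrite -sqrf_eq0; apply/eqP; have := cd1' s; rewrite e; lra.
  have e1 : c s = cos s0.
    have -> : c s = c' s * cos al - d' s * sin al.
      rewrite /c' /d' -[LHS]mulr1 -ab1.
      by move: (c s) (d s) (cos al) (sin al) => x y z w; ring.
    by rewrite e d0 cosDpi; ring.
  have e2 : d s = sin s0.
    have -> : d s = c' s * sin al + d' s * cos al.
      rewrite /c' /d' -[LHS]mulr1 -ab1.
      by move: (c s) (d s) (cos al) (sin al) => x y z w; ring.
    by rewrite e d0 sinDpi; ring.
  rewrite -/(v s) qE /loop_param -e1 -e2 /c /d; case: (v s) => x y /=.
  by congr pair; field.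
have cc' : continuous c'.
  move=> s; apply: cvgD; apply: cvgM; try exact: cvg_cst; [exact: cc|exact: cd].
have cd' : continuous d'.
  move=> s; apply: cvgB; apply: cvgM; try exact: cvg_cst; [exact: cd|exact: cc].
pose xi s := angle (c' s) (d' s) + al.
have cxi : continuous xi.
  move=> s; apply: cvgD; last exact: cvg_cst.
  exact: angle_continuous.
have := @loop_degree k (fun=> 0) f xi hf cxi.
have fE s : 0 <= s <= pi *+ 2 -> f (loop_param k s) = loop_param k (xi s).
  move=> _; have [ac as_] := angleP (cd1' s) (cN1 s).
  rewrite /xi /loop_param cosD sinD ac as_ -/(v s).
  have -> : c' s * cos al - d' s * sin al = c s.
    rewrite /c' /d' -[RHS]mulr1 -ab1.
    by move: (c s) (d s) (cos al) (sin al) => x y z w; ring.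
  have -> : d' s * cos al + c' s * sin al = d s.
    rewrite /c' /d' -[RHS]mulr1 -ab1.
    by move: (c s) (d s) (cos al) (sin al) => x y z w; ring.
  by rewrite /c /d; case: (v s) => x y /=; congr pair; field.
move=> /(_ fE).
have -> : xi (pi *+ 2) = xi 0.
  by rewrite /xi /c' /d' /c /d /v /loop_param cos2pi sin2pi cos0 sin0.
have := pi_gt0 R; rewrite mulr2n; move: (xi 0) (@pi R); clear=> x y ? ?; lra.
Qed.

(** On a segment with a loop at the origin, only the loop is reflected: its one
    point with second coordinate 0 is the origin. *)
Definition flip q : R * R := if q.2 == 0 then q else (- q.1, q.2).

Lemma flip_loop s : flip (loop_param 0 s) = loop_param 0 (pi - s).
Proof.
have e : loop_param 0 (pi - s) = (- (loop_param 0 s).1, (loop_param 0 s).2).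
  rewrite /loop_param cosB sinB cospi sinpi /=; congr pair; first by field.
  by field.
rewrite /flip e; case: eqP => // y0.
have [_ _ /(_ y0) x0] := loop_atP (loop_paramP 0 s).
by case: (loop_param 0 s) x0 => x y /= ->; rewrite oppr0.
Qed.

Lemma flip_not_homotopic :
  ~ proper_homotopic R (loop_at 0) (loop_at 0) set0 id flip.
Proof.
move=> h; have := @loop_degree 0 (fun=> 0) flip (fun s => pi - s) h.
have cxi : continuous (fun s : R => pi - s).
  by move=> s; apply: cvgB; [exact: cvg_cst|exact: cvg_id].
move=> /(_ cxi (fun s _ => flip_loop s)).
have := pi_gt0 R; rewrite mulr2n => ? ?; lra.
Qed.

(** * A segment with a loop *)

Definition shape a b k : set (R * R) := base_segment a b `|` loop_at k.

(** The retraction of a segment with a loop at [k] onto the loop. *)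
Definition collapse k q : R * R := if q.2 == 0 then (k%:R, 0) else q.
(** The retraction of a segment with a loop at [k] onto the segment, as a
    coordinate. *)
Definition height k q : R := if q.2 == 0 then q.1 else k%:R.

Lemma within_shape (Y : topologicalType) a b k (f : R * R -> Y) :
  {within base_segment a b, continuous f} -> {within loop_at k, continuous f} ->
  {within shape a b k, continuous f}.
Proof.
move=> cs cl; apply: withinU_continuous => //.
  exact: closed_base_segment.
exact: closed_loop_at.
Qed.

Lemma compact_shape a b k : compact (shape a b k).
Proof. by apply: compactU; [exact: compact_base_segment|exact: compact_loop_at]. Qed.

Lemma collapse_loop k q : loop_at k q -> collapse k q = q.
Proof.
move=> lq; rewrite /collapse; case: eqP => // y0.
have [_ _ /(_ y0) x0] := loop_atP lq.
by case: q x0 y0 {lq} => x y /= -> ->.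
Qed.

Lemma collapse_in a b k q : shape a b k q -> loop_at k (collapse k q).
Proof.
case=> [[_ q0]|lq]; last by rewrite collapse_loop.
by rewrite /collapse q0 eqxx; exact: loop_base.
Qed.

Lemma continuous_collapse a b k : {within shape a b k, continuous (collapse k)}.
Proof.
apply: within_shape.
  apply: (@within_eq _ _ _ (fun=> (k%:R : R, 0 : R))).
    by move=> q [_ q0]; rewrite /collapse q0 eqxx.
  by apply: continuous_subspaceT => q; exact: cvg_cst.
apply: (@within_eq _ _ _ id); first by move=> q /collapse_loop.
by apply: continuous_subspaceT => q; exact: cvg_id.
Qed.

Lemma continuous_height a b k : {within shape a b k, continuous (height k)}.
Proof.
apply: within_shape.
  apply: (@within_eq _ _ _ fst).
    by move=> q [_ q0]; rewrite /height q0 eqxx.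
  by apply: continuous_subspaceT; exact: continuous_fst_prod.
apply: (@within_eq _ _ _ (fun=> k%:R : R)).
  move=> q lq; rewrite /height; case: eqP => // y0.
  by have [_ _ ->] := loop_atP lq.
by apply: continuous_subspaceT => q; exact: cvg_cst.
Qed.

(** Points of the loop off the segment are reached by the degree, points of the
    segment off the loop by the intermediate value theorem for [height].  The point
    where the two meet is a limit of the latter, and the image is closed. *)
Lemma shape_surjective a b k (f : R * R -> R * R) : a < k%:R < b ->
  proper_on (shape a b k) (shape a b k) f ->
  proper_homotopic R (shape a b k) (shape a b k) [set (a, 0); (b, 0)] f id ->
  f @` shape a b k = shape a b k.
Proof.
move=> /andP[ak kb] [cf fS _] hf.
have Sa : shape a b k (a, 0) by left; split=> //=; rewrite lexx (ltW (lt_trans ak kb)).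
have Sb : shape a b k (b, 0) by left; split=> //=; rewrite lexx (ltW (lt_trans ak kb)).
have fa : f (a, 0) = (a, 0).
  case: hf => H [_ H0 H1 HD]; rewrite -[RHS]H1// HD ?H0//; last by left.
  by rewrite /= in_itv /= ler01 lexx.
have fb : f (b, 0) = (b, 0).
  case: hf => H [_ H0 H1 HD]; rewrite -[RHS]H1// HD ?H0//; last by right.
  by rewrite /= in_itv /= ler01 lexx.
have hloop : proper_homotopic R (loop_at k) (loop_at k) set0 id (collapse k \o f).
  have := proper_homotopic_sub (@sub0set _ _) (proper_homotopic_sym hf).
  move=> /(proper_homotopic_restrict (@norm_hausdorff _ _) (@compact_loop_at R k) (@subsetUr _ _ _)).
  have hk := @continuous_collapse a b k.
  move=> /(proper_homotopic_compl_compact (@norm_hausdorff _ _) (@compact_loop_at R k) hk (@collapse_in a b k)).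
  by apply: proper_homotopic_endsl => q; exact: collapse_loop.
have offbase x : a <= x <= b -> x != k%:R -> (f @` shape a b k) (x, 0).
  move=> xab xk; pose g x := height k (f (x, 0)).
  have cg : {within `[a, b], continuous g}.
    apply: (@within_comp _ _ _ _ (shape a b k) (fun x => f (x, 0))).
    - by move=> y /=; rewrite in_itv /= => yab; apply: fS; left.
    - apply: (@within_comp _ _ _ _ (shape a b k) (fun x => (x, 0))) => //.
        by move=> y /=; rewrite in_itv /= => yab; left.
      apply: continuous_subspaceT; apply: continuous_pair => y; last exact: cvg_cst.
      exact: cvg_id.
    - exact: continuous_height.
  have ga : g a = a by rewrite /g fa /height eqxx.
  have gb : g b = b by rewrite /g fb /height eqxx.
  have le_ab : a <= b by rewrite (ltW (lt_trans ak kb)).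
  have gI : Num.min (g a) (g b) <= x <= Num.max (g a) (g b).
    by rewrite ga gb min_l// max_r.
  have [z] := IVT le_ab cg gI; rewrite in_itv /= => zab.
  rewrite /g /height; case: eqP => [f0 e|_ e]; last by rewrite e eqxx in xk.
  by exists (z, 0); [left|case: (f (z, 0)) f0 e => ? ? /= -> ->].
apply/seteqP; split=> [_ [q Sq <-]|q]; first exact: fS.
have [y0|y0] := eqVneq q.2 0; last first.
  move=> [[_ /eqP]|lq]; first by rewrite (negbTE y0).
  have [z lz] := loop_surjective hloop lq.
  rewrite /= /collapse; case: eqP => [_ e|_ e]; first by rewrite -e eqxx in y0.
  by exists z => //; right.
have -> : q = (q.1, 0) by case: q y0 => x y /= ->.
move=> Sq; have qab : a <= q.1 <= b.
  case: Sq => [[]//|lq]; have [_ _ /(_ erefl) /= ->] := loop_atP lq.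
  by rewrite !ltW.
have [qk|] := eqVneq q.1 k%:R; last exact: offbase.
have clS : closed (f @` shape a b k).
  apply: compact_closed; first exact: norm_hausdorff.
  by apply: continuous_compact => //; exact: compact_shape.
apply: clS => B nB; rewrite qk in nB.
have cx : continuous (fun x : R => (x, 0 : R)).
  by apply: continuous_pair => x; [exact: cvg_id|exact: cvg_cst].
have /nbhs_ballP[e /= e0 eB] : nbhs (k%:R : R) [set x | B (x, 0)] by exact: (cx k%:R _ nB).
(* a point of the segment off the loop, within e of the loop *)
pose x := k%:R + Num.min (e / 2) (b - k%:R).
have m0 : 0 < Num.min (e / 2) (b - k%:R) by rewrite lt_min divr_gt0//= subr_gt0.
exists (x, 0); split.
  apply: offbase; last by rewrite gt_eqF// ltrDl.
  apply/andP; split; last by rewrite /x -lerBrDl ge_min lexx orbT.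
  by apply: (le_trans (ltW ak)); rewrite lerDl ltW.
apply: eB; rewrite /ball /= /x opprD addNKr normrN gtr0_norm//.
by rewrite gt_min ltr_pdivrMr// mulr_natr mulr2n ltrDl e0.
Qed.

Lemma flip_flip q : shape (- 2^-1) 2^-1 0 q -> flip (flip q) = q.
Proof.
rewrite /flip => _; case: (eqVneq q.2 0) => [->|ne]; first by rewrite eqxx.
by rewrite /= (negbTE ne) opprK; case: q ne.
Qed.

Lemma flip_loopE q : loop_at 0 q -> flip q = (- q.1, q.2).
Proof.
move=> lq; rewrite /flip; case: eqP => // y0.
have [_ _ /(_ y0) x0] := loop_atP lq.
by case: q x0 {lq y0} => x y /= ->; rewrite oppr0.
Qed.

Lemma flip_in_loop q : loop_at 0 q -> loop_at 0 (flip q).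
Proof. by move=> lq; rewrite flip_loopE//; move: lq; rewrite /loop_at /= !subr0 sqrrN. Qed.

Lemma flip_base a b q : base_segment a b q -> flip q = q.
Proof. by move=> [_ q0]; rewrite /flip q0 eqxx. Qed.

Lemma continuous_flip : {within @Y1 R, continuous flip}.
Proof.
apply: within_shape.
  apply: (@within_eq _ _ _ id); first by move=> q /flip_base.
  by apply: continuous_subspaceT => q; exact: cvg_id.
apply: (@within_eq _ _ _ (fun q => (- q.1, q.2))); first by move=> q /flip_loopE.
apply: continuous_subspaceT; apply: continuous_pair => q; last exact: cvg_snd.
by apply: cvgN; exact: cvg_fst.
Qed.

Lemma flip_Y1 q : Y1 q -> Y1 (flip q).
Proof. by case=> [bq|/flip_in_loop]; [left; rewrite (flip_base bq)|right]. Qed.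

Lemma proper_flip : proper_on (@Y1 R) (@Y1 R) flip.
Proof.
apply: compact_proper_on.
- exact: norm_hausdorff.
- exact: compact_shape.
- exact: continuous_flip.
- exact: flip_Y1.
Qed.

End LoopDegree.

(** * Flips of the loops of the graph *)

Section LoopFlips.
Variables (R : realType) (r : nat) (D : rigid_structure R r).
Local Notation ambient := ('rV[R]_r * R)%type.
Local Notation J := ('I_r * nat)%type.
Local Notation piece := (piece (Defs.cut D)).
Local Notation core := (core (Defs.cut D)).
Local Notation minus := (piece_minus (Defs.cut D)).
Local Notation plus := (piece_plus (Defs.cut D)).
Local Notation cell := (cell (Defs.cut D)).
Local Notation Gamma := (Gamma R r).
Local Notation Y1 := (@Y1 R).
Local Notation ends := (piece_ends (Defs.cut D)).
Local Notation cutP := (@cut_bounds R r D).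
Implicit Types (i l : 'I_r) (j k : J) (c : option J) (p : ambient) (q : R * R).

Definition Y1_ends : set (R * R) := [set Y1_minus R; Y1_plus R].

Lemma compact_piece j : compact (piece j).
Proof. exact: (@compact_cell _ _ (Defs.cut D) (Some j)). Qed.

Lemma compact_Y1 : compact Y1.
Proof. exact: compact_shape. Qed.

Lemma piece_Gamma j : piece j `<=` Gamma.
Proof. exact: (cell_Gamma cutP (c := Some j)). Qed.

Lemma mark_ends j p : ends j p -> Y1_ends (mark D j p).
Proof. by have [em ep] := mark_boundary D j; case=> ->; rewrite ?em ?ep; [left|right]. Qed.

Lemma flip_ends q : Y1_ends q -> flip q = q.
Proof. by case=> ->; rewrite /flip eqxx. Qed.

Lemma unmark_mark_ends j p : ends j p -> unmark D j (mark D j p) = p.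
Proof.
have [em ep] := mark_boundary D j; have [um up] := unmark_boundary D j.
by case=> ->; rewrite ?em ?ep ?um ?up.
Qed.

Lemma within_mark j : {within piece j, continuous (mark D j)}.
Proof. by have [] := mark_proper D j. Qed.

Lemma within_unmark j : {within Y1, continuous (unmark D j)}.
Proof. by have [] := unmark_proper D j. Qed.

Lemma mark_Y1 j p : piece j p -> Y1 (mark D j p).
Proof. by have [_ h _] := mark_proper D j; exact: h. Qed.

Lemma unmark_piece j q : Y1 q -> piece j (unmark D j q).
Proof. by have [_ h _] := unmark_proper D j; exact: h. Qed.

(** [mark j \o unmark j] is homotopic to the identity relative to the ends of Y^1,
    hence onto by [shape_surjective]. *)
Lemma mark_surjective j : mark D j @` piece j = Y1.
Proof.
have half_gt0 : 0 < 2^-1 :> R by rewrite invr_gt0 ltr0n.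
have := @shape_surjective R (- 2^-1) 2^-1 0 (mark D j \o unmark D j).
move=> /(_ _ _ (mark_unmark D j)) h.
have e : (mark D j \o unmark D j) @` Y1 = Y1.
  apply: h; first by rewrite oppr_lt0 half_gt0.
  exact: proper_on_comp (unmark_proper D j) (mark_proper D j).
apply/seteqP; split=> [_ [p jp <-]|q]; first exact: mark_Y1.
by rewrite -{1}e => -[z Yz <-]; exists (unmark D j z) => //; exact: unmark_piece.
Qed.

(** The same argument, carried to the plane of the ray. *)
Lemma unmark_surjective j : unmark D j @` Y1 = piece j.
Proof.
pose S := shape (Defs.cut D j.1 j.2) (Defs.cut D j.1 j.2.+1) j.2.+1.
have pR : proper_on S (piece j) (ray_plane j.1).
  apply: compact_proper_on.
  - exact: hausdorff_ambient.
  - exact: compact_shape.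
  - exact/continuous_subspaceT/continuous_ray_plane.
  - by move=> q Sq; exists q.
have pF : proper_on (piece j) S (flat j.1).
  apply: compact_proper_on.
  - exact: norm_hausdorff.
  - exact: compact_piece.
  - exact/continuous_subspaceT/continuous_flat.
  - by move=> _ [q Sq <-]; rewrite flatK.
pose f := flat j.1 \o ((unmark D j \o mark D j) \o ray_plane j.1).
have pf : proper_on S S f.
  apply: proper_on_comp pF; apply: proper_on_comp pR _.
  exact: proper_on_comp (mark_proper D j) (unmark_proper D j).
have hf : proper_homotopic R S S
    [set (Defs.cut D j.1 j.2, 0); (Defs.cut D j.1 j.2.+1, 0)] f id.
  have := proper_homotopic_compr_rel (hausdorff_ambient (R := R) (r := r)) pR _ (unmark_mark D j).
  move=> /(_ [set (Defs.cut D j.1 j.2, 0); (Defs.cut D j.1 j.2.+1, 0)]) h.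
  have {}h := proper_homotopic_compl (h _) pF.
  apply: (proper_homotopic_endsr _ (h _)) => [q _|q _]; first by rewrite /= flatK.
  by case=> ->; [left|right].
have e : f @` S = S.
  by apply: shape_surjective pf hf; rewrite (cut_gt cutP) (cut_lt cutP).
apply/seteqP; split=> [_ [q Yq <-]|_ [q Sq <-]]; first exact: unmark_piece.
have : (f @` S) q by rewrite e.
move=> [z Sz <-]; exists (mark D j (ray_plane j.1 z)); first by apply: mark_Y1; exists z.
rewrite /f /=.
have [+ _ _] := piece_flat cutP (unmark_piece j (mark_Y1 (ex_intro2 _ _ z Sz erefl))).
by [].
Qed.

(** Conjugating by the marking, rather than reflecting the loop of the piece,
    makes rigid maps carry flips to flips. *)
Definition flip_piece j : ambient -> ambient := unmark D j \o (@flip R \o mark D j).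

Lemma proper_flip_piece j : proper_on (piece j) (piece j) (flip_piece j).
Proof.
apply: proper_on_comp (unmark_proper D j).
exact: proper_on_comp (mark_proper D j) (@proper_flip R).
Qed.

Lemma flip_piece_surjective j p : piece j p ->
  exists2 p', piece j p' & flip_piece j p' = p.
Proof.
rewrite -{1}(unmark_surjective j) => -[q Yq <-].
have : Y1 (flip q) by exact: flip_Y1.
rewrite -(mark_surjective j) => -[p' jp' e]; exists p' => //.
by rewrite /flip_piece /= e flip_flip.
Qed.

Lemma flip_piece_self j : piece_self (Defs.cut D) j (flip_piece j).
Proof.
have [cf fj _] := proper_flip_piece j; split=> // p pj.
by rewrite /flip_piece /= flip_ends ?unmark_mark_ends//; exact: mark_ends.
Qed.

Lemma unmark_mark_self j : piece_self (Defs.cut D) j (unmark D j \o mark D j).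
Proof.
have [cf fj _] := proper_on_comp (mark_proper D j) (unmark_proper D j).
by split=> // p pj; exact: unmark_mark_ends.
Qed.

Lemma id_self j : piece_self (Defs.cut D) j id.
Proof. by split=> //; apply: continuous_subspaceT => p; exact: cvg_id. Qed.

(** Composites of rigid maps and flips are simplified by this. *)
Lemma cancel_mark_unmark (X : topologicalType) (A : set X) (B : set ambient)
    (E : set X) j (f : X -> R * R) (g : R * R -> ambient) :
  proper_on A Y1 f -> (forall x, A x -> E x -> Y1_ends (f x)) ->
  proper_on Y1 B g ->
  proper_homotopic R A B E (g \o ((mark D j \o unmark D j) \o f)) (g \o f).
Proof.
move=> pf fE pg; apply: proper_homotopic_compl pg.
have := proper_homotopic_compr_rel (@norm_hausdorff _ _) pf fE (mark_unmark D j).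
by [].
Qed.

Lemma flip_piece_flip_piece j :
  proper_homotopic R (piece j) (piece j) (ends j) (flip_piece j \o flip_piece j) id.
Proof.
apply: proper_homotopic_trans (unmark_mark D j).
have pfm := proper_on_comp (mark_proper D j) (@proper_flip R).
have puf := proper_on_comp (@proper_flip R) (unmark_proper D j).
have := @cancel_mark_unmark _ _ _ (ends j) j _ _ pfm _ puf.
move=> h; apply: (proper_homotopic_endsr _ (h _)) => [p jp|p jp pj].
  by rewrite /= flip_flip//; exact: mark_Y1.
by rewrite /= flip_ends; exact: mark_ends.
Qed.

Definition flip_cell j c : ambient -> ambient :=
  if c == Some j then flip_piece j else id.

Definition loop_flip j : ambient -> ambient := glue (Defs.cut D) id (flip_cell j).

Lemma cell_selfI (a : option J -> ambient -> ambient) :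
  a None = id -> (forall k, piece_self (Defs.cut D) k (a (Some k))) -> cell_self (Defs.cut D) a.
Proof. by move=> a0 ak; split=> // p _; rewrite a0. Qed.

Lemma flip_cell_self j : cell_self (Defs.cut D) (flip_cell j).
Proof.
apply: cell_selfI => // k; rewrite /flip_cell; case: eqP => [[->]|_].
  exact: flip_piece_self.
exact: id_self.
Qed.

Lemma id_cell_self : cell_self (Defs.cut D) (fun=> id).
Proof. by apply: cell_selfI => // k; exact: id_self. Qed.

Lemma loop_flip_id j c p : cell c p -> c <> Some j -> loop_flip j p = p.
Proof.
move=> cp cj; rewrite /loop_flip (glue_selfE cutP (flip_cell_self j) cp) /flip_cell.
by case: eqP cj.
Qed.

Lemma loop_flip_piece j p : piece j p -> loop_flip j p = flip_piece j p.
Proof.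
move=> jp; rewrite /loop_flip (glue_selfE cutP (flip_cell_self j) (c := Some j) jp).
by rewrite /flip_cell eqxx.
Qed.

Lemma proper_loop_flip j : proper_on Gamma Gamma (loop_flip j).
Proof. exact (glue_self_proper cutP (flip_cell_self j)). Qed.

Lemma flip_flip_cell_homotopic j k :
  proper_homotopic R (piece k) (piece k) (ends k)
    (flip_cell j (Some k) \o flip_cell j (Some k)) id.
Proof.
rewrite /flip_cell; case: eqP => [[->]|_]; first exact: flip_piece_flip_piece.
exact: proper_homotopic_refl (proper_on_id _).
Qed.

Lemma glue_id p : Gamma p -> glue (Defs.cut D) id (fun=> id) p = p.
Proof. by move=> /(Gamma_cell cutP)[c cp]; rewrite (glue_selfE cutP id_cell_self cp). Qed.

Lemma loop_flip_loop_flip j :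
  proper_homotopic R Gamma Gamma set0 (loop_flip j \o loop_flip j) id.
Proof.
have [h E] := glue_self_comp cutP (flip_cell_self j) (flip_cell_self j).
apply: (proper_homotopic_endsl E); apply: (proper_homotopic_endsr glue_id).
exact: (glue_homotopic cutP h id_cell_self (@flip_flip_cell_homotopic j)).
Qed.

Lemma loop_flip_loop_flip_ball j N :
  proper_homotopic R (ball_graph (Defs.cut D) N) (ball_graph (Defs.cut D) N) set0
    (loop_flip j \o loop_flip j) id.
Proof.
have [h E] := glue_self_comp cutP (flip_cell_self j) (flip_cell_self j).
have sub := @ball_graph_Gamma _ _ _ cutP N.
apply: (proper_homotopic_endsl (fun p bp => E p (sub p bp))).
apply: (proper_homotopic_endsr (fun p bp => glue_id (sub p bp))).
exact: (glue_homotopic_ball cutP N h id_cell_self (@flip_flip_cell_homotopic j)).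
Qed.

Lemma loop_flip_heq j : proper_heq R Gamma Gamma (loop_flip j).
Proof.
have p := proper_loop_flip j; split=> //; exists (loop_flip j).
by split=> //; exact: loop_flip_loop_flip.
Qed.

Definition phe_flip j : phe Gamma := Phe (loop_flip_heq j).

Definition flip_class j : map_Gamma R r := mclass (phe_flip j).

Lemma mclass_mul (f g : phe Gamma) :
  (mclass f * mclass g)%g = mclass (phe_comp f g).
Proof. by rewrite mclass_comp. Qed.

Lemma mclass_one : mclass (phe_one Gamma) = 1%g.
Proof. by []. Qed.

Lemma flip_class_sq j : (flip_class j * flip_class j)%g = 1%g.
Proof. by rewrite mclass_mul -mclass_one; apply/mclassP; exact: loop_flip_loop_flip. Qed.

Lemma flip_class_commute j k : (flip_class j * flip_class k)%g = (flip_class k * flip_class j)%g.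
Proof.
rewrite !mclass_mul; apply/mclassP => /=.
apply: proper_homotopic_eq.
  exact: proper_on_comp (proper_loop_flip k) (proper_loop_flip j).
move=> p /(Gamma_cell cutP)[c cp] /=.
have [->//|jk] := eqVneq j k.
have h (j' : J) : cell c (loop_flip j' p) by exact: (glue_homo cutP (flip_cell_self j') cp).
have [cj|/eqP cj] := eqVneq c (Some j).
  by rewrite !(@loop_flip_id k c)// cj => -[/eqP]; rewrite (negbTE jk).
by rewrite !(@loop_flip_id j c).
Qed.

(** * The flips belong to the graph Houghton group *)

(** The flip of the piece [j] as an asymptotically rigid map: beyond the ball that
    contains [j], the identity is replaced by the rigid maps of the pieces to
    themselves, to which it is homotopic. *)
Definition rigid_flip_cell j c : ambient -> ambient :=
  if c is Some k then
    if k == j then flip_piece j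
    else if (k.2 <= j.2)%N then id else unmark D k \o mark D k
  else id.

Lemma rigid_flip_cell_self j : cell_self (Defs.cut D) (rigid_flip_cell j).
Proof.
apply: cell_selfI => // k; rewrite /rigid_flip_cell; case: eqP => [->|_].
  exact: flip_piece_self.
by case: ifP => _; [exact: id_self|exact: unmark_mark_self].
Qed.

Definition rigid_flip j : ambient -> ambient := glue (Defs.cut D) id (rigid_flip_cell j).

Lemma rigid_flip_homotopic j :
  proper_homotopic R Gamma Gamma set0 (rigid_flip j) (loop_flip j).
Proof.
apply: (glue_homotopic cutP (rigid_flip_cell_self j) (flip_cell_self j)) => k.
rewrite /rigid_flip_cell /flip_cell (inj_eq Some_inj); case: eqP => [->|_].
  exact: proper_homotopic_refl (proper_flip_piece j).
case: ifP => _; first exact: proper_homotopic_refl (proper_on_id _).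
exact: unmark_mark.
Qed.

Lemma proper_heq_homotopic (f g : ambient -> ambient) :
  proper_on Gamma Gamma f -> proper_homotopic R Gamma Gamma set0 f g ->
  proper_heq R Gamma Gamma g -> proper_heq R Gamma Gamma f.
Proof.
move=> pf fg [pg [h [ph hg gh]]]; split=> //; exists h; split=> //.
  exact: proper_homotopic_trans (proper_homotopic_compl fg ph) hg.
apply: proper_homotopic_trans gh.
exact: proper_homotopic_compr (@hausdorff_ambient R r) ph fg.
Qed.

Lemma rigid_flip_heq j : proper_heq R Gamma Gamma (rigid_flip j).
Proof.
apply: proper_heq_homotopic (loop_flip_heq j); last exact: rigid_flip_homotopic.
exact (glue_self_proper cutP (rigid_flip_cell_self j)).
Qed.

Lemma finite_ball_index N : finite_set [set j : J | (j.2 < N)%N].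
Proof.
apply: (@sub_finite_set _ _ (setT `*` `I_N)) => [[i k]|] //.
by apply: finite_setX; [exact: finite_finset|exact: finite_II].
Qed.

Lemma ball_graph_suited N : suited (Defs.cut D) (ball_graph (Defs.cut D) N).
Proof.
split; first exact: ball_graph_connected cutP N.
by exists [set j | (j.2 < N)%N] => //; exact: finite_ball_index.
Qed.

(** The top of the loop of a piece is an interior point of the piece. *)
Lemma piece_closure_ball k N :
  piece k `<=` closure (Gamma `\` ball_graph (Defs.cut D) N) -> (N <= k.2)%N.
Proof.
move=> h; rewrite leqNgt; apply/negP => kN.
pose x := k.2.+1%:R : R; pose p0 := ray_plane k.1 (x, 2^-1).
have /h clp0 : piece k p0 by exists (x, 2^-1) => //; right; exact: loop_top.
have p0E : p0.1 0 k.1 = x by rewrite coord_ray_plane eqxx.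
have lo : x - 2^-1 < p0.1 0 k.1 by rewrite p0E gtrBl invr_gt0 ltr0n.
have hi : p0.1 0 k.1 < x + 2^-1 by rewrite p0E ltrDl invr_gt0 ltr0n.
have up : 0 < p0.2 by rewrite /= invr_gt0 ltr0n.
have nlo : nbhs p0 [set p : ambient | x - 2^-1 < p.1 0 k.1].
  exact: (@continuous_coord R r k.1 p0 _ (lt_nbhsr lo)).
have nhi : nbhs p0 [set p : ambient | p.1 0 k.1 < x + 2^-1].
  exact: (@continuous_coord R r k.1 p0 _ (lt_nbhsl hi)).
have nup : nbhs p0 [set p : ambient | 0 < p.2].
  exact: (@continuous_snd_prod _ _ p0 _ (lt_nbhsr up)).
have [p [[/(Gamma_cell cutP)[c cp] nb] [/= plo [phi pup]]]] :=
  clp0 _ (filterI nlo (filterI nhi nup)).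
apply: nb; apply/ball_graph_cell; exists c => //.
case: c cp => [l|//] /= lp.
have x1 : 1 <= x by rewrite /x ler1n.
have e1 : l.1 = k.1.
  apply/eqP; apply: contraT => ne; have := piece_coord_other lp ne => e.
  by rewrite e in plo; have : False by lra.
have [pE _ _] := piece_flat cutP lp.
case: lp e1 => q qE qp e1; move: plo phi pup; rewrite -qp /= -e1 coord_ray_plane eqxx.
case: qE => [[_ ->]|/loop_bounds/andP[b1 b2]]; first by rewrite ltxx.
move=> plo phi _.
suff : l.2.+1%:R < k.2.+2%:R :> R by rewrite ltr_nat; lia.
by rewrite -[k.2.+2%:R]natr1 -/x; lra.
Qed.

Lemma rigid_flip_rigid j : asymptotically_rigid D (rigid_flip j).
Proof.
pose N := j.2.+1; pose Z := ball_graph (Defs.cut D) N.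
have fE c p : cell c p -> rigid_flip j p = rigid_flip_cell j c p.
  exact: (glue_selfE cutP (rigid_flip_cell_self j)).
have fc c p : cell c p -> cell c (rigid_flip j p).
  exact: (glue_homo cutP (rigid_flip_cell_self j)).
have fZ p : Z p -> rigid_flip j p = loop_flip j p.
  move=> /ball_graph_cell[c cN cp]; rewrite (fE _ _ cp).
  rewrite /loop_flip (glue_selfE cutP (flip_cell_self j) cp) /flip_cell.
  case: c cN {cp} => //= k kN; rewrite (inj_eq Some_inj).
  by case: eqP => // _; rewrite -ltnS kN.
(* the pieces in the ball other than j are fixed pointwise *)
have imZ : rigid_flip j @` Z = Z.
  apply/seteqP; split=> [_ [p /ball_graph_cell[c cN cp] <-]|p /[dup] Zp /ball_graph_cell[c cN cp]].
    by apply/ball_graph_cell; exists c => //; exact: fc.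
  have [cj|/eqP cj] := eqVneq c (Some j); last first.
    by exists p => //; rewrite fZ// (loop_flip_id cp cj).
  move: cp; rewrite cj => /flip_piece_surjective[p' jp' e].
  have Zp' : Z p' by apply/ball_graph_cell; exists (Some j).
  by exists p' => //; rewrite fZ// loop_flip_piece.
have cZ : compact Z by exact: compact_ball_graph.
have pZ : proper_on Z Z (rigid_flip j).
  apply: compact_proper_on => //.
  - have [cf _ _] := glue_self_proper cutP (rigid_flip_cell_self j).
    by apply: continuous_subspaceW cf; exact (@ball_graph_Gamma _ _ _ cutP N).
  - by move=> p Zp; rewrite -[X in X _]imZ; exists p.
exists Z; rewrite imZ; split.
- exact: ball_graph_suited.
- exact: ball_graph_suited.
- have hh : proper_homotopic R Z Z set0 (rigid_flip j \o rigid_flip j) id.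
    apply: proper_homotopic_endsl (loop_flip_loop_flip_ball j N) => p Zp /=.
    by rewrite -(fZ p)// -fZ//; have [_ h _] := pZ; exact: h.
  by split=> //; exists (rigid_flip j).
- move=> k kcl; have Nk := piece_closure_ball kcl.
  have kE p : piece k p -> rigid_flip j p = unmark D k (mark D k p).
    move=> kp; rewrite (fE (Some k))//= ifN ?ifN//; first by rewrite -ltnNge.
    by apply: contraTneq Nk => ->; rewrite ltnn.
  exists k; split=> //; apply/seteqP; split=> [_ [p kp <-]|p].
    by rewrite kE//; apply: unmark_piece; exact: mark_Y1.
  rewrite -{1}(unmark_surjective k) => -[q + <-].
  rewrite -{1}(mark_surjective k) => -[p' kp' <-]; exists p' => //; exact: kE.
Qed.

Lemma flip_class_houghton j : graph_houghton D (flip_class j).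
Proof.
exists (Phe (rigid_flip_heq j)); last exact: rigid_flip_rigid.
by apply/mclassP; apply: proper_homotopic_sym; exact: rigid_flip_homotopic.
Qed.

End LoopFlips.

(** * The action on the marked pieces *)

Section Action.
Variables (R : realType) (r : nat) (D : rigid_structure R r).
Local Notation ambient := ('rV[R]_r * R)%type.
Local Notation J := ('I_r * nat)%type.
Local Notation piece := (piece (Defs.cut D)).
Local Notation core := (core (Defs.cut D)).
Local Notation minus := (piece_minus (Defs.cut D)).
Local Notation plus := (piece_plus (Defs.cut D)).
Local Notation cell := (cell (Defs.cut D)).
Local Notation Gamma := (Gamma R r).
Local Notation Y1 := (@Y1 R).
Local Notation ends := (piece_ends (Defs.cut D)).
Local Notation cutP := (@cut_bounds R r D).
Local Notation group := (map_Gamma R r).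
Implicit Types (i l : 'I_r) (j k : J) (c : option J) (p : ambient) (q : R * R)
  (x y : group).

Lemma unmark_Gamma j : proper_on Y1 Gamma (unmark D j).
Proof.
apply: compact_proper_on.
- exact: hausdorff_ambient.
- exact: compact_Y1.
- exact: within_unmark.
- by move=> q Yq; apply: piece_Gamma; exact: unmark_piece.
Qed.

(** The action on free homotopy classes of maps of Y^1, restricted to the marked
    pieces: free homotopies require no base point and still detect flips. *)
Definition carries x j k : Prop :=
  proper_homotopic R Y1 Gamma set0 (repr x \o unmark D j) (unmark D k).

Lemma carries_mclass (f : phe Gamma) j k :
  proper_homotopic R Y1 Gamma set0 (f \o unmark D j) (unmark D k) ->
  carries (mclass f) j k.
Proof.
move=> h; apply: proper_homotopic_trans h.
have /mclassP e := mclass_repr (mclass f).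
exact: (proper_homotopic_compr (@hausdorff_ambient R r) (unmark_Gamma j) e).
Qed.

Lemma carries_one j : carries 1%g j j.
Proof.
rewrite -mclass_one; apply: carries_mclass => /=.
exact: proper_homotopic_refl (unmark_Gamma j).
Qed.

Lemma repr_mul x y j : proper_homotopic R Y1 Gamma set0
  (repr (x * y)%g \o unmark D j) (repr x \o (repr y \o unmark D j)).
Proof.
have /mclassP e : mclass (repr (x * y)%g) = mclass (phe_comp (repr x) (repr y)).
  by rewrite -mclass_mul !mclass_repr.
exact: (proper_homotopic_compr (@hausdorff_ambient R r) (unmark_Gamma j) e).
Qed.

Lemma carries_mul x y j k j' : carries y j k -> carries x k j' -> carries (x * y)%g j j'.
Proof.
move=> hy hx; apply: proper_homotopic_trans (repr_mul x y j) _.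
apply: proper_homotopic_trans hx.
by have [px _] := pheP (repr x); exact: (proper_homotopic_compl hy px).
Qed.

Lemma carries_inv x j k : carries x j k -> carries x^-1%g k j.
Proof.
move=> h; have [px _] := pheP (repr x^-1%g).
apply: proper_homotopic_trans (proper_homotopic_sym (proper_homotopic_compl h px)) _.
apply: proper_homotopic_trans (proper_homotopic_sym (repr_mul _ _ _)) _.
by rewrite mulVg; exact: carries_one.
Qed.

(** * The flip of a loop is not homotopic to the identity *)

(** A retraction of the graph onto the piece [j]; it is continuous because each
    component of the complement collapses to the end of [j] at which it is
    attached. *)
Definition retraction j : ambient -> ambient :=
  glue (Defs.cut D) id (fun c => if c is Some k then
    if k == j then id
    else if (k.1 == j.1) && (j.2 < k.2)%N then fun=> plus j else fun=> minus j
  else fun=> minus j).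

Lemma retractionE j c p : cell c p ->
  retraction j p = if c is Some k then
    if k == j then p
    else if (k.1 == j.1) && (j.2 < k.2)%N then plus j else minus j
  else minus j.
Proof.
move=> cp; rewrite /retraction (@glueE R r (Defs.cut D) _ _ id _ c p) //.
  by case: c cp => // k _; case: ifP => // _; case: ifP.
have adj (k k' : J) p' : k.1 = k'.1 -> k'.2 = k.2.+1 -> p' = plus k -> p' = minus k' ->
    (if k == j then id
    else if (k.1 == j.1) && (j.2 < k.2)%N then fun=> plus j else fun=> minus j) p' =
    (if k' == j then id
    else if (k'.1 == j.1) && (j.2 < k'.2)%N then fun=> plus j else fun=> minus j) p'.
  case: j k k' => [i m] [l n] [l' n'] /= <- -> {l' n'} ep em.
  rewrite !xpair_eqE.
  have [el|nl] /= := eqVneq l i; last by [].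
  subst l; have [nm|mn|e] := ltngtP n m.
  - rewrite ltnS leqNgt nm /=; case: eqP => [e|//].
    by rewrite em e.
  - by rewrite ltnS (ltnW mn) gtn_eqF//= ltnS ltnW.
  - by rewrite ep e ltnSn gtn_eqF.
have cadj (k : J) p' : k.2 = 0%N -> p' = minus k -> 
    (if k == j then id
    else if (k.1 == j.1) && (j.2 < k.2)%N then fun=> plus j else fun=> minus j) p' =
    minus j.
  move=> k0 ->; rewrite k0 ltn0 andbF; by case: eqP => [->|].
move=> c1 c2; case: c1 c2 => [k|] [k'|] //= kp kp'.
- have [->//|[e1 [e2 [e3 e4]]]|[e1 [e2 [e3 e4]]]] := piece_overlap cutP kp kp'.
    exact: adj.
  by apply/esym/adj.
- by have [e1 e2] := core_overlap cutP kp' kp; exact: cadj.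
- by have [e1 e2] := core_overlap cutP kp kp'; exact/esym/cadj.
Qed.

Lemma retraction_piece j p : piece j p -> retraction j p = p.
Proof. by move=> jp; rewrite (@retractionE j (Some j))// eqxx. Qed.

Lemma retraction_in j p : Gamma p -> piece j (retraction j p).
Proof.
have hm : piece j (minus j) by exact: (piece_has_minus cutP).
have hp : piece j (plus j) by exact: (piece_has_plus cutP).
move=> /(Gamma_cell cutP)[c cp]; rewrite (retractionE j cp).
by case: c cp => [k|//] kp; case: eqP => [<-//|_]; case: ifP.
Qed.

Lemma within_retraction j : {within Gamma, continuous (retraction j)}.
Proof.
have : {within setT `&` id @^-1` Gamma, continuous (retraction j)}.
  apply: (within_cells cutP) => //.
    by move=> p; exact: cvg_id.
  have cc (b : ambient) A : {within A, continuous (fun=> b : ambient)}.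
    by apply: continuous_subspaceT => p; exact: cvg_cst.
  move=> [k|]; rewrite setTI; last first.
    by apply: (@within_eq _ _ _ (fun=> minus j)) => // p /(@retractionE j None).
  apply: (@within_eq _ _ _ (if k == j then id
    else if (k.1 == j.1) && (j.2 < k.2)%N then fun=> plus j else fun=> minus j)).
    by move=> p /(@retractionE j (Some k)) ->; case: ifP => // _; case: ifP.
  case: ifP => _; last by case: ifP.
  by apply: continuous_subspaceT => p; exact: cvg_id.
by rewrite setTI.
Qed.

(** Retract the graph to the piece, read it through the marking and collapse Y^1 to
    its loop: a homotopy of the loops would become one from the reflection of a
    circle to the identity. *)
Lemma unmark_flip_not_homotopic j :
  ~ proper_homotopic R Y1 Gamma set0 (unmark D j \o @flip R) (unmark D j).
Proof.
move=> h.
pose L := @loop_at R 0.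
have LY : L `<=` Y1 by exact: subsetUr.
have cL : compact L by exact: compact_loop_at.
have hR2 : hausdorff_space (R * R)%type by exact: norm_hausdorff.
pose g := @collapse R 0 \o (mark D j \o retraction j).
have cg : {within Gamma, continuous g}.
  apply: within_comp (@continuous_collapse R (- 2^-1) 2^-1 0).
    by move=> p Gp /=; apply: mark_Y1; exact: retraction_in.
  apply: within_comp (within_mark (j := j)); last exact: within_retraction.
  by move=> p; exact: retraction_in.
have gL p : Gamma p -> L (g p).
  move=> Gp; apply: (@collapse_in _ (- 2^-1) 2^-1); apply: mark_Y1.
  exact: retraction_in.
have h1 := proper_homotopic_compl_compact hR2 cL cg gL
  (proper_homotopic_restrict hR2 cL LY h).
have h2 := proper_homotopic_compl_compact hR2 cL
  (@continuous_collapse R (- 2^-1) 2^-1 0) (@collapse_in R (- 2^-1) 2^-1 0)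
  (proper_homotopic_restrict hR2 cL LY (proper_homotopic_sub (@sub0set _ _) (mark_unmark D j))).
have gu q : Y1 q -> g (unmark D j q) = collapse 0 (mark D j (unmark D j q)).
  by move=> Yq; rewrite /g /= retraction_piece//; exact: unmark_piece.
have h3 : proper_homotopic R L L set0 (g \o unmark D j) id.
  apply: (proper_homotopic_endsl _ (proper_homotopic_endsr _ h2)) => q Lq /=.
    by rewrite gu//; exact: LY.
  exact: collapse_loop.
have pflip : proper_on L L (@flip R).
  apply: compact_proper_on => //.
  - exact: continuous_subspaceW (@continuous_flip R).
  - exact: flip_in_loop.
have h4 : proper_homotopic R L L set0 (g \o (unmark D j \o @flip R)) (@flip R).
  by have := proper_homotopic_compr hR2 pflip h3.
apply: (@flip_not_homotopic R); apply: proper_homotopic_trans h4.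
exact: proper_homotopic_trans (proper_homotopic_sym h3) (proper_homotopic_sym h1).
Qed.

Lemma flip_class_carries_other j k : k <> j -> carries (flip_class D j) k k.
Proof.
move=> kj; apply: carries_mclass.
have pu := unmark_Gamma k.
apply: proper_homotopic_endsl (proper_homotopic_refl _ _ pu) => q Yq /=.
rewrite (@loop_flip_id _ _ _ j (Some k))//; last by case.
exact: unmark_piece.
Qed.

Lemma flip_class_not_carries j : ~ carries (flip_class D j) j j.
Proof.
move=> h; apply: (@unmark_flip_not_homotopic j).
apply: proper_homotopic_trans h.
have /mclassP e := mclass_repr (flip_class D j).
have := proper_homotopic_compr (@hausdorff_ambient R r) (unmark_Gamma j) e.
move=> {}e; apply: proper_homotopic_trans (proper_homotopic_sym e).
have puf := proper_on_comp (@proper_flip R) (unmark_Gamma j).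
have := @cancel_mark_unmark _ _ D _ _ _ set0 j id (unmark D j \o @flip R) (proper_on_id _) _ puf.
move=> h2; apply: proper_homotopic_sym.
apply: (proper_homotopic_endsl _ (h2 _)) => // q Yq /=.
by rewrite loop_flip_piece//; exact: unmark_piece.
Qed.

Lemma carries_inj x j k j' : carries x j j' -> carries x k j' -> j = k.
Proof.
exact: (sends_inj carries_mul carries_inv flip_class_carries_other flip_class_not_carries).
Qed.

(** * Tails of rigid maps *)

Lemma minus_plus j k : minus j = plus k -> j.1 = k.1 /\ j.2 = k.2.+1.
Proof.
move=> e; have e1 : j.1 = k.1.
  apply/eqP; apply: contraT => ne.
  have := congr1 (fun p : ambient => p.1 0 j.1) e.
  rewrite !coord_ray_plane eqxx eq_sym (negbTE ne) /= => e0.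
  by have := cut_gt0 cutP j.1 j.2; rewrite e0 ltxx.
split=> //; move: e; rewrite /piece_minus /piece_plus e1.
move=> /(congr1 (flat k.1)); rewrite !flatK => -[e].
have lt1 : (j.2 < k.2.+2)%N.
  by rewrite -(ltr_nat R) (lt_trans (cut_gt cutP k.1 j.2))// e (cut_lt cutP).
have lt2 : (k.2.+1 < j.2.+1)%N.
  by rewrite -(ltr_nat R) (lt_trans (cut_gt cutP k.1 k.2.+1))// -e (cut_lt cutP).
by move: lt1 lt2; clear; lia.
Qed.

Definition rigid_tail (f : ambient -> ambient) i M l a : Prop :=
  forall n p, piece (i, (M + n)%N) p ->
    f p = unmark D (l, (a + n)%N) (mark D (i, (M + n)%N) p).

(** Rigid maps take inner ends to inner ends and outer ends to outer ends, so the
    next piece of the ray goes to the next piece. *)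
Lemma asymptotically_rigid_tail (f : ambient -> ambient) i :
  asymptotically_rigid D f -> exists M l a, rigid_tail f i M l a.
Proof.
move=> [Z [[_ [F finF ZE]] _ _ fZ]].
have [B hB] := finite_set_bounded (fun j : J => j.2) finF.
pose M := B.+1.
have /choice[pi piP] : forall n, exists k, forall p, piece (i, (M + n)%N) p ->
    f p = unmark D k (mark D (i, (M + n)%N) p).
  move=> n; have [|k [_ _ fk]] := fZ (i, (M + n)%N); last by exists k.
  move=> p jp; apply: subset_closure; split; first exact: piece_Gamma jp.
  rewrite ZE => -[cp|[j Fj kp]].
    by have [] := core_overlap cutP cp jp.
  have /= jB := hB _ Fj.
  have [e|[_ [/= e _]]|[_ [/= e _]]] := piece_overlap cutP jp kp.
  - by move: jB; rewrite -e /M /=; lia.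
  - by move: jB; rewrite /M; lia.
  - by move: jB; rewrite /M in e; lia.
have step n : (pi n.+1).1 = (pi n).1 /\ (pi n.+1).2 = (pi n).2.+1.
  apply: minus_plus.
  have [um up] := unmark_boundary D (pi n).
  have [um' up'] := unmark_boundary D (pi n.+1).
  have [mm mp] := mark_boundary D (i, (M + n)%N).
  have [mm' mp'] := mark_boundary D (i, (M + n.+1)%N).
  have e : minus (i, (M + n.+1)%N) = plus (i, (M + n)%N) by rewrite addnS.
  rewrite -um' -mm' -(piP n.+1); last exact: (piece_has_minus cutP).
  by rewrite e (piP n) ?mp ?up//; exact: (piece_has_plus cutP).
exists M, (pi 0%N).1, (pi 0%N).2 => n p jp; rewrite (piP n p jp).
suff <- : pi n = ((pi 0%N).1, ((pi 0%N).2 + n)%N) by [].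
elim: n {p jp} => [|n IHn]; first by rewrite addn0; case: (pi 0%N).
by have [e1 e2] := step n; rewrite [pi n.+1]surjective_pairing e1 e2 IHn addnS.
Qed.

Lemma rigid_tail_carries (f : phe Gamma) i M l a n : rigid_tail f i M l a ->
  carries (mclass f) (i, (M + n)%N) (l, (a + n)%N).
Proof.
move=> tf; apply: carries_mclass.
have := @cancel_mark_unmark _ _ D _ _ _ set0 (i, (M + n)%N) id _ (proper_on_id _) _
  (unmark_Gamma (l, (a + n)%N)).
move=> h; apply: (proper_homotopic_endsl _ (h _)) => // q Yq /=.
by rewrite (tf n)//; exact: unmark_piece.
Qed.

(** On the piece [j] both composites are homotopic to the marked flip followed by
    [unmark k].  Off [j] they agree as soon as [f] maps no other cell onto the
    piece [k]: another rigid piece has a different image by [carries_inj], and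
    the remaining cells form a compact set, whose image is bounded. *)
Lemma houghton_tail x i : graph_houghton D x -> exists M l a, forall n,
  carries x (i, (M + n)%N) (l, (a + n)%N) /\
  (x * flip_class D (i, (M + n)%N) = flip_class D (l, (a + n)%N) * x)%g.
Proof.
move=> [f -> rf].
have /choice[t tP] : forall i, exists t : nat * 'I_r * nat, rigid_tail f i t.1.1 t.1.2 t.2.
  by move=> i'; have [M [l [a h]]] := asymptotically_rigid_tail i' rf; exists (M, l, a).
pose B := \max_i (t i).1.1.
have BP i' : ((t i').1.1 <= B)%N by exact: (leq_bigmax i').
have [pf _] := pheP f; have [cf fG _] := pf.
have cfB : compact (f @` ball_graph (Defs.cut D) B).
  apply: continuous_compact; last exact: compact_ball_graph.
  exact: continuous_subspaceW (@ball_graph_Gamma _ _ _ cutP B) cf.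
have /filter_ex[N hN] := compact_coord_bounded cfB.
(* beyond B the map is rigid on every ray; from N on, its pieces miss the image of the ball *)
pose M := ((t i).1.1 + (B + N))%N; pose l := (t i).1.2; pose a := ((t i).2 + (B + N))%N.
have tf : rigid_tail f i M l a.
  by move=> n p; rewrite /M /a -!addnA; exact: tP.
exists M, l, a => n; split; first exact: rigid_tail_carries.
pose j : J := (i, (M + n)%N); pose k : J := (l, (a + n)%N).
rewrite -[(i, _)]/j -[(l, _)]/k /flip_class !mclass_mul; apply/mclassP => /=.
have pj := proper_loop_flip D j; have pk := proper_loop_flip D k.
apply: (homotopic_on_piece cutP (j := j)).
- exact: proper_on_comp pj pf.
- move=> c p cp cj; rewrite /= (loop_flip_id cp cj).
  suff [c' c'p c'k] : exists2 c', cell c' (f p) & c' <> Some k by rewrite (loop_flip_id c'p c'k).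
  have [cB|cB] := pselect (ball_graph (Defs.cut D) B p).
    have fp : (f @` ball_graph (Defs.cut D) B) (f p) by exists p.
    have /(Gamma_cell cutP)[c1 c1p] : Gamma (f p) by apply: fG; exact (cell_Gamma cutP cp).
    have /ball_graph_cell[c' c'N c'p] := cell_ball_graph cutP c1p (hN _ fp).
    by exists c' => // c'k; move: c'N; rewrite c'k /k /a /=; lia.
  case: c cp cj => [[i' m']|] cp cj; last by case: cB; left.
  have Bm' : (B <= m')%N.
    by rewrite leqNgt; apply/negP => lt; apply: cB; right; exists (i', m').
  have tm : ((t i').1.1 <= m')%N by exact: leq_trans (BP i') Bm'.
  pose k' : J := ((t i').1.2, ((t i').2 + (m' - (t i').1.1))%N).
  have e' : (i', m') = (i', ((t i').1.1 + (m' - (t i').1.1))%N) by rewrite subnKC.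
  exists (Some k').
    move: (cp); rewrite /= e' => /[dup] cp' /tP ->; apply: unmark_piece.
    exact: mark_Y1.
  move=> /Some_inj kk; apply: cj; congr Some.
  have s1 : carries (mclass f) (i', m') k'.
    by rewrite e'; exact: rigid_tail_carries (tP i').
  have s2 : carries (mclass f) j k by exact: rigid_tail_carries.
  by rewrite kk in s1; exact: carries_inj s1 s2.
- have fj p : piece j p -> f p = unmark D k (mark D j p) by exact: tf.
  have pm := mark_proper D j.
  have pfm := proper_on_comp pm (@proper_flip R).
  have puf := proper_on_comp (@proper_flip R) (unmark_Gamma k).
  have fe p : piece j p -> ends j p -> Y1_ends (flip (mark D j p)).
    by move=> _ pj'; rewrite flip_ends; exact: mark_ends.
  have me p : piece j p -> ends j p -> Y1_ends (mark D j p).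
    by move=> _; exact: mark_ends.
  have h1 := cancel_mark_unmark D j pfm fe (unmark_Gamma k).
  have h2 := cancel_mark_unmark D k pm me puf.
  have {}h1 : proper_homotopic R (piece j) Gamma (ends j) (f \o loop_flip D j)
      (unmark D k \o (@flip R \o mark D j)).
    apply: proper_homotopic_endsl h1 => p jp /=.
    rewrite loop_flip_piece// fj//.
    by have [_ h _] := proper_flip_piece D j; exact: h.
  have {}h2 : proper_homotopic R (piece j) Gamma (ends j) (loop_flip D k \o f)
      (unmark D k \o (@flip R \o mark D j)).
    apply: proper_homotopic_endsl h2 => p jp /=.
    rewrite fj// loop_flip_piece//.
    by apply: unmark_piece; exact: mark_Y1.
  exact: proper_homotopic_trans h1 (proper_homotopic_sym h2).
Qed.

End Action.

(** * One-endedness *)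

Theorem theorem8p1 (R : realType) (r : nat) (hr : (2 <= r)%N)
  (D : rigid_structure R r) (S : set (map_Gamma R r)) :
  finite_set S ->
  generated_by S = graph_houghton D ->
  number_of_ends (cayley (graph_houghton D) S) 1.
Proof.
move=> finS genS.
have i0 : 'I_r := Ordinal (ltnW hr).
have one := carries_one D; have mul := carries_mul (D := D); have inv := carries_inv (D := D).
have tails x i : graph_houghton D x -> exists M l a, moves_tail (flip_class D) (carries D) x i l M a.
  exact: houghton_tail.
apply: (cayley_one_end finS genS).
  exact: (infinite_group (@flip_class_houghton _ _ D) (@flip_class_carries_other _ _ D) (@flip_class_not_carries _ _ D) i0).
move=> A hA; apply: (almost_invariant_trivial finS genS (@flip_class_houghton _ _ D)
  (@flip_class_sq _ _ D) (@flip_class_commute _ _ D) one mul inv (@flip_class_carries_other _ _ D)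
  (@flip_class_not_carries _ _ D) tails i0).
exact: (almost_invariant_generators genS).
Qed.
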